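(* Let $T:\mathbb R\to\mathbb R\cup\{-\infty\}$ be a non-decreasing concave function satisfying: (i) there exist $\alpha>0$ and $c\in[0,1]$ with $T(q)\ge\alpha q-c$ for all $q\ge0$; (ii) $\mathrm{dom}(T)$ equals $\mathbb R$ or $\mathbb R_+$, and $T^*$ is non-negative on its domain; (iii) setting $q_0=\inf\{q\ge0:T(q)>0\}$, either $q_0>0$, or $T'(0^+)>0$ and $T(q)=T'(0^+)q$ for all $q>0$. Then there exists a homogeneously multifractal Hölder continuous function $F$ with $\mathrm{supp}(F)\subset[0,1]$ which satisfies the multifractal formalism (i.e. $\dim_H\underline E(F,h)=T_F^*(h)$ for all $h\in\mathbb R_+\cup\{\infty\}$) with $T_F=T$.
   Context: Work on $\mathbb R$. Fix an orthonormal wavelet basis $\{\psi_I\}$ indexed by dyadic intervals, with mother wavelet in the Schwartz class and the $\psi_I$ normalized to have equal supremum norm. For a bounded Hölder continuous $F:\mathbb R\to\mathbb R$ with wavelet coefficients $\{\lambda_I\}$, let $L_I=\sup|\lambda_{I'}|$ over dyadic $I'$ contained in $I$ or in one of the two neighboring dyadic intervals of the same generation as $I$. $I_n(x)$: closure of the dyadic interval $[k2^{-n},(k+1)2^{-n})$ containing $x$. $\mathrm{supp}(F)=\{x\in[0,1]:L_{I_n(x)}>0\ \forall n\ge1\}$. Pointwise Hölder exponent $h_F(x_0)=\sup\{h\ge0:\exists P\in\mathbb R[X],\ |F(x)-P(x-x_0)|=O(|x-x_0|^h)\}$; $\underline E(F,h)=\{x\in\mathrm{supp}(F):h_F(x)=h\}$;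 $\dim_H\emptyset=-\infty$. $G^*_n$ is the set of dyadic subintervals $I\subset[0,1]$ of length $2^{-n}$ with $L_I>0$, and $T_F(q)=\liminf_{n\to\infty}\frac{-1}{n}\log_2\sum_{I\in G^*_n}L_I^q$. $F$ is homogeneously multifractal if for every $h$, $\dim_H(\underline E(F,h)\cap B)$ does not depend on the ball $B$ whose interior intersects $\mathrm{supp}(F)$. $\mathrm{dom}(T)=\{q:T(q)>-\infty\}$. Extended Legendre transform for $T$ with $0\in\mathrm{dom}(T)$: $T^*(h)=\inf\{hq-T(q):q\in\mathrm{dom}(T)\}$ for $h\in\mathbb R$ and $T^*(\infty)=\inf\{\infty\cdot q-T(q):q\in\mathrm{dom}(T)\cap\mathbb R_-\}$, where $\infty\cdot q=-\infty$ for $q<0$ and $\infty\cdot0=0$. $T'(0^+)$ is the right derivative at $0$. *)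

(* Defs.v *)
From HB Require Import structures.
From mathcomp Require Import all_boot all_order all_algebra.
From mathcomp Require Import all_classical all_reals all_analysis.
Set Implicit Arguments. Unset Strict Implicit. Unset Printing Implicit Defensive.
Import Order.TTheory GRing.Theory Num.Theory.
Import numFieldNormedType.Exports.
Local Open Scope classical_set_scope.
Local Open Scope ring_scope.

Section Defs.
Variable R : realType.
Local Notation leb := (@lebesgue_measure R).

Definition schwartz (psi : R -> R) : Prop :=
  (forall (n : nat) (x : R), derivable (derive1n n psi) x 1) /\
  (forall m n : nat, exists C : R, forall x : R,
      `|x ^+ m * derive1n n psi x| <= C).

Definition psiL2 (psi : R -> R) (j k : int) (x : R) : R :=
  powR 2 (j%:~R / 2) * psi (powR 2 j%:~R * x - k%:~R).

Definition orthonormal_wavelet (psi : R -> R) : Prop :=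
  (forall j k j' k' : int,
     (\int[leb]_x (psiL2 psi j k x * psiL2 psi j' k' x)%:E)%E
       = (if (j == j') && (k == k') then 1 else 0)%:E) /\
  (forall f : R -> R, measurable_fun setT f ->
     (\int[leb]_x ((f x) ^+ 2)%:E < +oo)%E ->
     (forall j k : int, (\int[leb]_x (f x * psiL2 psi j k x)%:E)%E = 0%E) ->
     {ae leb, forall x, f x = 0}).

(** Wavelet coefficients in the L^infty normalisation
    (psi_I = psi(2^j x - k), I = [k 2^-j, (k+1) 2^-j)):
    F = sum lambda_{j,k} psi(2^j x - k), lambda_{j,k} = 2^j int F psi(2^j x - k). *)
Definition wcoef (psi F : R -> R) (j : nat) (k : int) : R :=
  2 ^+ j * Rintegral leb setT (fun x => F x * psi (2 ^+ j * x - k%:~R)).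

(** Wavelet leader of I = [k 2^-n, (k+1) 2^-n): sup of |lambda_{I'}| over
    dyadic I' contained in I or in one of its two neighbours of generation n,
    i.e. I' = [k' 2^-j', (k'+1) 2^-j') with j' >= n and
    I' included in [(k-1) 2^-n, (k+2) 2^-n). *)
Definition leader (psi F : R -> R) (n : nat) (k : int) : R :=
  sup [set r : R | exists (j' : nat) (k' : int),
        (n <= j')%N /\
        (k - 1)%:~R / 2 ^+ n <= k'%:~R / 2 ^+ j' :> R /\
        (k' + 1)%:~R / 2 ^+ j' <= (k + 2)%:~R / 2 ^+ n :> R /\
        r = `|wcoef psi F j' k'|].

Definition wsupp (psi F : R -> R) : set R :=
  [set x | 0 <= x <= 1 /\
     forall n : nat, (1 <= n)%N -> 0 < leader psi F n (Num.floor (2 ^+ n * x))].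

Definition bounded_real_fun (F : R -> R) : Prop := exists M : R, forall x, `|F x| <= M.

Definition holder_continuous (F : R -> R) : Prop :=
  exists gamma C : R, 0 < gamma /\
    forall x y : R, `|F x - F y| <= C * powR `|x - y| gamma.

Definition hexp (F : R -> R) (x0 : R) : \bar R :=
  ereal_sup [set h%:E | h in [set h : R | 0 <= h /\
     exists (P : {poly R}) (C delta : R), 0 < delta /\
       forall x, `|x - x0| < delta -> `|F x - P.[x - x0]| <= C * powR `|x - x0| h]].

Definition isoH (psi F : R -> R) (h : \bar R) : set R :=
  [set x | wsupp psi F x /\ hexp F x = h].

Definition diam (A : set R) : \bar R :=
  ereal_sup [set e | exists x y, A x /\ A y /\ e = (`|x - y|)%:E].

(** delta-Hausdorff content for s > 0 (diam of an empty piece counts as 0). *)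
Definition hcontent (s delta : R) (E : set R) : \bar R :=
  ereal_inf [set (\sum_(0 <= n <oo) (powR (fine (diam (U n))) s)%:E)%E
            | U in [set U : nat -> set R |
                     E `<=` \bigcup_n U n /\ forall n, (diam (U n) <= delta%:E)%E]].

Definition hmeasure (s : R) (E : set R) : \bar R :=
  ereal_sup [set hcontent s delta E | delta in [set delta : R | 0 < delta]].

Definition dimH (E : set R) : \bar R :=
  if `[< E = set0 >] then -oo%E
  else ereal_inf [set s%:E | s in [set s : R | 0 < s /\ hmeasure s E = 0%E]].

(** T_F(q) = liminf_n -1/n log_2 sum_{I in G*_n} L_I^q  (log_2 0 = -oo). *)
Definition scaling_fun (psi F : R -> R) (q : R) : \bar R :=
  limn_einf (fun n : nat =>
    let s := \sum_(0 <= k < 2 ^ n | 0 < leader psi F n k%:Z)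
               powR (leader psi F n k%:Z) q in
    if s == 0 then +oo%E else ((- (n%:R)^-1) * (ln s / ln 2))%:E).

Definition edom (T : R -> \bar R) : set R := [set q | (-oo < T q)%E].

(** Extended Legendre transform; the value at -oo is irrelevant. *)
Definition legendre (T : R -> \bar R) (h : \bar R) : \bar R :=
  match h with
  | EFin r => ereal_inf [set ((r * q)%:E - T q)%E | q in edom T]
  | +oo%E => ereal_inf [set (+oo * q%:E - T q)%E
                        | q in [set q | edom T q /\ q <= 0]]
  | -oo%E => -oo%E
  end.

Definition homogeneously_multifractal (psi F : R -> R) : Prop :=
  forall (h : \bar R) (x1 r1 x2 r2 : R), 0 < r1 -> 0 < r2 ->
    [set y | `|y - x1| < r1] `&` wsupp psi F !=set0 ->
    [set y | `|y - x2| < r2] `&` wsupp psi F !=set0 ->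
    dimH (isoH psi F h `&` [set y | `|y - x1| <= r1])
    = dimH (isoH psi F h `&` [set y | `|y - x2| <= r2]).

End Defs.

(* Main.v *)
Require Import Defs.
From HB Require Import structures.
From mathcomp Require Import all_boot all_order all_algebra.
From mathcomp Require Import all_classical all_reals all_analysis.
From mathcomp Require Import measurable_realfun.
From mathcomp Require Import ring lra zify.
Import Order.TTheory GRing.Theory Num.Theory.
Import numFieldNormedType.Exports.
Set Implicit Arguments.
Unset Strict Implicit.
Local Open Scope classical_set_scope.
Local Open Scope ring_scope.

(** [F] is a lacunary wavelet series carried by a tree of dyadic intervals.  Block [i] of the tree
    appends [(i+1)^2 + (i+1) + 2] binary digits: [i+1] digits encode a slope [h] and a number
    [a <= (i+1)^2 T^*(h)] of free digits, and the last two digits are [01], which keeps the nodes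
    of a level apart, so that a wavelet leader sees one branch only.  A node reached through the
    slopes [h_0, h_1, ...] carries the coefficient [2^-(sum_i h_i |block i|)], and all other
    coefficients vanish.

    The sum of the [q]-th powers of the leaders is a product over the blocks, whose factors are at
    most [2^(i+1) 2^(-T(q) |block i|)] because [a - q h |block i| <= -T(q) |block i|] by definition
    of [T^*]; equality of [T_F] and [T] comes from the branches with a constant slope supporting
    [T] at [q].  When the domain of [T] is [R_+] one code is reserved for the slope [+oo].

    The Hoelder exponent on a branch is the liminf of (minus the binary logarithm of the
    coefficient) / generation: it is not larger because all moments of a Schwartz orthonormal
    wavelet vanish, and not smaller by Taylor expansion of the wavelets.  Counting the nodes whose
    exponent is close to [h] bounds the dimension of the iso-Hoelder set by [h q - T(q)].
    Conversely, below any node, the branches of constant slope [h] are parametrized by their free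
    digits, and reading these digits is a map onto [[0, 1)] which is Hoelder of every order
    smaller than [T^*(h)]. *)

(** * Integrals of continuous functions *)

(** The construction is deterministic, and the block length is a compromise. Block [i] has length of
    order [i ^ 2] whereas the generations reached before it are of order [i ^ 3], so that one block
    is negligible in every exponent and only the generations [gen m] matter. The [2 ^ i.+1] codes
    are subexponential in the block length, so that summing over all of them costs nothing in the
    limit; still they can hold a grid of slopes of mesh [1 / i.+1] whose range exhausts the
    half-line. The free digits fit into a block because [T^* <= - T(0) <= c <= 1].

    Every code is allowed below every node, whatever precedes it. This yields the product formula
    and the homogeneity, but also branches with oscillating slopes. They are harmless: the bound
    from above only uses that the weight falls in a window around [h] at infinitely many levels.

    The reserved slope grows with the block. For [q < 0] it drives the sums above every exponential;
    for [q > 0] its contribution is dominated; at [q = 0] it supplies the digits of [- T(0)], a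
    value at which no supporting slope need exist. *)

Section ContinuousIntegrals.
Variable R : realType.
Local Notation mu := (@lebesgue_measure R).
Local Notation intg f := (mu.-integrable setT (EFin \o f)).

Lemma continuous_integrable_le (f g : R -> R) : continuous f ->
  (forall x, `|f x| <= g x) -> intg g -> intg f.
Proof.
move=> cf fg ig; apply: (le_integrable measurableT _ _ ig).
  by apply/measurable_EFinP; exact: continuous_measurable_fun.
by move=> x _ /=; rewrite lee_fin (le_trans (fg x))// ler_norm.
Qed.

Lemma oneDsqrV_ge0 (x : R) : 0 <= (oneDsqr x)^-1.
Proof. by rewrite invr_ge0 (le_trans ler01) ?oneDsqr_ge1. Qed.

Lemma integrable_oneDsqrV : intg (fun x : R => (oneDsqr x)^-1).
Proof.
apply/integrableP; split.
  apply/measurable_EFinP; apply: continuous_measurable_fun.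
  exact: continuous_oneDsqrV.
under eq_integral => x _ do rewrite /= ger0_norm ?oneDsqrV_ge0//.
rewrite ge0_symfun_integralT; last 3 first.
- exact: oneDsqrV_ge0.
- exact: continuous_oneDsqrV.
- by move=> x; rewrite /oneDsqr /= sqrrN.
by rewrite (_ : [set x | 0%R <= x] = `[0%R, +oo[%classic) ?integral0y_oneDsqr ?ltry// set_itvE.
Qed.

Lemma integrable_oneDsqrV_le (f : R -> R) (C : R) : continuous f ->
  (forall x, `|f x| <= C / oneDsqr x) -> intg f.
Proof.
move=> cf fC; apply: (@continuous_integrable_le f (fun x => C * (oneDsqr x)^-1)) => //.
have /(integrableZl measurableT C) : intg (fun x : R => (oneDsqr x)^-1).
  exact: integrable_oneDsqrV.
by [].
Qed.

Lemma continuous_affine (a b : R) : continuous (fun x : R => a * x - b).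
Proof.
move=> x; apply: cvgB; last exact: cvg_cst.
by apply: cvgM; [exact: cvg_cst|exact: cvg_id].
Qed.

Lemma ge0_integral_affine (a b : R) (G : R -> R) : 0 < a -> continuous G ->
  (forall x, 0 <= G x) ->
  (\int[mu]_x (G x)%:E = a%:E * \int[mu]_x (G (a * x - b))%:E)%E.
Proof.
move=> a0 cG G0.
pose F (x : R) := a * x - b.
have dF (x : R) : is_derive x (1 : R) F a.
  rewrite /F; apply: is_derive_eq.
  by rewrite subr0 /GRing.scale/= mulr1.
have F' : derive1 F = cst a.
  by apply/funext => x; rewrite derive1E; apply/derive_val.
rewrite (@increasing_ge0_integration_by_substitutionT R F)//; last 6 first.
- by move=> x y xy; rewrite /F ltrD2r ltr_pM2l.
- by rewrite F'; exact: cst_continuous.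
- by rewrite F'; apply: is_cvg_cst.
- by rewrite F'; apply: is_cvg_cst.
- apply/cvgrNyPle => A; exists (a^-1 * (A + b)); split; first exact: num_real.
  by move=> x /ltW; rewrite /F lerBlDr ler_pdivlMl.
- apply/cvgryPge => A; exists (a^-1 * (A + b)); split; first exact: num_real.
  by move=> x /ltW; rewrite /F lerBrDr ler_pdivrMl.
rewrite -ge0_integralZl//; last 3 first.
- apply/measurable_EFinP; apply: continuous_measurable_fun => x.
  apply: continuous_comp; last exact: cG.
  exact: continuous_affine.
- by move=> x _; rewrite lee_fin.
- by rewrite lee_fin ltW.
by apply: eq_integral => x _; rewrite F' /= EFinM muleC.
Qed.

Lemma integrable_affine (a b : R) (G : R -> R) : 0 < a -> continuous G ->
  intg G -> intg (fun x => G (a * x - b)).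
Proof.
move=> a0 cG /integrableP[_ iG].
have cGa : continuous (fun x => G (a * x - b)).
  by move=> x; apply: continuous_comp; [exact: continuous_affine|exact: cG].
apply/integrableP; split.
  by apply/measurable_EFinP; apply: continuous_measurable_fun.
have := @ge0_integral_affine a b (fun x => `|G x|) a0.
rewrite /= in iG *; move=> E; move: iG; rewrite E//; last first.
  by move=> x; apply: continuous_comp; [exact: cG|exact: norm_continuous].
rewrite -lte_pdivlMl//.
by rewrite mulry gtr0_sg ?invr_gt0// mul1e.
Qed.

Lemma Rintegral_affine (a b : R) (G : R -> R) : 0 < a -> continuous G ->
  intg G -> \int[mu]_x G x = a * \int[mu]_x G (a * x - b).
Proof.
move=> a0 cG iG.
(* [p] and [n] stand in for the positive and negative parts: [G = p - n] with both terms
   nonnegative, continuous and integrable. *)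
pose n (x : R) : R := `|G x|; pose p (x : R) : R := G x + n x.
have cn : continuous n by move=> x; apply: continuous_comp; [exact: cG|exact: norm_continuous].
have cp : continuous p by move=> x; apply: cvgD; [exact: cG|exact: cn].
have Gpn x : G x = p x - n x by rewrite /p addrK.
have in_ : intg n by have := integrable_abse iG.
have ip : intg p by have := integrableD measurableT iG in_.
have H (f : R -> R) : continuous f -> (forall x, 0 <= f x) -> intg f ->
    \int[mu]_x f x = a * \int[mu]_x f (a * x - b).
  move=> cf f0 if_; rewrite /Rintegral (@ge0_integral_affine a b)//.
  rewrite fineM//; apply: (integrable_fin_num (mu := mu)) => //.
  exact: integrable_affine.
have n0 x : 0 <= n x by exact: normr_ge0.
have p0 x : 0 <= p x by rewrite /p /n; have := ler_norm (- G x); rewrite normrN; lra.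
under eq_Rintegral => x _ do rewrite Gpn.
rewrite RintegralB//.
rewrite (H p)// (H n)// -mulrBr -RintegralB//; last 2 first.
- exact: (@integrable_affine a b p).
- exact: (@integrable_affine a b n).
congr (_ * _); apply: eq_Rintegral => x _.
by rewrite -Gpn.
Qed.

End ContinuousIntegrals.

(** * Schwartz functions and their Taylor remainders *)

Section Elementary.
Variable R : realType.

Lemma expr1D_le (t : R) (K : nat) : 0 <= t -> (1 + t) ^+ K <= 2 ^+ K * (1 + t ^+ K).
Proof.
move=> t0; have tK : 0 <= t ^+ K by exact: exprn_ge0.
have [t1|/ltW t1] := leP t 1.
  apply: (@le_trans _ _ (2 ^+ K)); last by rewrite ler_peMr ?exprn_ge0//; lra.
  by apply: lerXn2r; rewrite ?nnegrE; lra.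
apply: (@le_trans _ _ ((2 * t) ^+ K)); first by apply: lerXn2r; rewrite ?nnegrE; lra.
by rewrite exprMn ler_wpM2l ?exprn_ge0//; lra.
Qed.

(** A bounded primitive of [(1 + |t|) ^ -2]: its unit increments dominate that function up to a
    factor 4, so sums over translates telescope. *)
Let g (t : R) : R := t / (1 + `|t|).

Lemma sigmoid_step (t : R) : ((1 + `|t|) ^+ 2)^-1 <= 4 * (g (t + 1) - g t).
Proof.
have aux (d n q : R) : 0 < d -> 0 < q -> q <= n * d -> d^-1 <= n / q.
  by move=> d0 q0 qnd; rewrite -[leLHS]mul1r ler_pdivrMr// mulrAC ler_pdivlMr// mul1r.
rewrite /g.
have [t0|t0] := leP 0 t.
  rewrite (ger0_norm t0) ger0_norm ?addr_ge0//.
  have -> : 4 * ((t + 1) / (1 + (t + 1)) - t / (1 + t)) = 4 / ((1 + t) * (2 + t)).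
    by field; apply/andP; split; lra.
  by apply: aux; nra.
have [t1|t1] := leP (t + 1) 0.
  rewrite (ler0_norm (ltW t0)) ler0_norm//.
  have -> : 4 * ((t + 1) / (1 - (t + 1)) - t / (1 - t)) = 4 / ((1 - t) * (- t)).
    by field; apply/andP; split; lra.
  by apply: aux; nra.
rewrite (ler0_norm (ltW t0)) gtr0_norm//.
have -> : 4 * ((t + 1) / (1 + (t + 1)) - t / (1 - t)) =
   4 * (1 - 2 * t - 2 * t ^+ 2) / ((2 + t) * (1 - t)).
  by field; apply/andP; split; lra.
have u0 : 0 < 1 - t by lra.
apply: aux; [by rewrite exprn_gt0|by rewrite mulr_gt0//; lra|].
have N1 : 1 <= 1 - 2 * t - 2 * t ^+ 2 by nra.
have N2 : 2 + t <= 4 * (1 - 2 * t - 2 * t ^+ 2) * (1 - t) by nra.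
by have := ler_wpM2r (ltW u0) N2; rewrite expr2 !mulrA.
Qed.

Lemma sum_translates_le (y : R) (n : nat) (P : pred nat) :
  \sum_(0 <= k < n | P k) ((1 + `|y - k%:R|) ^+ 2)^-1 <= 8.
Proof.
have step (t : R) : 0 <= ((1 + `|t|) ^+ 2)^-1 by rewrite invr_ge0 exprn_ge0// addr_ge0.
apply: (@le_trans _ _ (\sum_(0 <= k < n) ((1 + `|y - k%:R|) ^+ 2)^-1)).
  by rewrite [leLHS]big_mkcond; apply: ler_sum => k _; case: ifP.
(* The telescoped sum is at most [4 * (1 - (-1)) = 8]. *)
apply: (@le_trans _ _ (4 * (g (y + 1) - g (y + 1 - n%:R)))).
  elim: n => [|n IH]; first by rewrite big_nil subr0 subrr mulr0.
  rewrite big_nat_recr//=; have := sigmoid_step (y - n%:R).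
  have -> : y - n%:R + 1 = y + 1 - n%:R by ring.
  have -> : y + 1 - n.+1%:R = y - n%:R by rewrite -natr1; ring.
  lra.
have g1 (t : R) : -1 <= g t <= 1.
  have p : 0 < 1 + `|t| by rewrite ltr_pwDl.
  rewrite /g ler_pdivlMr// ler_pdivrMr// mulN1r mul1r.
  by have := ler_norm t; have := ler_norm (- t); rewrite normrN; lra.
by have /andP[_ ?] := g1 (y + 1); have /andP[? _] := g1 (y + 1 - n%:R); lra.
Qed.

End Elementary.

Section SchwartzKernel.
Variables (R : realType) (psi : R -> R).
Hypothesis Spsi : schwartz psi.
Local Notation D n := (derive1n n psi).

Lemma schwartz_decay (n K : nat) :
  exists C : R, 0 <= C /\ forall x, `|D n x| * (1 + `|x|) ^+ K <= C.
Proof.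
have [_ dec] := Spsi.
have [C0 H0] := dec 0%N n; have [CK HK] := dec K n.
have D0 x : `|D n x| <= C0 by have := H0 x; rewrite expr0 mul1r.
have DK x : `|D n x| * `|x| ^+ K <= CK by have := HK x; rewrite normrM normrX mulrC.
exists (2 ^+ K * (C0 + CK)); split.
  rewrite mulr_ge0 ?exprn_ge0// addr_ge0//; first exact: le_trans (D0 0).
  by apply: le_trans (DK 0); rewrite mulr_ge0 ?exprn_ge0.
move=> x; apply: (@le_trans _ _ (`|D n x| * (2 ^+ K * (1 + `|x| ^+ K)))).
  by rewrite ler_wpM2l ?expr1D_le.
rewrite mulrCA ler_wpM2l ?exprn_ge0// mulrDr mulr1.
exact: lerD.
Qed.

Lemma schwartz_is_derive (n : nat) (x : R) : is_derive x (1 : R) (D n) (D n.+1 x).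
Proof.
have [dpsi _] := Spsi.
by split; [exact: dpsi|rewrite derive1nS derive1E].
Qed.

Lemma schwartz_continuous (n : nat) : continuous (D n).
Proof.
have [dpsi _] := Spsi.
by move=> x; apply/differentiable_continuous/derivable1_diffP/dpsi.
Qed.

Definition taylor_rem (n M : nat) (y s : R) : R :=
  D n (y + s) - \sum_(l < M) D (n + l) y / l`!%:R * s ^+ l.

(** Differentiating in the increment lowers the order by one and raises the derivative by one, the
    recursion behind [taylor_rem_le]. *)
Lemma taylor_rem_is_derive (n M : nat) (y s : R) :
  is_derive s (1 : R) (taylor_rem n M.+1 y) (taylor_rem n.+1 M y s).
Proof.
have e1 : is_derive s (1 : R) (fun s => D n (y + s)) (D n.+1 (y + s)).
  have d1 : is_derive s (1 : R) (fun s : R => y + s) 1.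
    by apply: is_derive_eq; rewrite add0r mulr1.
  have := @is_derive1_comp _ (D n) (fun s : R => y + s) s _ _ (schwartz_is_derive n (y + s)) d1.
  by rewrite mulr1.
have e2 (l : nat) : is_derive s (1 : R) (fun s : R => D (n + l) y / l`!%:R * s ^+ l)
    (D (n + l) y / l`!%:R * (s ^+ l.-1 *+ l)).
  have := is_derive_poly ((D (n + l) y / l`!%:R) *: 'X^l) s.
  rewrite derivZ derivXn hornerZ hornerMn hornerXn.
  rewrite (_ : horner _ = fun s : R => D (n + l) y / l`!%:R * s ^+ l)//.
  by apply/funext => t; rewrite hornerZ hornerXn.
have e3 : is_derive s (1 : R) (fun s : R => \sum_(l < M.+1) D (n + l) y / l`!%:R * s ^+ l)
    (\sum_(l < M) D (n.+1 + l) y / l`!%:R * s ^+ l).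
  have -> : (fun s : R => \sum_(l < M.+1) D (n + l) y / l`!%:R * s ^+ l) =
     \sum_(l < M.+1) (fun s : R => D (n + l) y / l`!%:R * s ^+ l).
    by apply/funext => t; rewrite fct_sumE.
  have := is_derive_sum (fun l : 'I_M.+1 => e2 l).
  rewrite [X in is_derive _ _ _ X -> _]big_ord_recl /= mulr0n mulr0 add0r.
  rewrite (eq_bigr (fun l : 'I_M => D (n.+1 + l) y / l`!%:R * s ^+ l))// => l _.
  rewrite /bump /= add1n -addSnnS factS natrM -mulr_natl.
  rewrite -derive1nS -addSn add0n -mulr_natl.
  by field; rewrite addrC natr1 !pnatr_eq0 -lt0n fact_gt0.
exact: (@is_deriveB _ _ _ _ _ _ _ _ _ e1 e3).
Qed.

(** Iterated mean value theorem, without the factor [1 / M!]. The derivative need only be bounded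
    within [|s|] of [y], which lets its decay at [y] be used. *)
Lemma taylor_rem_le (M n : nat) (y s B : R) :
  (forall xi, `|xi - y| <= `|s| -> `|D (n + M) xi| <= B) ->
  `|taylor_rem n M y s| <= `|s| ^+ M * B.
Proof.
elim: M n s => [|M IH] n s HB.
  rewrite /taylor_rem big_ord0 subr0 expr0 mul1r; have := HB (y + s).
  by rewrite addn0; apply; rewrite [y + s]addrC addrK.
have r0 : taylor_rem n M.+1 y 0 = 0.
  rewrite /taylor_rem big_ord_recl /= expr0 addr0 addn0 fact0 divr1 mulr1.
  by rewrite big1 ?addr0 ?subrr// => i _; rewrite expr0n /= mulr0.
have cont : continuous (taylor_rem n M.+1 y).
  move=> t; apply/differentiable_continuous/derivable1_diffP.
  by have [] := taylor_rem_is_derive n M y t.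
have bd t : `|t| <= `|s| -> `|taylor_rem n.+1 M y t| <= `|s| ^+ M * B.
  move=> ts; apply: (@le_trans _ _ (`|t| ^+ M * B)).
    by apply: IH => xi xt; rewrite addSnnS; apply: HB; apply: le_trans ts.
  rewrite ler_wpM2r//; last by rewrite lerXn2r ?nnegrE.
  by apply: le_trans (HB y _); rewrite ?subrr ?normr0.
have [s0|s0] := leP 0 s.
  have [c] := @MVT_segment _ (taylor_rem n M.+1 y) (taylor_rem n.+1 M y) 0 s s0
    (fun x _ => taylor_rem_is_derive n M y x) (continuous_subspaceT cont).
  rewrite in_itv/= r0 !subr0 => /andP[c0 cs] ->.
  rewrite normrM mulrC exprS -mulrA ler_wpM2l//.
  by apply: bd; rewrite !ger0_norm.
have [c] := @MVT_segment _ (taylor_rem n M.+1 y) (taylor_rem n.+1 M y) s 0 (ltW s0)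
    (fun x _ => taylor_rem_is_derive n M y x) (continuous_subspaceT cont).
rewrite in_itv/= r0 !sub0r => /andP[c0 cs] E.
rewrite -normrN E normrM normrN mulrC exprS -mulrA ler_wpM2l//.
by apply: bd; rewrite !ler0_norm ?lerN2// ltW.
Qed.

(** The hypotheses on [M] say that it is the integer part of [h] plus one. The growing weight is
    paid for by the decay of [psi], and a square is left over on the right to sum over the
    translates. *)
Lemma schwartz_taylor_weight (h : R) (M : nat) : 0 <= h -> h < M%:R ->
  (forall l, (l < M)%N -> l%:R <= h) ->
  exists C : R, 0 <= C /\ forall y s,
    (1 + `|y|) `^ h * `|taylor_rem 0 M y s| <=
    C * `|s| `^ h * (((1 + `|y|) ^+ 2)^-1 + ((1 + `|y + s|) ^+ 2)^-1).
Proof.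
move=> h0 hM lh.
have [CM [CM0 HM]] := schwartz_decay M M.+2.
have [C0 [C00 H0]] := schwartz_decay 0 M.+2.
have /choice[Cl Hl] : forall l : nat, exists C : R, 0 <= C /\
  forall x, `|D l x| * (1 + `|x|) ^+ M.+2 <= C by move=> l; exact: schwartz_decay.
pose S : R := \sum_(l < M) Cl l.
have S0 : 0 <= S by apply: sumr_ge0 => l _; have [] := Hl l.
have one (t : R) : 1 <= 1 + `|t| by rewrite lerDl.
have pos (t : R) : 0 < 1 + `|t| by rewrite (lt_le_trans ltr01).
have weight (t : R) : (1 + `|t|) `^ h <= (1 + `|t|) ^+ M.
  by rewrite -powR_mulrn ?(ltW (pos _))// ler_powR// ltW.
have inv2 (f C t : R) : 0 <= f -> f * (1 + `|t|) ^+ M.+2 <= C ->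
    (1 + `|t|) `^ h * f <= C / (1 + `|t|) ^+ 2.
  move=> f0 fC; rewrite ler_pdivlMr ?exprn_gt0//; apply: le_trans fC.
  rewrite [_ * f]mulrC -mulrA ler_wpM2l// -(addn2 M) exprD.
  by apply: ler_wpM2r (weight t); rewrite exprn_ge0// ltW.
have i0 (t : R) : 0 <= ((1 + `|t|) ^+ 2)^-1 by rewrite invr_ge0 exprn_ge0// ltW.
pose C := 2 ^+ M.+2 * CM + S + 2 ^+ M * C0.
have pC : 0 <= C by rewrite /C !addr_ge0// mulr_ge0// exprn_ge0.
exists C; split=> // y s.
(* For a short increment the Taylor remainder is evaluated at points comparable to [y]. For a long
   one the function and the polynomial are bounded separately, by [1 + |y| <= 2 |s| (1 + |y + s|)]
   and by [|s| ^ l <= |s| ^ h]. *)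
have [s1|s1] := leP `|s| 1.
  have bd xi : `|xi - y| <= `|s| -> `|D (0 + M) xi| <= 2 ^+ M.+2 * CM / (1 + `|y|) ^+ M.+2.
    move=> xs; rewrite ler_pdivlMr ?exprn_gt0//.
    apply: (@le_trans _ _ (`|D M xi| * (2 * (1 + `|xi|)) ^+ M.+2)).
      rewrite ler_wpM2l// lerXn2r// ?nnegrE ?mulr_ge0 ?(ltW (pos _))//.
      have := ler_normB xi (xi - y); rewrite (_ : xi - (xi - y) = y); last by ring.
      have := normr_ge0 xi; lra.
    by rewrite exprMn mulrCA ler_wpM2l ?exprn_ge0.
  have sM : `|s| ^+ M <= `|s| `^ h.
    have [->|sn0] := eqVneq s 0.
      rewrite normr0 expr0n; case: M hM {lh HM CM CM0 H0 S S0 C pC weight inv2 Cl Hl bd C0 C00} => [|M _].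
        by move=> hM; move: (le_lt_trans h0 hM); rewrite ltxx.
      by rewrite /= powR_ge0.
    by rewrite -powR_mulrn// ger_powR ?(ltW hM)// normr_gt0 sn0.
  have := @taylor_rem_le M 0 y s _ bd => tr.
  have K0 : 0 <= 2 ^+ M.+2 * CM / (1 + `|y|) ^+ M.+2.
    apply: divr_ge0; first by apply: mulr_ge0 => //; exact: exprn_ge0.
    by apply: exprn_ge0; exact: ltW.
  apply: (@le_trans _ _ ((1 + `|y|) `^ h * (`|s| `^ h * (2 ^+ M.+2 * CM / (1 + `|y|) ^+ M.+2)))).
    rewrite ler_wpM2l ?powR_ge0//; apply: le_trans tr _.
    exact: ler_wpM2r sM.
  rewrite mulrCA [C * _]mulrC -[leRHS]mulrA ler_wpM2l ?powR_ge0//.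
  apply: (@le_trans _ _ (2 ^+ M.+2 * CM / (1 + `|y|) ^+ 2)).
    apply: inv2 => //.
    by rewrite divfK// expf_neq0// gt_eqF.
  apply: ler_pM => //; first by rewrite mulr_ge0// exprn_ge0.
    by rewrite /C -addrA lerDl addr_ge0// mulr_ge0// exprn_ge0.
  by rewrite lerDl.
have s0 : 0 < `|s| by rewrite (lt_trans ltr01).
have T1 : (1 + `|y|) `^ h * `|D 0 (y + s)| <=
    `|s| `^ h * (2 ^+ M * C0 / (1 + `|y + s|) ^+ 2).
  apply: (@le_trans _ _ ((2 * `|s| * (1 + `|y + s|)) `^ h * `|D 0 (y + s)|)).
    apply: ler_wpM2r => //; apply: ge0_ler_powR => //; rewrite ?nnegrE.
    - exact: ltW.
    - by apply: mulr_ge0; [apply: mulr_ge0|exact: ltW].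
    have := ler_normB (y + s) s; rewrite addrK => ys.
    have := normr_ge0 (y + s); nra.
  rewrite powRM ?mulr_ge0 ?(ltW (pos _))// powRM// -!mulrA mulrCA.
  rewrite ler_wpM2l ?powR_ge0//; apply: ler_pM; rewrite ?powR_ge0 ?mulr_ge0 ?powR_ge0//.
    by rewrite -powR_mulrn//; apply: ler_powR; [lra|exact: ltW].
  exact: inv2.
have T2 : (1 + `|y|) `^ h * `|\sum_(l < M) D (0 + l) y / l`!%:R * s ^+ l| <=
    `|s| `^ h * (S / (1 + `|y|) ^+ 2).
  apply: (@le_trans _ _ (\sum_(l < M) `|s| `^ h * (Cl l / (1 + `|y|) ^+ 2))); last first.
    by rewrite -mulr_sumr -mulr_suml.
  apply: (@le_trans _ _ (\sum_(l < M) (1 + `|y|) `^ h * `|D (0 + l) y / l`!%:R * s ^+ l|)).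
    by rewrite -mulr_sumr ler_wpM2l ?powR_ge0// ler_norm_sum.
  apply: ler_sum => l _; rewrite add0n.
  have [Cl0 HCl] := Hl l.
  apply: (@le_trans _ _ ((1 + `|y|) `^ h * (`|D l y| * `|s| `^ h))).
    rewrite ler_wpM2l ?powR_ge0// normrM normrX; apply: ler_pM => //.
      rewrite normrM ler_piMr// normfV normr_nat invf_le1 ?ltr0n ?fact_gt0//.
      by rewrite ler1n fact_gt0.
    by rewrite -powR_mulrn//; apply: ler_powR; [exact: ltW|exact: lh].
  rewrite [leLHS]mulrA [leLHS]mulrC; apply: ler_wpM2l; first exact: powR_ge0.
  exact: inv2.
rewrite /taylor_rem.
apply: (@le_trans _ _ ((1 + `|y|) `^ h * (`|D 0 (y + s)| + `|\sum_(l < M) D (0 + l) y / l`!%:R * s ^+ l|))).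
  by rewrite ler_wpM2l ?powR_ge0//; exact: ler_normB.
rewrite mulrDr; apply: (le_trans (lerD T1 T2)).
rewrite -mulrDr [C * _]mulrC -[leRHS]mulrA ler_wpM2l ?powR_ge0// mulrDr addrC; apply: lerD.
  by rewrite ler_wpM2r// /C; have := exprn_ge0 M.+2 (ler0n R 2); have := exprn_ge0 M (ler0n R 2); nra.
by rewrite ler_wpM2r// /C; have := exprn_ge0 M.+2 (ler0n R 2); nra.
Qed.

Lemma schwartz_taylor_sum (h : R) (M : nat) : 0 <= h -> h < M%:R ->
  (forall l, (l < M)%N -> l%:R <= h) ->
  exists C : R, 0 <= C /\ forall (y s : R) (n : nat) (P : pred nat),
    \sum_(0 <= k < n | P k) (1 + `|y - k%:R|) `^ h * `|taylor_rem 0 M (y - k%:R) s|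
    <= C * `|s| `^ h.
Proof.
move=> h0 hM lh; have [C [C0 HC]] := schwartz_taylor_weight h0 hM lh.
exists (C * 16); split; first by rewrite mulr_ge0.
move=> y s n P.
apply: (@le_trans _ _ (\sum_(0 <= k < n | P k) C * `|s| `^ h *
   (((1 + `|y - k%:R|) ^+ 2)^-1 + ((1 + `|(y + s) - k%:R|) ^+ 2)^-1))).
  by apply: ler_sum => k _; rewrite (_ : y + s - k%:R = y - k%:R + s)//; ring.
rewrite -mulr_sumr [C * 16 * _]mulrAC ler_wpM2l ?mulr_ge0 ?powR_ge0//.
rewrite big_split /=.
by have := sum_translates_le y n P; have := sum_translates_le (y + s) n P; lra.
Qed.

End SchwartzKernel.

(** * Vanishing moments *)

Lemma le0_of_geometric (R : realType) (a C : R) :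
  (forall j : nat, (0 < j)%N -> a <= C / 2 ^+ j) -> a <= 0.
Proof.
move=> H; rewrite leNgt; apply/negP => a0.
have [n nCa] : exists n : nat, C / a < n%:R.
  exists (Num.truncn `|C / a|).+1; apply: le_lt_trans (ler_norm _) _.
  exact: truncnS_gt.
have n2 : n%:R <= 2 ^+ n.+1 :> R.
  by rewrite -natrX ler_nat ltnW// (leq_trans (ltn_expl n (ltnSn 1)))// leq_pexp2l.
have := H n.+1 (ltn0Sn _); rewrite ler_pdivlMr ?exprn_gt0// leNgt => /negP; apply.
by rewrite mulrC -ltr_pdivrMr//; exact: lt_le_trans n2.
Qed.

Section Moments.
Variables (R : realType) (psi : R -> R).
Hypothesis Spsi : schwartz psi.
Local Notation D n := (derive1n n psi).
Local Notation mu := (@lebesgue_measure R).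
Local Notation intg f := (mu.-integrable setT (EFin \o f)).

Let psi_continuous : continuous psi := @schwartz_continuous R psi Spsi 0%N.

Lemma continuous_1Dnorm_exp (K : nat) : continuous (fun x : R => (1 + `|x|) ^+ K).
Proof.
move=> x; apply: (@continuous_comp _ _ _ (fun x : R => 1 + `|x|) (fun y : R => y ^+ K)).
  by apply: cvgD; [exact: cvg_cst|exact: norm_continuous].
exact: exprn_continuous.
Qed.

Lemma schwartz_mul_integrable (f : R -> R) (A : R) (K : nat) : continuous f ->
  (forall x, `|f x| <= A * (1 + `|x|) ^+ K) -> intg (fun x => f x * psi x).
Proof.
move=> cf fA; have [C [C0 HC]] := schwartz_decay Spsi 0 K.+2.
have A0 : 0 <= A by have := fA 0; rewrite normr0 addr0 expr1n mulr1; exact: le_trans.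
apply: (@integrable_oneDsqrV_le R _ (A * C)).
  by move=> x; apply: cvgM; [exact: cf|exact: psi_continuous].
move=> x; rewrite ler_pdivlMr; last by rewrite (lt_le_trans ltr01) ?oneDsqr_ge1.
apply: (@le_trans _ _ (A * (1 + `|x|) ^+ K * `|psi x| * (1 + `|x|) ^+ 2)).
  rewrite normrM; apply: ler_pM; [by rewrite mulr_ge0| |by rewrite ler_wpM2r|].
    by rewrite (le_trans ler01) ?oneDsqr_ge1.
  by rewrite /oneDsqr -(real_normK (num_real x)); have := normr_ge0 x; nra.
rewrite -!mulrA ler_wpM2l//; apply: le_trans (HC x).
by rewrite mulrCA -exprD addn2.
Qed.

Lemma schwartz_bounded : exists C : R, 0 <= C /\ forall x, `|psi x| <= C.
Proof.
have [C [C0 HC]] := schwartz_decay Spsi 0 0.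
by exists C; split => // x; have := HC x; rewrite expr0 mulr1.
Qed.

Lemma continuous_affine_schwartz (a b : R) : continuous (fun x => psi (a * x - b)).
Proof. by move=> x; apply: continuous_comp; [exact: continuous_affine|exact: psi_continuous]. Qed.

Lemma schwartz_affine_integrable (f : R -> R) (A a b : R) : 0 < a -> continuous f ->
  (forall x, `|f x| <= A) -> intg (fun x => f x * psi (a * x - b)).
Proof.
move=> a0 cf fA.
pose f' (y : R) : R := f (a^-1 * y - (- (a^-1 * b))).
have cf' : continuous f'.
  by move=> x; apply: (@continuous_comp _ _ _ (fun y : R => a^-1 * y - (- (a^-1 * b))) f);
   [exact: continuous_affine|exact: cf].
have : intg (fun x => f' x * psi x).
  apply: (@schwartz_mul_integrable _ A 0) => // x.
  by rewrite expr0 mulr1 fA.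
move=> /(@integrable_affine R a b _ a0); rewrite (_ : EFin \o _ = EFin \o (fun x => f x * psi (a * x - b))).
  by apply => x; apply: cvgM; [exact: cf'|exact: psi_continuous].
apply/funext => x; rewrite /= /f'; congr (f _ * _)%:E.
by field; rewrite gt_eqF.
Qed.

Definition schwartz_weight (K : nat) : R := \int[mu]_x ((1 + `|x|) ^+ K * `|psi x|).

Lemma schwartz_weight_integrable (K : nat) : intg (fun x => (1 + `|x|) ^+ K * `|psi x|).
Proof.
have : intg (fun x => (1 + `|x|) ^+ K * psi x).
  apply: (@schwartz_mul_integrable _ 1 K); first exact: continuous_1Dnorm_exp.
  by move=> x; rewrite mul1r ger0_norm ?exprn_ge0// addr_ge0.
move=> /integrable_abse; rewrite (_ : abse \o _ = EFin \o (fun x => (1 + `|x|) ^+ K * `|psi x|))//.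
apply/funext => x /=; rewrite normrM [in LHS](@ger0_norm _ (_ ^+ _))// exprn_ge0// addr_ge0//.
Qed.

Lemma schwartz_weight_ge0 (K : nat) : 0 <= schwartz_weight K.
Proof.
by apply: Rintegral_ge0 => x _; rewrite mulr_ge0// exprn_ge0// addr_ge0.
Qed.

(** For [a] a power of two the left side is the modulus of a wavelet coefficient, controlled by the
    growth of [f] at the scale of the wavelet. *)
Lemma schwartz_integral_le (f : R -> R) (A a b : R) (K : nat) : 0 < a -> continuous f ->
  (forall x, `|f x| <= A * (1 + `|a * x - b|) ^+ K) ->
  intg (fun x => f x * psi (a * x - b)) ->
  a * `|\int[mu]_x (f x * psi (a * x - b))| <= A * schwartz_weight K.
Proof.
move=> a0 cf fA ifp.
pose G (y : R) : R := (1 + `|y|) ^+ K * `|psi y|.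
have cG : continuous G.
  move=> y; apply: cvgM; first exact: continuous_1Dnorm_exp.
  by apply: continuous_comp; [exact: psi_continuous|exact: norm_continuous].
have iG : intg G by exact: schwartz_weight_integrable.
have iGa : intg (fun x => G (a * x - b)) by exact: integrable_affine.
have -> : A * schwartz_weight K = a * \int[mu]_x (A * G (a * x - b)).
  rewrite /schwartz_weight (@Rintegral_affine R a b G)// RintegralZl//.
  by rewrite mulrCA.
rewrite ler_pM2l//; apply: (le_trans (le_normr_Rintegral _ _)) => //.
apply: le_Rintegral => //.
- by have := integrable_abse ifp.
- by have := integrableZl measurableT A iGa.
by move=> x _; rewrite normrM /G mulrA ler_wpM2r.
Qed.

Definition moment (m : nat) : R := \int[mu]_x (x ^+ m * psi x).

Lemma moment_integrable (m : nat) : intg (fun x => x ^+ m * psi x).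
Proof.
apply: (@schwartz_mul_integrable _ 1 m); first exact: exprn_continuous.
by move=> x; rewrite mul1r normrX lerXn2r// ?nnegrE ?addr_ge0// lerDr.
Qed.

Lemma integral_sum_moment (c : nat -> R) (n : nat) :
  intg (fun x => (\sum_(l < n) c l * x ^+ l) * psi x) /\
  \int[mu]_x ((\sum_(l < n) c l * x ^+ l) * psi x) = \sum_(l < n) c l * moment l.
Proof.
elim: n => [|n [IHi IH]].
  split.
    rewrite (_ : EFin \o _ = cst 0%E); first exact: integrable0.
    by apply/funext => x /=; rewrite big_ord0 mul0r.
  rewrite big_ord0; under eq_Rintegral => x _ do rewrite big_ord0 mul0r.
  by rewrite Rintegral_cst// mul0r.
have E : (fun x : R => (\sum_(l < n.+1) c l * x ^+ l) * psi x) =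
   (fun x => (\sum_(l < n) c l * x ^+ l) * psi x + c n * (x ^+ n * psi x)).
  by apply/funext => x; rewrite big_ord_recr /= mulrDl mulrA.
have iZ : intg (fun x => c n * (x ^+ n * psi x)).
  by have := integrableZl measurableT (c n) (moment_integrable n).
rewrite E big_ord_recr /= -IH; split.
  by have := integrableD measurableT IHi iZ.
by rewrite RintegralD// RintegralZl//; exact: moment_integrable.
Qed.

Hypothesis Opsi : orthonormal_wavelet psi.

Lemma wavelet_orthogonality (j j' : nat) (k k' : int) :
  \int[mu]_x (psi (2 ^+ j * x - k%:~R) * psi (2 ^+ j' * x - k'%:~R))
  = if (j == j') && (k == k') then (2 ^+ j)^-1 else 0.
Proof.
have [orth _] := Opsi.
have := orth j k j' k'.
pose c (j : nat) : R := 2 `^ (j%:R / 2).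
have cE (i : nat) (l : int) x : psiL2 psi i l x = c i * psi (2 ^+ i * x - l%:~R).
  by rewrite /psiL2 /c -pmulrn powR_mulrn.
have c0 i : c i != 0 by rewrite gt_eqF// powR_gt0.
have c2 i : c i * c i = 2 ^+ i.
  by rewrite /c -powRD ?pnatr_eq0 ?implybT// (_ : i%:R / 2 + i%:R / 2 = i%:R); [rewrite powR_mulrn|field].
have [A [A0 HA]] := schwartz_bounded.
have i12 : intg (fun x => psi (2 ^+ j * x - k%:~R) * psi (2 ^+ j' * x - k'%:~R)).
  apply: (@schwartz_affine_integrable _ A); rewrite ?exprn_gt0//.
  exact: continuous_affine_schwartz.
have -> : (\int[mu]_x (psiL2 psi j k x * psiL2 psi j' k' x)%:E)%E =
  (\int[mu]_x ((c j * c j') * (psi (2 ^+ j * x - k%:~R) * psi (2 ^+ j' * x - k'%:~R)))%:E)%E.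
  by apply: eq_integral => x _; rewrite !cE; congr EFin; ring.
move=> /(congr1 fine); rewrite -/(Rintegral _ _ _) RintegralZl// eqz_nat /=.
move=> E; apply: (mulfI (mulf_neq0 (c0 j) (c0 j'))); rewrite E.
case: ifP => // [/andP[/eqP <- _]|_]; last by rewrite mulr0.
by rewrite c2 mulfV// expf_neq0.
Qed.

(** If a derivative vanishes, the preceding one is constant, and a constant that decays at infinity
    is zero. *)
Lemma schwartz_cst0 (m : nat) : (forall x, D m x = 0) -> forall x, psi x = 0.
Proof.
elim: m => [//|m IH] H; apply: IH => x.
have const y : D m y = D m x.
  have : `|taylor_rem psi m 1 x (y - x)| <= `|y - x| ^+ 1 * 0.
    by apply: (taylor_rem_le Spsi) => xi _; rewrite addn1 H normr0.
  rewrite mulr0 normr_le0 /taylor_rem big_ord1 expr0 addn0 fact0 divr1 mulr1.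
  by rewrite (_ : x + (y - x) = y) ?subr_eq0 => [/eqP|]//; ring.
have [C [C0 HC]] := schwartz_decay Spsi m 1.
apply/eqP; rewrite -normr_eq0 eq_le normr_ge0 andbT.
apply: (@le0_of_geometric R _ C) => j _.
have := HC (2 ^+ j); rewrite const expr1 ler_pdivlMr ?exprn_gt0//; apply: le_trans.
by rewrite ler_wpM2l// ger0_norm ?exprn_ge0// lerDr.
Qed.

(* Expanding [psi] at the dyadic point [k / 2^j] inside the orthogonality relation
   [int psi(x) psi(2^j x - k) dx = 0] isolates the first nonvanishing moment. *)
Lemma vanishing_moments (m : nat) : moment m = 0.
Proof.
elim/ltn_ind: m => m IH.
apply/eqP/negPn/negP => m0.
have [B [B0 HB']] := schwartz_decay Spsi m.+1 0.
have HB x : `|D m.+1 x| <= B by have := HB' x; rewrite expr0 mulr1.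
suff : forall x, D m x = 0.
  move=> /schwartz_cst0 psi0.
  have := wavelet_orthogonality 0 0 0 0.
  rewrite !eqxx /= expr0 invr1.
  rewrite (_ : (fun x : R => _) = cst 0).
    by rewrite Rintegral_cst// mul0r => /eqP; rewrite eq_sym oner_eq0.
  by apply/funext => x /=; rewrite !psi0 mul0r.
move=> x0.
pose W := schwartz_weight m.+1.
have W0 : 0 <= W := schwartz_weight_ge0 _.
(* The Taylor terms of degree below [m] disappear by induction, the term of degree [m] has size
   [2 ^ (- j m)] and the remainder [2 ^ (- j (m + 1))]; dividing leaves a factor [2 ^ (- j)]. *)
have main (j : nat) (k : int) : (0 < j)%N ->
    `|D m (k%:~R / 2 ^+ j) / m`!%:R * moment m| <= B * W / 2 ^+ j.
  move=> j0; pose xj : R := k%:~R / 2 ^+ j; rewrite -/xj.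
  pose G (y : R) : R := psi (xj + (2 ^+ j)^-1 * y) * psi y.
  have p2 : (0 : R) < 2 ^+ j by rewrite exprn_gt0.
  have p2' : (2 : R) ^+ j != 0 by rewrite gt_eqF.
  have cxj : continuous (fun y : R => psi (xj + (2 ^+ j)^-1 * y)).
    have -> : (fun y : R => psi (xj + (2 ^+ j)^-1 * y)) = (fun y : R => psi ((2 ^+ j)^-1 * y - - xj)).
      by apply/funext => y; rewrite opprK addrC.
    exact: continuous_affine_schwartz.
  have [A [A0 HA]] := schwartz_bounded.
  have iG : intg G.
    by apply: (@schwartz_mul_integrable _ A 0) => // y; rewrite expr0 mulr1.
  have IG0 : \int[mu]_y G y = 0.
    rewrite (@Rintegral_affine R (2 ^+ j) k%:~R)//; last first.
      by move=> y; apply: cvgM; [exact: cxj|exact: psi_continuous].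
    have := wavelet_orthogonality 0 j 0 k; rewrite ltn_eqF//= => E.
    rewrite -[RHS](mulr0 (2 ^+ j)) -E; congr (_ * _); apply: eq_Rintegral => x _.
    rewrite /G; congr (psi _ * _); rewrite /xj expr0 subr0 mul1r.
    by field.
  pose c (l : nat) : R := D l xj / l`!%:R * (2 ^+ j)^-1 ^+ l.
  have [iS IS] := integral_sum_moment c m.+1.
  rewrite big_ord_recr /= big1 ?add0r in IS; last first.
    by move=> i _; rewrite IH ?mulr0.
  pose Q (y : R) : R := taylor_rem psi 0 m.+1 xj ((2 ^+ j)^-1 * y).
  have QE : (fun y : R => Q y * psi y) = (fun y : R => G y - (\sum_(l < m.+1) c l * y ^+ l) * psi y).
    apply/funext => y; rewrite /Q /taylor_rem /G -mulrBl; congr ((_ - _) * _).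
    by apply: eq_bigr => l _; rewrite add0n /c exprMn mulrA.
  have iQ : intg (fun y => Q y * psi y).
    by rewrite QE; have := integrableB measurableT iG iS.
  have IQ : \int[mu]_y (Q y * psi y) = - (c m * moment m).
    by rewrite QE RintegralB// IG0 IS sub0r.
  have cQ : continuous Q.
    have -> : Q = fun y => psi (xj + (2 ^+ j)^-1 * y) - (\sum_(l < m.+1) (c l)%:P * 'X^l).[y].
      apply/funext => y; rewrite /Q /taylor_rem; congr (_ - _).
      rewrite horner_sum; apply: eq_bigr => l _; rewrite add0n /c exprMn mulrA.
      by rewrite hornerM hornerC hornerXn.
    by move=> y; apply: cvgB; [exact: cxj|exact: continuous_horner].
  have := @schwartz_integral_le Q (B * (2 ^+ j)^-1 ^+ m.+1) 1 0 m.+1 ltr01 cQ.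
  under [fun x => Q x * psi (1 * x - 0)]eq_fun do rewrite mul1r subr0.
  rewrite mul1r IQ normrN => H.
  have {H} : `|c m * moment m| <= B * (2 ^+ j)^-1 ^+ m.+1 * W.
    apply: H => // y; rewrite mul1r subr0.
    apply: (@le_trans _ _ (`|(2 ^+ j)^-1 * y| ^+ m.+1 * B)).
      by apply: (taylor_rem_le Spsi) => xi _; rewrite add0n.
    rewrite normrM exprMn [X in X ^+ _ * _]gtr0_norm ?invr_gt0//.
    rewrite [leRHS](_ : _ = (2 ^+ j)^-1 ^+ m.+1 * (1 + `|y|) ^+ m.+1 * B); last by ring.
    apply: ler_wpM2r => //; apply: ler_wpM2l; first by rewrite exprn_ge0// invr_ge0 ltW.
    by rewrite lerXn2r ?nnegrE ?addr_ge0// lerDr.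
  rewrite /c exprS => H.
  have q0 : 0 < (2 ^+ j)^-1 ^+ m :> R by rewrite exprn_gt0// invr_gt0.
  rewrite -(ler_pM2r q0); move: H.
  rewrite !normrM [X in _ * X * _ <= _](gtr0_norm q0).
  by rewrite mulrAC => /le_trans; apply; rewrite le_eqVlt; apply/orP; left; apply/eqP; field.
have mn0 : 0 < `|moment m| by rewrite normr_gt0.
have f0 : 0 < m`!%:R :> R by rewrite ltr0n fact_gt0.
apply/eqP; rewrite -normr_eq0 eq_le normr_ge0 andbT.
apply: (@le0_of_geometric R _ (B + B * W * m`!%:R / `|moment m|)) => j j0.
(* [k / 2 ^ j] approximates [x0] within [2 ^ (- j)]. Since [D m.+1] is bounded, the smallness of
   [D m] at dyadic points passes to [x0]. *)
pose k : int := Num.floor (2 ^+ j * x0).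
have p2 : (0 : R) < 2 ^+ j by rewrite exprn_gt0.
have /andP[k1 k2] := floor_itv (2 ^+ j * x0).
pose xj : R := k%:~R / 2 ^+ j; have H := main j k j0; rewrite -/xj in H.
have near : `|x0 - xj| <= (2 ^+ j)^-1.
  have -> : x0 - xj = (2 ^+ j * x0 - k%:~R) / 2 ^+ j by rewrite /xj; field; rewrite gt_eqF.
  rewrite normrM [X in _ * X]gtr0_norm ?invr_gt0// ler_piMl ?invr_ge0 ?ltW//.
  by rewrite ger0_norm; [rewrite intrD in k2; lra|rewrite subr_ge0].
have T1 : `|D m x0 - D m xj| <= B / 2 ^+ j.
  have : `|taylor_rem psi m 1 xj (x0 - xj)| <= `|x0 - xj| ^+ 1 * B.
    by apply: (taylor_rem_le Spsi) => xi _; rewrite addn1.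
  rewrite /taylor_rem big_ord1 expr0 addn0 fact0 divr1 mulr1 expr1.
  rewrite (_ : xj + (x0 - xj) = x0); last by ring.
  move=> /le_trans; apply.
  by rewrite mulrC ler_wpM2l.
have T2 : `|D m xj| <= B * W * m`!%:R / `|moment m| / 2 ^+ j.
  move: H; rewrite !normrM normfV (gtr0_norm f0) mulrAC ler_pdivrMr// => H.
  by rewrite mulrAC ler_pdivlMr//; apply: (le_trans H); rewrite mulrAC.
have := ler_normD (D m x0 - D m xj) (D m xj); rewrite subrK mulrDl; lra.
Qed.

(** Allows a Taylor polynomial to be subtracted from a function without changing its wavelet
    coefficients. *)
Lemma wavelet_integral_poly (P : {poly R}) (x0 : R) (j : nat) (k : int) :
  intg (fun x => P.[x - x0] * psi (2 ^+ j * x - k%:~R)) /\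
  \int[mu]_x (P.[x - x0] * psi (2 ^+ j * x - k%:~R)) = 0.
Proof.
have p2 : (0 : R) < 2 ^+ j by rewrite exprn_gt0.
pose Q : {poly R} := P \Po ((2 ^+ j)^-1 *: 'X + (k%:~R / 2 ^+ j - x0)%:P).
have QE y : Q.[y] = \sum_(l < size Q) Q`_l * y ^+ l by rewrite horner_coef.
have [iS IS] := integral_sum_moment (fun l => Q`_l) (size Q).
have {}IS : \int[mu]_x (Q.[x] * psi x) = 0.
  under eq_Rintegral => x _ do rewrite QE.
  by rewrite IS big1// => l _; rewrite vanishing_moments mulr0.
have {}iS : intg (fun x => Q.[x] * psi x).
  by under eq_fun do rewrite QE.
have cQ : continuous (fun x => Q.[x] * psi x).
  by move=> x; apply: cvgM; [exact: continuous_horner|exact: psi_continuous].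
have E : (fun x => P.[x - x0] * psi (2 ^+ j * x - k%:~R)) =
   (fun x => Q.[2 ^+ j * x - k%:~R] * psi (2 ^+ j * x - k%:~R)).
  apply/funext => x; congr (_ * _); rewrite horner_comp hornerD hornerZ hornerX hornerC.
  by congr (P.[_]); field; rewrite gt_eqF.
rewrite E; split; first exact: (@integrable_affine R (2 ^+ j) k%:~R (fun x => Q.[x] * psi x)).
apply: (mulfI (lt0r_neq0 p2)); rewrite mulr0 -IS.
by rewrite -(@Rintegral_affine R (2 ^+ j) k%:~R (fun x => Q.[x] * psi x)).
Qed.

End Moments.

(** * Lacunary wavelet series *)

Section Pow2.
Variable R : realType.
Implicit Types x y : R.

Lemma pow2_gt0 x : 0 < 2 `^ x. Proof. exact: powR_gt0. Qed.

Lemma pow2_ge0 x : 0 <= 2 `^ x. Proof. exact: powR_ge0. Qed.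

Lemma pow2_neq0 x : 2 `^ x != 0. Proof. by rewrite gt_eqF ?pow2_gt0. Qed.

Lemma pow2D x y : 2 `^ (x + y) = 2 `^ x * 2 `^ y.
Proof. by rewrite powRD// pnatr_eq0 implybT. Qed.

Lemma pow2_nat (n : nat) : 2 `^ n%:R = 2 ^+ n :> R.
Proof. by rewrite powR_mulrn. Qed.

Lemma ler_pow2 x y : (2 `^ x <= 2 `^ y) = (x <= y).
Proof.
apply/idP/idP; last by apply: ler_powR; lra.
rewrite /powR pnatr_eq0 /= ler_expR ler_pM2r//.
by rewrite ln_gt0// ltr1n.
Qed.

Lemma ltr_pow2 x y : (2 `^ x < 2 `^ y) = (x < y).
Proof. by rewrite !ltNge ler_pow2. Qed.

Lemma pow2_exprn x (n : nat) : (2 `^ x) ^+ n = 2 `^ (x * n%:R).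
Proof. by rewrite powRrM powR_mulrn// powR_ge0. Qed.

End Pow2.

Lemma geometric_series_tail (R : realType) (u : R^nat) (A r : R) :
  0 <= A -> 0 < r -> r < 1 -> (forall m, `|u m| <= A * r ^+ m) ->
  cvgn (series u) /\
  forall n, `|limn (series u) - series u n| <= A * r ^+ n / (1 - r).
Proof.
move=> A0 r0 r1 ule.
have nr1 : `|r| < 1 by rewrite gtr0_norm.
have cu : cvgn (series u).
  apply: normed_cvg; apply: (@series_le_cvg _ _ (geometric A r)).
  - by move=> n; exact: normr_ge0.
  - by move=> n; rewrite /geometric /= mulr_ge0// exprn_ge0// ltW.
  - exact: ule.
  - exact: is_cvg_geometric_series.
split=> // n.
have B m : `|series u (n + m)%N - series u n| <= A * r ^+ n / (1 - r).
  have -> : series u (n + m)%N - series u n = \sum_(n <= k < n + m) u k.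
    by rewrite /series /= (@big_cat_nat _ _ _ n 0 (n + m))//= ?leq_addr// addrAC subrr add0r.
  apply: (le_trans (ler_norm_sum _ _ _)).
  apply: (@le_trans _ _ (\sum_(n <= k < n + m) A * r ^+ k)); first exact: ler_sum.
  rewrite -mulr_sumr geometric_partial_tail geometric_seriesE ?lt_eqF//.
  rewrite -mulrA ler_wpM2l// ler_wpM2r//; first by rewrite invr_ge0; lra.
  by rewrite ler_piMr ?exprn_ge0// ?ltW// ltrBlDr ltrDl exprn_gt0.
have cs : (fun m => `|series u (n + m)%N - series u n|) @ \oo --> `|limn (series u) - series u n|.
  apply: cvg_norm; apply: cvgB; last exact: cvg_cst.
  have -> : (fun m => series u (n + m)%N) = [sequence series u (m + n)%N]_m.
    by apply/funext => m; rewrite addnC.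
  by rewrite (cvg_shiftn n (series u)).
rewrite -(cvg_lim (@Rhausdorff R) cs); apply: limr_le; first by apply/cvg_ex; eexists; exact: cs.
exact: nearW.
Qed.

Lemma continuous_finite_sum (R : realType) (I : Type) (s : seq I) (P : pred I) (f : I -> R -> R) :
  (forall i, P i -> continuous (f i)) -> continuous (fun x => \sum_(i <- s | P i) f i x).
Proof.
move=> cf; elim: s => [|i s IH] x.
  by under eq_fun do rewrite big_nil; exact: cvg_cst.
have [Pi|nPi] := boolP (P i); last first.
  by under eq_fun do rewrite big_cons (negbTE nPi); exact: IH.
by under eq_fun do rewrite big_cons Pi; apply: cvgD; [exact: cf|exact: IH].
Qed.

Section FiniteSums.
Variable R : realType.
Local Notation mu := (@lebesgue_measure R).

Lemma ratio_bounds (b : R) : 0 < b -> 0 < 2 `^ (- b) :> R /\ 2 `^ (- b) < 1 :> R.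
Proof. by move=> b0; rewrite pow2_gt0 -[ltRHS](powRr0 (2 : R)) ltr_pow2 oppr_lt0. Qed.

Lemma Rintegral_finite_sum (I : Type) (s : seq I) (P : pred I) (f : I -> R -> R) :
  (forall i, P i -> mu.-integrable setT (EFin \o f i)) ->
  mu.-integrable setT (EFin \o (fun x => \sum_(i <- s | P i) f i x)) /\
  \int[mu]_x (\sum_(i <- s | P i) f i x) = \sum_(i <- s | P i) \int[mu]_x f i x.
Proof.
move=> fi; elim: s => [|i s [IHi IH]].
  split.
    rewrite (_ : EFin \o _ = cst 0%E); first exact: integrable0.
    by apply/funext => x /=; rewrite big_nil.
  rewrite big_nil; under eq_Rintegral => x _ do rewrite big_nil.
  by rewrite Rintegral_cst// mul0r.
have [Pi|nPi] := boolP (P i); last first.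
  rewrite big_cons (negbTE nPi) -IH; split.
    by under eq_fun do rewrite big_cons (negbTE nPi).
  by apply: eq_Rintegral => x _; rewrite big_cons (negbTE nPi).
have E : (fun x => \sum_(j <- i :: s | P j) f j x) = (fun x => f i x + \sum_(j <- s | P j) f j x).
  by apply/funext => x; rewrite big_cons Pi.
rewrite E big_cons Pi -IH; split; first by have := integrableD measurableT (fi i Pi) IHi.
by rewrite RintegralD//; exact: fi.
Qed.

Lemma poly_growth (P : {poly R}) : exists B : R, 0 <= B /\
  forall t, `|P.[t]| <= B * (1 + `|t|) ^+ size P.
Proof.
exists (\sum_(l < size P) `|P`_l|); split; first exact: sumr_ge0.
move=> t; rewrite horner_coef mulr_suml; apply: (le_trans (ler_norm_sum _ _ _)).
apply: ler_sum => l _; rewrite normrM normrX ler_wpM2l//.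
apply: (@le_trans _ _ ((1 + `|t|) ^+ l)).
  by rewrite lerXn2r ?nnegrE ?addr_ge0// lerDr.
by apply: ler_weXn2l; rewrite ?lerDl// ltnW.
Qed.

End FiniteSums.

Section WaveletSeries.
Variables (R : realType) (psi : R -> R).
Hypothesis Spsi : schwartz psi.
Hypothesis Opsi : orthonormal_wavelet psi.
Local Notation D n := (derive1n n psi).
Local Notation mu := (@lebesgue_measure R).
Local Notation intg f := (mu.-integrable setT (EFin \o f)).

Variables (N : nat -> nat) (act : nat -> pred nat) (wt : nat -> nat -> R) (alpha : R).
Hypothesis NS : forall m, (N m < N m.+1)%N.
Hypothesis alpha0 : 0 < alpha.
Hypothesis act_lt : forall m k, act m k -> (k < 2 ^ N m)%N.
Hypothesis wt_ge : forall m k, act m k -> alpha * (N m)%:R <= wt m k.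

Definition wavelet_gen (m : nat) (x : R) : R :=
  \sum_(0 <= k < 2 ^ N m | act m k) 2 `^ (- wt m k) * psi (2 ^+ N m * x - k%:R).

Definition wavelet_series (x : R) : R := limn (series (wavelet_gen ^~ x)).

Local Notation F := wavelet_series.

Lemma leq_gen m : (m <= N m)%N.
Proof. by elim: m => // m IH; exact: leq_ltn_trans IH (NS m). Qed.

Lemma gen_inj : injective N.
Proof.
have H m n : (m < n)%N -> (N m < N n)%N.
  elim: n => // n IH; rewrite ltnS leq_eqVlt => /predU1P[->//|/IH h].
  exact: ltn_trans h (NS n).
move=> m n E; have [/H|/H|//] := ltngtP m n; by rewrite E ltnn.
Qed.

Lemma psi_continuous : continuous psi. Proof. exact: (@schwartz_continuous R psi Spsi 0%N). Qed.

Lemma schwartz_weighted_sum (h : R) (l : nat) : 0 <= h ->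
  exists C : R, 0 <= C /\ forall (y : R) (n : nat) (P : pred nat),
  \sum_(0 <= k < n | P k) (1 + `|y - k%:R|) `^ h * `|D l (y - k%:R)| <= C.
Proof.
move=> h0; pose H := (Num.truncn h).+1.
have [C [C0 HC]] := schwartz_decay Spsi l H.+2.
exists (C * 8); split; first by rewrite mulr_ge0.
move=> y n P; apply: (@le_trans _ _ (\sum_(0 <= k < n | P k) C * ((1 + `|y - k%:R|) ^+ 2)^-1)); last first.
  by rewrite -mulr_sumr ler_wpM2l// sum_translates_le.
apply: ler_sum => k _; set t := y - k%:R.
have p1 : 1 <= 1 + `|t| by rewrite lerDl.
have p0 : 0 < 1 + `|t| by rewrite (lt_le_trans ltr01).
rewrite ler_pdivlMr ?exprn_gt0//; apply: le_trans (HC t).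
rewrite [X in X * _ <= _]mulrC -mulrA ler_wpM2l// -(addn2 H) exprD.
apply: ler_wpM2r; first by rewrite exprn_ge0// ltW.
rewrite -powR_mulrn ?(ltW p0)//; apply: ler_powR => //.
by apply: ltW; exact: truncnS_gt.
Qed.

Lemma pow2_gen_le (b : R) (m : nat) : 0 <= b -> 2 `^ (- (b * (N m)%:R)) <= (2 `^ (- b)) ^+ m.
Proof.
move=> b0; rewrite pow2_exprn ler_pow2 mulNr lerN2 ler_wpM2l// ler_nat.
exact: leq_gen.
Qed.

Lemma wavelet_gen_bound : exists C r : R, 0 <= C /\ 0 < r /\ r < 1 /\
  forall m x, `|wavelet_gen m x| <= C * r ^+ m.
Proof.
have [C [C0 HC]] := @schwartz_weighted_sum 0 0 (lexx _).
have [r0 r1] := ratio_bounds alpha0.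
exists C, (2 `^ (- alpha)); do 3?split => //.
move=> m x; apply: (le_trans (ler_norm_sum _ _ _)).
apply: (@le_trans _ _ (\sum_(0 <= k < 2 ^ N m | act m k)
   (2 `^ (- alpha)) ^+ m * ((1 + `|2 ^+ N m * x - k%:R|) `^ 0 * `|D 0 (2 ^+ N m * x - k%:R)|))).
  apply: ler_sum => k ak; rewrite powRr0 mul1r normrM; apply: ler_wpM2r => //.
  rewrite gtr0_norm ?pow2_gt0//; apply: le_trans (pow2_gen_le m (ltW alpha0)).
  by rewrite ler_pow2 lerN2 wt_ge.
by rewrite -mulr_sumr mulrC ler_wpM2r// exprn_ge0// ltW.
Qed.

Lemma wavelet_series_approx : exists C r : R, 0 <= C /\ 0 < r /\ r < 1 /\
  forall n x, cvgn (series (wavelet_gen ^~ x)) /\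
    `|F x - series (wavelet_gen ^~ x) n| <= C * r ^+ n.
Proof.
have [C [r [C0 [r0 [r1 H]]]]] := wavelet_gen_bound.
exists (C / (1 - r)), r; split; first by rewrite divr_ge0// subr_ge0 ltW.
do 2!split => //; move=> n x.
have [cs /(_ n)] := geometric_series_tail C0 r0 r1 (fun m => H m x).
by rewrite mulrAC.
Qed.

Lemma wavelet_series_bounded : bounded_real_fun F.
Proof.
have [C [r [C0 [r0 [r1 H]]]]] := wavelet_series_approx.
exists C => x; have [_] := H 0%N x.
by rewrite /series /= big_nil subr0 expr0 mulr1.
Qed.

(* The decay of the coefficients away from [x0] is the two-microlocal condition,
   with a spare factor [r ^+ m] which makes the sum over the generations geometric. *)
Lemma wavelet_series_taylor (h : R) (M : nat) : 0 <= h -> h < M%:R ->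
  (forall l, (l < M)%N -> l%:R <= h) -> forall r : R, 0 < r -> r < 1 ->
  exists C : R, 0 <= C /\ forall (x0 A : R), 0 <= A ->
  (forall m k, act m k -> 2 `^ (- wt m k) * 2 `^ ((N m)%:R * h) <=
     A * r ^+ m * (1 + `|2 ^+ N m * x0 - k%:R|) `^ h) ->
  exists P : {poly R}, (size P <= M)%N /\
    forall x, `|F x - P.[x - x0]| <= C * A * `|x - x0| `^ h.
Proof.
move=> h0 hM lh r r0 r1.
have [C [C0 HC]] := schwartz_taylor_sum Spsi h0 hM lh.
exists (C / (1 - r)); split; first by rewrite divr_ge0// subr_ge0 ltW.
move=> x0 A A0 HA.
pose y m : R := 2 ^+ N m * x0.
(* [c l m] is the coefficient of [(x - x0) ^+ l] in the Taylor polynomial of generation [m]. The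
   polynomial [P] sums them over all generations; since [l <= h], the weights that control the
   remainders make these series converge too. *)
pose c l m : R := \sum_(0 <= k < 2 ^ N m | act m k)
   2 `^ (- wt m k) * (D l (y m - k%:R) / l`!%:R * (2 ^+ N m) ^+ l).
have p2h m : 0 < 2 `^ ((N m)%:R * h) :> R by exact: pow2_gt0.
have lam m k : act m k -> 2 `^ (- wt m k) <=
    A * r ^+ m / 2 `^ ((N m)%:R * h) * (1 + `|y m - k%:R|) `^ h.
  by move=> ak; rewrite mulrAC ler_pdivlMr//; exact: HA.
have Arm m : 0 <= A * r ^+ m / 2 `^ ((N m)%:R * h).
  by rewrite divr_ge0 ?pow2_ge0// mulr_ge0// exprn_ge0// ltW.
have cvgc l : (l < M)%N -> cvgn (series (c l)).
  move=> lM; have [Cl [Cl0 HCl]] := schwartz_weighted_sum l h0.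
  suff Hm m : `|c l m| <= A * Cl * r ^+ m.
    by have [] := geometric_series_tail (mulr_ge0 A0 Cl0) r0 r1 Hm.
   apply: (le_trans (ler_norm_sum _ _ _)).
  apply: (@le_trans _ _ (\sum_(0 <= k < 2 ^ N m | act m k)
     (A * r ^+ m) * ((1 + `|y m - k%:R|) `^ h * `|D l (y m - k%:R)|))); last first.
    by rewrite -mulr_sumr [leRHS]mulrAC ler_wpM2l// mulr_ge0// exprn_ge0// ltW.
  apply: ler_sum => k ak; rewrite !normrM (gtr0_norm (pow2_gt0 _)).
  apply: (@le_trans _ _ (2 `^ (- wt m k) * (`|D l (y m - k%:R)| * 2 `^ ((N m)%:R * h)))).
    apply: ler_wpM2l; first exact: pow2_ge0.
    apply: ler_pM => //.
      rewrite ler_piMr// normfV normr_nat invf_le1 ?ltr0n ?fact_gt0//.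
      by rewrite ler1n fact_gt0.
    rewrite ger0_norm ?exprn_ge0// -exprM -pow2_nat ler_pow2 natrM ler_wpM2l//.
    exact: lh.
  by rewrite [leLHS]mulrCA [leLHS]mulrC [leRHS]mulrA ler_wpM2r// HA.
pose rem m (x : R) : R := \sum_(0 <= k < 2 ^ N m | act m k)
   2 `^ (- wt m k) * taylor_rem psi 0 M (y m - k%:R) (2 ^+ N m * (x - x0)).
have genE m x : wavelet_gen m x = rem m x + \sum_(l < M) c l m * (x - x0) ^+ l.
  rewrite /rem /c.
  under [X in _ = _ + X]eq_bigr => l _ do rewrite mulr_suml.
  rewrite exchange_big /= -big_split /=; apply: eq_bigr => k _.
  under eq_bigr => l _ do rewrite -mulrA.
  rewrite -mulr_sumr -mulrDr; congr (_ * _); rewrite /taylor_rem.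
  rewrite (_ : y m - k%:R + 2 ^+ N m * (x - x0) = 2 ^+ N m * x - k%:R); last by rewrite /y; ring.
  rewrite -[LHS]addr0 -addrA; congr (_ + _); apply/esym/eqP; rewrite addrC subr_eq0; apply/eqP.
  by apply: eq_bigr => l _; rewrite add0n exprMn -!mulrA.
have rem_le m x : `|rem m x| <= (C * A * `|x - x0| `^ h) * r ^+ m.
  apply: (le_trans (ler_norm_sum _ _ _)).
  apply: (@le_trans _ _ (\sum_(0 <= k < 2 ^ N m | act m k)
     (A * r ^+ m / 2 `^ ((N m)%:R * h)) * ((1 + `|y m - k%:R|) `^ h *
       `|taylor_rem psi 0 M (y m - k%:R) (2 ^+ N m * (x - x0))|))).
    apply: ler_sum => k ak; rewrite normrM (gtr0_norm (pow2_gt0 _)) mulrA.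
    by apply: ler_wpM2r => //; exact: lam.
  rewrite -mulr_sumr.
  apply: (le_trans (ler_wpM2l (Arm m) (HC (y m) (2 ^+ N m * (x - x0)) (2 ^ N m)%N (act m)))).
  rewrite normrM ger0_norm ?exprn_ge0// powRM ?exprn_ge0//.
  rewrite -pow2_nat -powRrM.
  by rewrite le_eqVlt; apply/orP; left; apply/eqP; field; rewrite pow2_neq0.
pose P := \poly_(l < M) limn (series (c l)).
exists P; split; first exact: size_poly.
move=> x; have CA0 : 0 <= C * A * `|x - x0| `^ h by rewrite !mulr_ge0 ?powR_ge0.
have [cr /(_ 0%N)] := geometric_series_tail CA0 r0 r1 (fun m => rem_le m x).
rewrite /series /= big_nil subr0 expr0 mulr1 => rl.
have [C' [r' [_ [_ [_ H]]]]] := wavelet_series_approx.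
have [cF _] := H 0%N x.
suff -> : F x - P.[x - x0] = limn (series (rem ^~ x)).
  by apply: le_trans rl _; rewrite le_eqVlt; apply/orP; left; apply/eqP; ring.
have cP : (fun n => \sum_(l < M) series (c l) n * (x - x0) ^+ l) @ \oo --> P.[x - x0].
  rewrite /P horner_poly; elim: {-2}M (leqnn M) => [|M' IH] M'M.
    by under eq_fun do rewrite big_ord0; rewrite big_ord0; exact: cvg_cst.
  under eq_fun do rewrite big_ord_recr/=.
  rewrite big_ord_recr /=; apply: cvgD; first exact: IH (ltnW M'M).
  by apply: cvgM; [exact: cvgc|exact: cvg_cst].
have cl : (fun n => series (wavelet_gen^~ x) n - \sum_(l < M) series (c l) n * (x - x0) ^+ l)
    @ \oo --> F x - P.[x - x0] by exact: cvgB cF cP.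
rewrite (_ : series (rem ^~ x) = (fun n => series (wavelet_gen^~ x) n - \sum_(l < M) series (c l) n * (x - x0) ^+ l)).
  by rewrite (cvg_lim (@Rhausdorff R) cl).
apply/funext => n; rewrite /series /=.
under [X in _ = _ - X]eq_bigr => l _ do rewrite mulr_suml.
rewrite exchange_big /= -sumrB; apply: eq_bigr => m _.
by rewrite genE addrK.
Qed.

Lemma wavelet_series_holder : holder_continuous F.
Proof.
(* An exponent below 1 reduces the Taylor polynomial to the constant [F y]. Half of [alpha] goes to
   the exponent, half to the geometric factor. *)
pose g : R := Num.min (alpha / 2) (1 / 2).
have g0 : 0 < g by rewrite lt_min !divr_gt0.
have g1 : g < 1%:R by rewrite gt_min; apply/orP; right; lra.
have ga : g <= alpha / 2 by rewrite ge_min lexx.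
have [r0 r1] := ratio_bounds (divr_gt0 alpha0 (ltr0n R 2)).
have [|C [C0 HC]] := @wavelet_series_taylor g 1 (ltW g0) g1 _ _ r0 r1.
  by move=> [|//] _; exact: ltW.
exists g, C; split=> // x y.
have [|P [sP HP]] := HC y 1 ler01.
  move=> m k ak; rewrite mul1r -pow2D.
  apply: (@le_trans _ _ (2 `^ (- ((alpha / 2) * (N m)%:R)))).
    rewrite ler_pow2; have := wt_ge ak; have := ler_wpM2r (ler0n R (N m)) ga.
    by rewrite mulrC; lra.
  apply: le_trans (pow2_gen_le m _) _; first by rewrite ltW// divr_gt0.
  rewrite ler_peMr ?exprn_ge0 ?(ltW r0)//.
  rewrite -[leLHS](powRr0 (1 + `|2 ^+ N m * y - k%:R|)); apply: ler_powR (ltW g0).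
  by rewrite lerDl.
have Pc z : P.[z] = F y.
  have := HP y; rewrite subrr normr0 powR0 ?mulr0 ?gt_eqF// normr_le0 subr_eq0 => /eqP ->.
  by have := size1_polyC sP => ->; rewrite !hornerC.
by have := HP x; rewrite Pc mulr1.
Qed.

Lemma wavelet_series_continuous : continuous F.
Proof.
have [g [C [g0 H]]] := wavelet_series_holder.
move=> x; apply/cvgrPdist_le => e e0.
pose C' := `|C| + 1; have C'0 : 0 < C' by rewrite ltr_wpDl.
have d0 : 0 < e / C' by rewrite divr_gt0.
exists ((e / C') `^ (g^-1)); first by rewrite /= powR_gt0.
move=> y /= xy; apply: le_trans (H x y) _.
apply: (@le_trans _ _ (C' * ((e / C') `^ (g^-1)) `^ g)).
  apply: (@le_trans _ _ (C' * `|x - y| `^ g)).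
    apply: ler_wpM2r; first exact: powR_ge0.
    by rewrite /C'; have := ler_norm C; lra.
  apply: ler_wpM2l; first exact: ltW.
  apply: ge0_ler_powR; rewrite ?nnegrE ?powR_ge0//; exact: ltW.
rewrite -powRrM mulVf ?gt_eqF// powRr1 ?(ltW d0)// mulrC divfK// gt_eqF//.
Qed.

Lemma wavelet_atom_integrable (j j' : nat) (k k' : R) :
  intg (fun x => psi (2 ^+ j * x - k) * psi (2 ^+ j' * x - k')).
Proof.
have [A [A0 HA]] := schwartz_bounded Spsi.
apply: (@schwartz_affine_integrable R psi Spsi _ A); rewrite ?exprn_gt0//.
exact: continuous_affine_schwartz.
Qed.

Lemma wavelet_gen_integral (m j : nat) (k : int) :
  intg (fun x => wavelet_gen m x * psi (2 ^+ j * x - k%:~R)) /\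
  \int[mu]_x (wavelet_gen m x * psi (2 ^+ j * x - k%:~R)) =
  \sum_(0 <= k' < 2 ^ N m | act m k')
     2 `^ (- wt m k') * (if (N m == j) && (k'%:Z == k) then (2 ^+ j)^-1 else 0).
Proof.
pose f (k' : nat) (x : R) : R := 2 `^ (- wt m k') * (psi (2 ^+ N m * x - k'%:~R) * psi (2 ^+ j * x - k%:~R)).
have fE : (fun x => wavelet_gen m x * psi (2 ^+ j * x - k%:~R)) =
   (fun x => \sum_(k' <- index_iota 0 (2 ^ N m) | act m k') f k' x).
  by apply/funext => x; rewrite mulr_suml; apply: eq_bigr => k' _; rewrite /f mulrA.
have fi (k' : nat) : intg (f k').
  by have := integrableZl measurableT (2 `^ (- wt m k')) (wavelet_atom_integrable (N m) j k'%:~R k%:~R).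
have [i1 i2] := @Rintegral_finite_sum _ _ (index_iota 0 (2 ^ N m)) (act m) f (fun k' _ => fi k').
rewrite fE; split => //; rewrite i2; apply: eq_bigr => k' _.
rewrite /f RintegralZl//; last exact: wavelet_atom_integrable.
rewrite (wavelet_orthogonality Spsi Opsi); case: ifP => // /andP[/eqP -> _] //.
Qed.

(** Since [m <= N m], no generation beyond index [j] contributes: the coefficient of a partial sum
    is stationary, and uniform convergence gives it to [F]. *)
Lemma wcoefE (j : nat) (k : int) : wcoef psi F j k =
  \sum_(0 <= m < j.+1) \sum_(0 <= k' < 2 ^ N m | act m k')
     2 `^ (- wt m k') * ((N m == j) && (k'%:Z == k))%:R.
Proof.
have p2 : 0 < 2 ^+ j :> R by rewrite exprn_gt0.
have [B HB] := wavelet_series_bounded.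
have iF : intg (fun x => F x * psi (2 ^+ j * x - k%:~R)).
  by apply: (@schwartz_affine_integrable R psi Spsi _ B) => //; exact: wavelet_series_continuous.
rewrite /wcoef; set V := RHS.
have [C [r [C0 [r0 [r1 HC]]]]] := wavelet_series_approx.
have partial n : (j < n)%N ->
  intg (fun x => series (wavelet_gen ^~ x) n * psi (2 ^+ j * x - k%:~R)) /\
  2 ^+ j * \int[mu]_x (series (wavelet_gen ^~ x) n * psi (2 ^+ j * x - k%:~R)) = V.
  move=> jn.
  have E : (fun x => series (wavelet_gen ^~ x) n * psi (2 ^+ j * x - k%:~R)) =
     (fun x => \sum_(m <- index_iota 0 n | true) wavelet_gen m x * psi (2 ^+ j * x - k%:~R)).
    by apply/funext => x; rewrite mulr_suml.
  have [i1 i2] := @Rintegral_finite_sum _ _ (index_iota 0 n) xpredT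
    (fun m x => wavelet_gen m x * psi (2 ^+ j * x - k%:~R))
    (fun m _ => (wavelet_gen_integral m j k).1).
  rewrite E; split => //; rewrite i2 mulr_sumr /V.
  rewrite (@big_cat_nat _ _ _ j.+1 0 n)//= [X in _ + X]big_nat_cond [X in _ + X]big1 ?addr0; last first.
    move=> m; rewrite andbT => /andP[jm _]; rewrite (wavelet_gen_integral m j k).2.
    rewrite big1 ?mulr0// => k' _; rewrite gtn_eqF ?mulr0//.
    exact: leq_trans jm (leq_gen m).
  apply: eq_bigr => m _; rewrite (wavelet_gen_integral m j k).2 mulr_sumr.
  apply: eq_bigr => k' _; rewrite mulrCA; congr (_ * _).
  by case: ifP => _; rewrite ?mulr0// mulfV// gt_eqF.
apply/eqP; rewrite -subr_eq0 -normr_eq0 eq_le normr_ge0 andbT.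
pose W := schwartz_weight psi 0.
have W0 : 0 <= W := schwartz_weight_ge0 _ _.
have bnd n : (j < n)%N -> `|2 ^+ j * \int[mu]_x (F x * psi (2 ^+ j * x - k%:~R)) - V| <= C * W * r ^+ n.
  move=> jn; have [i1 i2] := partial n jn.
  rewrite -i2 -mulrBr -RintegralB//.
  under eq_Rintegral => x _ do rewrite -mulrBl.
  rewrite normrM [X in X * _]gtr0_norm//.
  rewrite [leRHS]mulrAC; apply: (@schwartz_integral_le R psi Spsi _ _ _ _ 0 p2) => //.
  - move=> x; apply: cvgB; first exact: wavelet_series_continuous.
    apply: continuous_finite_sum => m _; apply: continuous_finite_sum => k' _ y.
    apply: cvgM; first exact: cvg_cst.
    exact: (continuous_affine_schwartz Spsi).
  - by move=> x; rewrite expr0 mulr1; have [] := HC n x.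
  - under [fun x => _ * psi _]eq_fun do rewrite mulrBl.
    by have := integrableB measurableT iF i1.
have cr : (fun n => C * W * r ^+ n) @ \oo --> 0.
  by apply: (@cvg_geometric R (C * W) r); rewrite gtr0_norm.
rewrite -(cvg_lim (@Rhausdorff R) cr); apply: limr_ge; first by apply/cvg_ex; exists 0.
by exists j.+1 => // n; exact: bnd.
Qed.

Lemma wcoef_active (m k : nat) : act m k -> wcoef psi F (N m) k%:Z = 2 `^ (- wt m k).
Proof.
move=> ak; rewrite wcoefE.
rewrite (bigD1_seq m) ?iota_uniq ?mem_index_iota ?ltnS ?leq_gen//=.
rewrite [X in _ + X]big1 ?addr0; last first.
  move=> m' m'm; rewrite big1// => k' _.
  by rewrite (inj_eq gen_inj) (negbTE m'm) mulr0.
rewrite (big_rem k) ?mem_index_iota ?act_lt//= ak !eqxx mulr1.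
rewrite big_seq_cond big1 ?addr0// => k'.
rewrite mem_rem_uniq ?iota_uniq// inE => /andP[/andP[k'k _] _].
by rewrite eqz_nat (negbTE k'k) mulr0.
Qed.

Lemma wcoef_neq0 (j : nat) (k : int) : wcoef psi F j k != 0 ->
  exists m k' : nat, [/\ act m k', j = N m & k = k'%:Z].
Proof.
apply: contra_neqP => H; rewrite wcoefE.
rewrite big1// => m _; rewrite big1// => k' ak.
have [/andP[/eqP jm /eqP kk]|] := boolP (_ && _); last by rewrite mulr0.
by case: H; exists m, k'.
Qed.

(** The vanishing moments remove [P], and [F - P] is of order [2 ^ (- h N)] at the scale of a
    wavelet located at [x0]. *)
Lemma coefficients_of_holder (x0 h : R) (P : {poly R}) (C delta : R) :
  0 <= h -> 0 < delta ->
  (forall x, `|x - x0| < delta -> `|F x - P.[x - x0]| <= C * `|x - x0| `^ h) ->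
  exists C' : R, 0 < C' /\ forall m k, act m k -> `|2 ^+ N m * x0 - k%:R| <= 1 ->
    2 `^ (- wt m k) <= C' * 2 `^ (- (h * (N m)%:R)).
Proof.
move=> h0 d0 loc.
have [Bp [Bp0 HBp]] := poly_growth P.
have [B0 HB0] := wavelet_series_bounded.
have B00 : 0 <= B0 by exact: le_trans (normr_ge0 _) (HB0 0).
pose K := size P; pose H := (Num.truncn h).+1.
have hH : h <= H%:R by rewrite ltW// truncnS_gt.
have dh0 : 0 < delta `^ h by exact: powR_gt0.
(* The wavelet sees the whole line, so the local estimate is made global: beyond [delta], where
   [|x - x0| ^ h >= delta ^ h], boundedness of [F] and polynomial growth of [P] suffice. *)
pose C2 := `|C| + (B0 + Bp) / delta `^ h.
have C20 : 0 <= C2 by rewrite addr_ge0// divr_ge0 ?addr_ge0// ltW.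
have glob x : `|F x - P.[x - x0]| <= C2 * `|x - x0| `^ h * (1 + `|x - x0|) ^+ K.
  have t1 : 1 <= (1 + `|x - x0|) ^+ K by rewrite exprn_ege1// lerDl.
  have t0 : 0 <= `|x - x0| `^ h by exact: powR_ge0.
  have [xd|xd] := ltP `|x - x0| delta.
    apply: (le_trans (loc x xd)).
    apply: (@le_trans _ _ (C2 * `|x - x0| `^ h)); last by rewrite ler_peMr// mulr_ge0.
    apply: ler_wpM2r => //; rewrite /C2.
    by apply: (le_trans (ler_norm C)); rewrite lerDl divr_ge0 ?addr_ge0// ltW.
  apply: (le_trans (ler_normB _ _)).
  apply: (@le_trans _ _ ((B0 + Bp) * (1 + `|x - x0|) ^+ K)).
    rewrite mulrDl; apply: lerD; last exact: HBp.
    by apply: (le_trans (HB0 x)); rewrite ler_peMr.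
  apply: ler_wpM2r; first exact: le_trans ler01 t1.
  apply: (@le_trans _ _ ((B0 + Bp) / delta `^ h * `|x - x0| `^ h)).
    rewrite mulrAC ler_pdivlMr// ler_wpM2l ?addr_ge0//.
    by apply: ge0_ler_powR; rewrite // ?nnegrE// ltW.
  by apply: ler_wpM2r => //; rewrite /C2 lerDr.
pose W := schwartz_weight psi (H + K).
have W0 : 0 <= W := schwartz_weight_ge0 _ _.
have C'0 : 0 < C2 * 2 ^+ K * W + 1 by rewrite ltr_wpDl// !mulr_ge0// exprn_ge0.
exists (C2 * 2 ^+ K * W + 1); split => // m k ak kx.
have p2 : 0 < 2 ^+ N m :> R by rewrite exprn_gt0.
have iF : intg (fun x => F x * psi (2 ^+ N m * x - k%:~R)).
  by apply: (@schwartz_affine_integrable R psi Spsi _ B0) => //; exact: wavelet_series_continuous.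
have [iP IP] := wavelet_integral_poly Spsi Opsi P x0 (N m) k.
have E : 2 `^ (- wt m k) =
    2 ^+ N m * `|\int[mu]_x ((F x - P.[x - x0]) * psi (2 ^+ N m * x - k%:~R))|.
  under eq_Rintegral => x _ do rewrite mulrBl.
  rewrite RintegralB// IP subr0 -[X in _ = X * _]gtr0_norm// -normrM.
  by rewrite -[X in `|X|]/(wcoef psi F (N m) k) wcoef_active// gtr0_norm ?pow2_gt0.
rewrite E.
apply: (@le_trans _ _ (C2 * 2 ^+ K * 2 `^ (- (h * (N m)%:R)) * W)); last first.
  by have := pow2_ge0 (- (h * (N m)%:R)); nra.
apply: (@schwartz_integral_le R psi Spsi _ _ _ _ _ p2).
- move=> x; apply: cvgB; first exact: wavelet_series_continuous.
  apply: (@continuous_comp _ _ _ (fun x : R => x - x0) (horner P)); last exact: continuous_horner.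
  by apply: cvgB; [exact: cvg_id|exact: cvg_cst].
- move=> x; apply: (le_trans (glob x)); set v := `|2 ^+ N m * x - k%:~R|.
  have v0 : 0 <= v by exact: normr_ge0.
  have tv : `|x - x0| <= (2 ^+ N m)^-1 * (1 + v).
    rewrite mulrC ler_pdivlMr// -[X in _ * X]gtr0_norm// -normrM.
    rewrite (_ : (x - x0) * 2 ^+ N m = (2 ^+ N m * x - k%:~R) - (2 ^+ N m * x0 - k%:R)); last by ring.
    by apply: (le_trans (ler_normB _ _)); rewrite -/v; lra.
  have i1 : (2 ^+ N m)^-1 <= 1 :> R by rewrite invf_le1// exprn_ege1// ler1n.
  have t1 : 1 + `|x - x0| <= 2 * (1 + v).
    by have := ler_wpM2r (addr_ge0 ler01 v0) i1; lra.
  have th : `|x - x0| `^ h <= 2 `^ (- (h * (N m)%:R)) * (1 + v) ^+ H.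
    apply: (@le_trans _ _ (((2 ^+ N m)^-1 * (1 + v)) `^ h)).
      by apply: ge0_ler_powR; rewrite // nnegrE// mulr_ge0 ?invr_ge0 ?addr_ge0// ltW.
    rewrite powRM ?invr_ge0 ?addr_ge0 ?(ltW p2)//.
    rewrite -pow2_nat -powRN -powRrM mulNr mulrC [X in - X]mulrC [leRHS]mulrC.
    apply: ler_wpM2r; first exact: pow2_ge0.
    by rewrite -powR_mulrn ?addr_ge0//; apply: ler_powR => //; rewrite lerDl.
  apply: (@le_trans _ _ (C2 * (2 `^ (- (h * (N m)%:R)) * (1 + v) ^+ H) * (2 * (1 + v)) ^+ K)).
    apply: ler_pM.
    - by rewrite mulr_ge0// powR_ge0.
    - by rewrite exprn_ge0// addr_ge0.
    - exact: (ler_wpM2l C20 th).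
    - by rewrite lerXn2r ?nnegrE ?mulr_ge0 ?addr_ge0.
  by rewrite exprMn exprD le_eqVlt; apply/orP; left; apply/eqP; ring.
- under [fun x => _ * psi _]eq_fun do rewrite mulrBl.
  by have := integrableB measurableT iF iP.
Qed.

End WaveletSeries.

(** * The tree *)

Definition blk (i : nat) : nat := (i.+1 ^ 2 + i.+1 + 2)%N.

Fixpoint gen (m : nat) : nat := if m is m'.+1 then (gen m' + blk m')%N else 0%N.

Lemma gen_ltS m : (gen m < gen m.+1)%N.
Proof. by rewrite /= -addn1 leq_add2l /blk addn2 ltnS. Qed.

Lemma gen_mono m n : (m <= n)%N -> (gen m <= gen n)%N.
Proof.
elim: n => [|n IH]; first by rewrite leqn0 => /eqP ->.
rewrite leq_eqVlt ltnS => /predU1P[->//|/IH h].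
exact: leq_trans h (ltnW (gen_ltS n)).
Qed.

Lemma gen_leq_inv m n : (gen m <= gen n)%N -> (m <= n)%N.
Proof.
move=> h; rewrite leqNgt; apply/negP => nm.
have := leq_trans (gen_ltS n) (gen_mono nm); lia.
Qed.

Lemma cube_le_gen m : (m ^ 3 <= 3 * gen m)%N.
Proof. by elim: m => // m IH; rewrite /= /blk; move: IH; rewrite !expnS !expn0; nia. Qed.

(** Generations grow like cubes, blocks like squares: passing from one level to the next does not
    affect an exponent. *)
Lemma blk_small (R : realType) (e : R) : 0 < e ->
  exists C : R, 0 <= C /\ forall m, (blk m)%:R <= e * (gen m)%:R + C.
Proof.
move=> e0; pose M := (Num.truncn (24 / e)).+1.
exists (blk M)%:R; split => // m.
have [mM|Mm] := leqP m M.
  apply: (@le_trans _ _ (blk M)%:R).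
    by rewrite ler_nat /blk !leq_add2r; have := leq_exp2r m.+1 M.+1 (ltn0Sn 1); lia.
  by rewrite lerDr mulr_ge0// ltW.
have hM : 24 / e < m%:R by apply: lt_trans (truncnS_gt _) _; rewrite ltr_nat.
apply: (@le_trans _ _ (e * (gen m)%:R)); last by rewrite lerDl.
have m24 : 24 <= e * m%:R by rewrite mulrC -ler_pdivrMr// ltW.
have b8 : (blk m <= 8 * m ^ 2)%N by rewrite /blk !expnS expn0; nia.
have g3 : (m%:R ^+ 3 <= 3 * (gen m)%:R :> R) by rewrite -natrX -natrM ler_nat cube_le_gen.
have b8R : (blk m)%:R <= 8 * m%:R ^+ 2 :> R by rewrite -natrX -natrM ler_nat.
have m2 : 0 <= m%:R ^+ 2 :> R by rewrite exprn_ge0.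
have : 24 * m%:R ^+ 2 <= e * m%:R ^+ 3.
  by rewrite [leRHS](_ : _ = e * m%:R * m%:R ^+ 2); [apply: ler_wpM2r|ring].
have := ler_wpM2l (ltW e0) g3; lra.
Qed.

Lemma sum_divmod (V : nmodType) (P Q : nat) (f : nat -> V) :
  \sum_(0 <= k < P * Q) f k = \sum_(0 <= p < P) \sum_(0 <= r < Q) f (p * Q + r)%N.
Proof.
elim: P => [|P IH]; first by rewrite mul0n !big_nil.
rewrite mulSn addnC (@big_cat_nat _ _ _ (P * Q)) ?leq_addr//= big_nat_recr//= IH; congr (_ + _).
rewrite -{1}[(P * Q)%N]add0n big_addn addKn.
by apply: eq_bigr => r _; rewrite addnC.
Qed.

Lemma dyadic_interval_div (R : realType) (y : R) (d k : nat) :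
  k%:R <= 2 ^+ d * y < k%:R + 1 -> (k %/ 2 ^ d)%:R <= y < (k %/ 2 ^ d)%:R + 1.
Proof.
move=> /andP[k1 k2]; have p2 : 0 < 2 ^+ d :> R by rewrite exprn_gt0.
have e1 : (k %/ 2 ^ d * 2 ^ d <= k)%N := leq_trunc_div _ _.
have e2 : (k < (k %/ 2 ^ d).+1 * 2 ^ d)%N by apply: ltn_ceil; rewrite expn_gt0.
apply/andP; split.
  rewrite -(ler_pM2l p2); apply: le_trans k1.
  by rewrite -natrX -natrM ler_nat mulnC.
rewrite -(ltr_pM2l p2); apply: lt_le_trans k2 _.
by rewrite !natr1 -natrX -natrM ler_nat mulnC.
Qed.

Lemma interval_nat_uniq (R : realType) (y : R) (k k' : nat) : k%:R <= y < k%:R + 1 -> k'%:R <= y < k'%:R + 1 -> k = k'.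
Proof.
move=> /andP[h1 h2] /andP[h3 h4].
have : (k%:R < k'.+1%:R :> R) by rewrite -natr1; lra.
have : (k'%:R < k.+1%:R :> R) by rewrite -natr1; lra.
rewrite !ltr_nat; lia.
Qed.

Section Nodes.
Variable a : nat -> nat -> nat.

Definition blk_code (i r : nat) : nat := (r %/ 4 %/ 2 ^ (i.+1 ^ 2))%N.
(* The digits [r] of block [i] are, from the most significant: [i+1] digits for the code,
   [(i+1)^2] digits of which only the last [a i code] are free, and [01]. *)
Definition admissible (i r : nat) : bool :=
  (r %% 4 == 1)%N && (r %/ 4 %% 2 ^ (i.+1 ^ 2) < 2 ^ a i (blk_code i r))%N.

(** [k] is the integer spelled by all digits so far, hence also the position of the interval in
    generation [gen m]; division by [2 ^ blk m'] separates the parent from the last block. *)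
Fixpoint active (m k : nat) : bool :=
  if m is m'.+1 then active m' (k %/ 2 ^ blk m') && admissible m' (k %% 2 ^ blk m') else k == 0%N.

Lemma act_lt m k : active m k -> (k < 2 ^ gen m)%N.
Proof.
elim: m k => [|m IH] k /=; first by move/eqP ->.
by move=> /andP[/IH h _]; rewrite expnD -ltn_divLR ?expn_gt0.
Qed.

Lemma act_mod4 m k : active m.+1 k -> (k %% 4 = 1)%N.
Proof.
have d4 : (4 %| 2 ^ blk m)%N by rewrite (_ : 4 = 2 ^ 2)%N// dvdn_exp2l// /blk; lia.
by move=> /= /andP[_ /andP[/eqP + _]]; rewrite modn_dvdm.
Qed.

(** The margins left by the final digits [01]: one interval on the left of a child, two on its
    right. They keep limit points off the excluded right ends and make up for the neighbours seen by
    a leader. *)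
Lemma act_child m k : active m.+1 k ->
  (k %/ 2 ^ blk m * 2 ^ blk m + 1 <= k)%N /\ (k + 3 <= (k %/ 2 ^ blk m).+1 * 2 ^ blk m)%N.
Proof.
move=> ak; have k4 := act_mod4 ak.
have : (4 %| 2 ^ blk m)%N by rewrite (_ : 4 = 2 ^ 2)%N// dvdn_exp2l// /blk; lia.
move=> /dvdnP[c cE]; have := divn_eq k (2 ^ blk m); have : (k %% 2 ^ blk m < 2 ^ blk m)%N.
  by rewrite ltn_mod expn_gt0.
have /andP[_ /andP[/eqP r4 _]] := ak.
move: r4; set r := (k %% _)%N; set q := (k %/ _)%N.
rewrite cE mulSn => r4 rlt kE; have := divn_eq r 4; rewrite r4 => rE.
by split; nia.
Qed.

Lemma act_sep m k k' : active m k -> active m k' -> (k <= k' + 3)%N -> (k' <= k + 3)%N -> k = k'.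
Proof.
case: m => [|m]; first by move=> /eqP -> /eqP ->.
move=> /act_mod4 h /act_mod4 h'.
have := divn_eq k 4; have := divn_eq k' 4; rewrite h h'; lia.
Qed.

End Nodes.

Fixpoint node_weight (R : realType) (w : nat -> nat -> R) (m k : nat) : R :=
  if m is m'.+1 then node_weight w m' (k %/ 2 ^ blk m') + w m' (blk_code m' (k %% 2 ^ blk m')) else 0.

Section Tree.
Variables (R : realType) (a : nat -> nat -> nat) (w : nat -> nat -> R) (alpha : R).
Hypothesis alpha0 : 0 < alpha.
Hypothesis w_ge : forall i u, alpha * (blk i)%:R <= w i u.

Local Notation act := (active a).
Local Notation wt := (node_weight w).

Lemma w_gt0 i u : 0 < w i u.
Proof.
apply: lt_le_trans (w_ge i u); rewrite mulr_gt0// ltr0n /blk; lia.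
Qed.

Lemma wt_ge m k : act m k -> alpha * (gen m)%:R <= wt m k.
Proof.
elim: m k => [|m IH] k /=; first by rewrite mulr0.
by move=> /andP[/IH h _]; rewrite natrD mulrDr lerD.
Qed.

Lemma wt_ge0 m k : act m k -> 0 <= wt m k.
Proof. by move=> /wt_ge; apply: le_trans; rewrite mulr_ge0// ltW. Qed.

Lemma act_anc p m k : (p <= m)%N -> act m k ->
  act p (k %/ 2 ^ (gen m - gen p)) /\ wt p (k %/ 2 ^ (gen m - gen p)) <= wt m k.
Proof.
elim: m k => [|m IH] k.
  by rewrite leqn0 => /eqP ->; rewrite subnn expn0 divn1.
rewrite leq_eqVlt ltnS => /predU1P[->|pm]; first by rewrite subnn expn0 divn1.
move=> /= /andP[ak _]; have [h1 h2] := IH _ pm ak.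
have -> : (gen m + blk m - gen p = blk m + (gen m - gen p))%N by have := gen_mono pm; lia.
rewrite expnD divnMA; split => //; apply: (le_trans h2).
by rewrite lerDl ltW// w_gt0.
Qed.

Definition in_node (m k : nat) (x : R) : Prop := k%:R <= 2 ^+ gen m * x < k%:R + 1.

(** Compatibility of the levels need not be required: [x] lies in a single half-open interval of
    each generation. *)
Definition branch (x : R) (kap : nat -> nat) : Prop :=
  forall m, act m (kap m) /\ in_node m (kap m) x.

Lemma inI_anc p m k x : (p <= m)%N -> in_node m k x -> in_node p (k %/ 2 ^ (gen m - gen p)) x.
Proof.
move=> pm; rewrite /in_node -{1 2}(subnK (gen_mono pm)) exprD -mulrA.
exact: dyadic_interval_div.
Qed.

Lemma branch_split x kap m k : branch x kap -> act m k -> k != kap m ->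
  exists p, [/\ (p < m)%N, wt p (kap p) <= wt m k &
    (k%:R + 1 + 2 ^+ (gen m - gen p.+1) <= 2 ^+ gen m * x \/
     2 ^+ gen m * x + 2 ^+ (gen m - gen p.+1) <= k%:R)].
Proof.
move=> bx; elim: m k => [|m IH] k ak.
  by have [/eqP -> _] := bx 0%N; rewrite (eqP ak).
move=> kk; set k' := (k %/ 2 ^ blk m)%N.
have ak' : act m k' by case/andP: ak.
have wk : wt m k' <= wt m.+1 k by rewrite /= lerDl ltW// w_gt0.
have [E|/(IH _ ak')[p [pm h1 h2]]] := eqVneq k' (kap m).
  exists m; split; rewrite -?E//.
  rewrite subnn expr0; have [am /andP[x1 x2]] := bx m.+1.
  have [h|h] := leqP (kap m.+1 + 4) k.
    right; have : ((kap m.+1 + 4)%N%:R <= k%:R :> R) by rewrite ler_nat.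
    rewrite natrD; lra.
  have [h'|h'] := leqP (k + 4) (kap m.+1).
    left; have : ((k + 4)%N%:R <= (kap m.+1)%:R :> R) by rewrite ler_nat.
    rewrite natrD; lra.
  by case/eqP: kk; apply: act_sep ak am _ _; lia.
exists p; split; [exact: leq_trans pm _|exact: le_trans wk|].
have gp := gen_mono pm.
have -> : (gen m.+1 - gen p.+1 = blk m + (gen m - gen p.+1))%N by move: gp; rewrite /=; lia.
rewrite exprD (_ : gen m.+1 = blk m + gen m)%N; last by rewrite /= addnC.
rewrite exprD -mulrA.
have p2 : 0 < 2 ^+ blk m :> R by rewrite exprn_gt0.
have k1 : k'%:R * 2 ^+ blk m <= k%:R :> R by rewrite -natrX -natrM ler_nat leq_trunc_div.
have k2 : k%:R + 1 <= (k'%:R + 1) * 2 ^+ blk m :> R.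
  by rewrite !natr1 -natrX -natrM ler_nat ltn_ceil// expn_gt0.
case: h2 => h2; [left|right]; have := ler_wpM2l (ltW p2) h2; lra.
Qed.

(** Nested intervals. The path starts at level [m0]; ancestors supply the lower levels of the
    branch. *)
Lemma path_branch (m0 : nat) (kap : nat -> nat) :
  (forall t, act (m0 + t) (kap t)) ->
  (forall t, kap t = (kap t.+1 %/ 2 ^ blk (m0 + t))%N) ->
  exists x, (exists kap', branch x kap') /\ forall t, in_node (m0 + t) (kap t) x.
Proof.
move=> ka kS.
pose l t : R := (kap t)%:R / 2 ^+ gen (m0 + t).
pose r t : R := ((kap t)%:R + 1) / 2 ^+ gen (m0 + t).
have p2 n : 0 < 2 ^+ n :> R by rewrite exprn_gt0.
have genS t : gen (m0 + t.+1) = (gen (m0 + t) + blk (m0 + t))%N by rewrite addnS.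
have lS t : l t <= l t.+1.
  have -> : l t = (kap t)%:R * 2 ^+ blk (m0 + t) / 2 ^+ gen (m0 + t.+1).
    by rewrite /l genS exprD; field; rewrite !gt_eqF.
  by rewrite ler_pM2r ?invr_gt0// -natrX -natrM ler_nat {1}(kS t) leq_trunc_div.
(* Strict because of the margin in [act_child]; it places the limit inside every half-open
   interval. *)
have rS t : r t.+1 < r t.
  have -> : r t = ((kap t)%:R + 1) * 2 ^+ blk (m0 + t) / 2 ^+ gen (m0 + t.+1).
    by rewrite /r genS exprD; field; rewrite !gt_eqF.
  rewrite /r ltr_pM2r ?invr_gt0//.
  rewrite !natr1 -natrX -natrM ltr_nat.
  have kt : act (m0 + t).+1 (kap t.+1) by rewrite -addnS.
  by have [_] := act_child kt; rewrite -kS; lia.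
have lmono s t : (s <= t)%N -> l s <= l t.
  elim: t => [|t IH]; first by rewrite leqn0 => /eqP ->.
  by rewrite leq_eqVlt ltnS => /predU1P[->//|/IH h]; exact: le_trans h (lS t).
have rmono s t : (s <= t)%N -> r t <= r s.
  elim: t => [|t IH]; first by rewrite leqn0 => /eqP ->.
  by rewrite leq_eqVlt ltnS => /predU1P[->//|/IH h]; exact: le_trans (ltW (rS t)) h.
have lr s t : l s <= r t.
  apply: (le_trans (lmono _ _ (leq_maxl s t))); apply: le_trans (rmono _ _ (leq_maxr s t)).
  by rewrite /l /r ler_pM2r ?invr_gt0// lerDl.
pose x := sup (range l).
have hs : has_sup (range l).
  split; first by exists (l 0%N), 0%N.
  by exists (r 0%N) => _ [s _ <-]; exact: lr.
have xI t : in_node (m0 + t) (kap t) x.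
  have xl : l t <= x by apply: ub_le_sup; [exact: hs.2|exists t].
  have xr : x <= r t.+1.
    by apply: ge_sup; [exact: hs.1|move=> _ [s _ <-]; exact: lr].
  apply/andP; split; first by rewrite -ler_pdivrMl// mulrC.
  by rewrite -ltr_pdivlMl// mulrC; exact: le_lt_trans xr (rS t).
exists x; split => //.
exists (fun m => kap m %/ 2 ^ (gen (m0 + m) - gen m))%N => m; split.
  by apply: (act_anc _ (ka m)).1; rewrite leq_addl.
by apply: inI_anc (xI m); rewrite leq_addl.
Qed.

End Tree.

(** * Partition sums of the tree *)

Section PartitionSums.
Variables (R : realType) (a : nat -> nat -> nat) (w : nat -> nat -> R).
Hypothesis a_le : forall i u, (a i u <= i.+1 ^ 2)%N.
Variable q : R.

Local Notation ok := (admissible a).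
Local Notation act := (active a).
Local Notation wt := (node_weight w).

Definition partition_sum (m : nat) : R := \sum_(0 <= k < 2 ^ gen m | act m k) 2 `^ (- (q * wt m k)).

Definition block_sum (i : nat) : R := \sum_(0 <= u < 2 ^ i.+1) 2 ^+ a i u * 2 `^ (- (q * w i u)).

Lemma sum_ok (i : nat) (c : nat -> R) :
  \sum_(0 <= r < 2 ^ blk i | ok i r) c (blk_code i r) = \sum_(0 <= u < 2 ^ i.+1) 2 ^+ a i u * c u.
Proof.
have -> : (2 ^ blk i = 2 ^ i.+1 * 2 ^ (i.+1 ^ 2) * 4)%N.
  by rewrite /blk !expnD; lia.
rewrite big_mkcond /= sum_divmod sum_divmod.
apply: eq_bigr => u _.
have aux v s : (v < 2 ^ (i.+1 ^ 2))%N -> (s < 4)%N ->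
    (if ok i ((u * 2 ^ (i.+1 ^ 2) + v) * 4 + s) then c (blk_code i ((u * 2 ^ (i.+1 ^ 2) + v) * 4 + s)) else 0)
    = if (s == 1)%N && (v < 2 ^ a i u)%N then c u else 0.
  move=> vl sl.
  rewrite /admissible /blk_code modnMDl (modn_small sl) divnMDl// (divn_small sl) addn0.
  rewrite divnMDl ?expn_gt0// (divn_small vl) addn0.
  by rewrite modnMDl (modn_small vl).
transitivity (\sum_(0 <= v < 2 ^ (i.+1 ^ 2)) (if (v < 2 ^ a i u)%N then c u else 0)).
  rewrite !big_nat; apply: eq_bigr => v /andP[_ vl].
  by rewrite !big_nat_recl// big_geq// !aux//= !add0r !addr0.
rewrite (@big_cat_nat _ _ _ (2 ^ a i u) 0)//=; last by rewrite leq_pexp2l.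
rewrite [X in _ + X]big_nat [X in _ + X]big1 ?addr0; last first.
  by move=> v /andP[h _]; rewrite ltnNge h.
rewrite big_nat (eq_bigr (fun=> c u)); last by move=> v /andP[_ ->].
by rewrite -big_nat sumr_const_nat subn0 -natrX mulr_natl.
Qed.

(** Admissibility and weight of a block depend on its level and digits, not on the node above it. *)
Lemma ZS (m : nat) : partition_sum m.+1 = partition_sum m * block_sum m.
Proof.
rewrite /partition_sum (_ : 2 ^ gen m.+1 = 2 ^ gen m * 2 ^ blk m)%N; last by rewrite /= expnD.
rewrite /block_sum -(sum_ok m (fun u => 2 `^ (- (q * w m u)))).
rewrite [in LHS]big_mkcond /= sum_divmod.
rewrite [X in _ = X * _]big_mkcond mulr_suml; apply: eq_bigr => p _.
rewrite [X in _ = _ * X]big_mkcond mulr_sumr /= !big_nat; apply: eq_bigr => r /andP[_ rl].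
rewrite divnMDl ?expn_gt0// (divn_small rl) addn0 modnMDl (modn_small rl).
case: (act m p) => /=; last by rewrite mul0r.
case: (ok m r); last by rewrite mulr0.
by rewrite -pow2D; congr (2 `^ _); ring.
Qed.

Lemma Z0 : partition_sum 0 = 1.
Proof.
by rewrite /partition_sum big_mkcond /= expn0 big_nat1 /= mulr0 oppr0 powRr0.
Qed.

Lemma Z_ge0 m : 0 <= partition_sum m.
Proof. by apply: sumr_ge0 => u _; rewrite pow2_ge0. Qed.

End PartitionSums.

(** * Exponents and leaders of the cascade *)

Section Generalities.
Variable R : realType.

Lemma ereal_le_of_lt (h s : \bar R) : h != -oo%E ->
  (forall t : R, (t%:E < h)%E -> (t%:E <= s)%E) -> (h <= s)%E.
Proof.
case: s => [s| |] hN H; [|by rewrite leey|].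
  rewrite leNgt; apply/negP; case: h hN H => [r _ H|_ H _|//].
    rewrite lte_fin => sr; have := H ((s + r) / 2); rewrite lte_fin lee_fin.
    by move=> /(_ ltac:(lra)); lra.
  by have := H (s + 1) (ltry _); rewrite lee_fin; lra.
case: h hN H => [r _ H|_ H|//].
  by have := H (r - 1); rewrite lte_fin leeNy_eq => /(_ ltac:(lra)).
by have := H 0 (ltry _); rewrite leeNy_eq.
Qed.

Lemma count_window (K L D : nat) :
  (\sum_(0 <= k < K) ((L <= k.+1) && (k <= L + D)) <= D.+2)%N.
Proof.
suff : (\sum_(0 <= k < K) ((L <= k.+1) && (k <= L + D)) <= minn D.+2 (K.+1 - L))%N by lia.
elim: K => [|K IH]; first by rewrite big_nil.
by rewrite big_nat_recr//=; have [?|?] := leqP L K.+1; have [?|?] := leqP K (L + D); rewrite /=; lia.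
Qed.

(** Double counting: a node [v] is charged by at most [D.+2] positions [k]. Used to compare leaders,
    one for each [k], with nodes. *)
Lemma window_sum (K V D : nat) (A : pred nat) (c : nat -> nat) (g : nat -> R) :
  (forall v, 0 <= g v) ->
  \sum_(0 <= k < K) \sum_(0 <= v < V | A v && ((c v * D <= k.+1) && (k <= c v * D + D))%N) g v
  <= D.+2%:R * \sum_(0 <= v < V | A v) g v.
Proof.
move=> g0; rewrite mulr_sumr.
under eq_bigr => k _ do rewrite big_mkcondr /=.
rewrite exchange_big /=; apply: ler_sum => v _.
rewrite (eq_bigr (fun k : nat => ((c v * D <= k.+1) && (k <= c v * D + D))%N%:R * g v)); last first.
  by move=> k _; case: ifP; rewrite ?mul1r ?mul0r.
rewrite -mulr_suml ler_wpM2r// -natr_sum ler_nat; exact: count_window.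
Qed.

Lemma term_le_sum (V v : nat) (A : pred nat) (g : nat -> R) : (forall v, 0 <= g v) ->
  (v < V)%N -> A v -> g v <= \sum_(0 <= v < V | A v) g v.
Proof.
move=> g0 vV Av; rewrite (big_rem v) ?mem_index_iota//= Av lerDl.
exact: sumr_ge0.
Qed.

Lemma gen_bracket n : (0 < n)%N -> exists m, (gen m < n <= gen m.+1)%N.
Proof.
elim: n => // n IH _; have [->|n0] := posnP n.
  by exists 0%N; rewrite /= /blk; lia.
have [m /andP[h1 h2]] := IH n0.
have [h|h] := leqP n.+1 (gen m.+1); first by exists m; rewrite h andbT; lia.
by exists m.+1; have := gen_ltS m.+1; lia.
Qed.

Lemma limn_einf_ge (u : (\bar R)^nat) (t : \bar R) (M : nat) :
  (forall n, (M <= n)%N -> (t <= u n)%E) -> (t <= limn_einf u)%E.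
Proof.
move=> H; rewrite limn_einf_lim; apply: lime_ge; first exact: is_cvg_einfs.
exists M => // n /= Mn; apply: le_ereal_inf_tmp => _ [k /= nk <-].
exact: H (leq_trans Mn nk).
Qed.

Lemma limn_einf_le (u : (\bar R)^nat) (t : \bar R) :
  (forall M, exists2 n, (M <= n)%N & (u n <= t)%E) -> (limn_einf u <= t)%E.
Proof.
move=> H; rewrite limn_einf_lim; apply: lime_le; first exact: is_cvg_einfs.
apply: nearW => M; have [n Mn un] := H M.
by apply: le_trans un; apply: ereal_inf_lbound; exists n.
Qed.

End Generalities.

Section CascadeFunction.
Variables (R : realType) (psi : R -> R).
Hypothesis Spsi : schwartz psi.
Hypothesis Opsi : orthonormal_wavelet psi.
Variables (a : nat -> nat -> nat) (w : nat -> nat -> R) (alpha : R).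
Hypothesis alpha0 : 0 < alpha.
Hypothesis w_ge : forall i u, alpha * (blk i)%:R <= w i u.

Local Notation act := (active a).
Local Notation wt := (node_weight w).
Local Notation Z := (partition_sum a w).

Definition cascade : R -> R := wavelet_series psi gen act wt.
Local Notation F := cascade.

Let alt := @act_lt a.
Let wge := @wt_ge R a w alpha w_ge.

Lemma cascade_bounded : bounded_real_fun F.
Proof. exact: (wavelet_series_bounded Spsi gen_ltS alpha0 wge). Qed.

Lemma cascade_holder : holder_continuous F.
Proof. exact: (wavelet_series_holder Spsi gen_ltS alpha0 wge). Qed.

Lemma cascade_wcoef m k : act m k -> wcoef psi F (gen m) k%:Z = 2 `^ (- wt m k).
Proof. exact: (wcoef_active Spsi Opsi gen_ltS alpha0 alt wge). Qed.

Lemma cascade_wcoef_neq0 (j : nat) (k : int) : wcoef psi F j k != 0 ->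
  exists m k' : nat, [/\ act m k', j = gen m & k = k'%:Z].
Proof. exact: (wcoef_neq0 Spsi Opsi gen_ltS alpha0 wge). Qed.

Definition holder_at (x0 h : R) : Prop := 0 <= h /\
  exists (P : {poly R}) (C delta : R), 0 < delta /\
    forall x, `|x - x0| < delta -> `|F x - P.[x - x0]| <= C * `|x - x0| `^ h.

Lemma holder_at_wt x kap h : branch a x kap -> holder_at x h ->
  exists C, forall m, h * (gen m)%:R - C <= wt m (kap m).
Proof.
move=> bx [h0 [P [C [d [d0 H]]]]].
have [C' [C'0 HC]] := coefficients_of_holder Spsi Opsi gen_ltS alpha0 alt wge h0 d0 H.
exists (ln C' / ln 2) => m.
have [am /andP[x1 x2]] := bx m.
have : 2 `^ (- wt m (kap m)) <= C' * 2 `^ (- (h * (gen m)%:R)).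
  by apply: HC => //; rewrite ger0_norm; lra.
have C'E : C' = 2 `^ (ln C' / ln 2).
  by rewrite /powR pnatr_eq0 /= divfK ?lnK ?posrE// gt_eqF// ln_gt0// ltr1n.
rewrite [X in X * _]C'E -pow2D ler_pow2; lra.
Qed.

(** A node off the branch weighs at least as much as the last common ancestor, of level [p], and
    lies at distance at least [2 ^ (- gen p.+1)] from [x]. This is the two-microlocal condition up
    to one block, which [blk_small] absorbs. *)
Lemma holder_at_of_wt x kap h h' C : branch a x kap -> 0 <= h -> h < h' ->
  (forall m, h' * (gen m)%:R - C <= wt m (kap m)) -> holder_at x h.
Proof.
move=> bx h0 hh' HC.
have h'0 : 0 < h' by exact: le_lt_trans hh'.
(* A fraction [th] of the weight, bounded below by [alpha * gen m], pays for the geometric factor.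
   The rest still has slope [(1 - th) h' = h2], midway between [h] and [h'], and [h2 - h] pays for
   the extra block. *)
pose th := (h' - h) / (2 * h'); pose h2 := (h + h') / 2.
have th0 : 0 < th by rewrite divr_gt0 ?mulr_gt0// subr_gt0.
have th1 : th <= 1 by rewrite ler_pdivrMr ?mulr_gt0//; lra.
have h2E : (1 - th) * h' = h2 by rewrite /th /h2; field; rewrite gt_eqF.
have hh2 : 0 < h2 - h by rewrite /h2; lra.
pose b := th * alpha.
have b0 : 0 < b by rewrite mulr_gt0.
have [r0 r1] := ratio_bounds b0.
pose M := (Num.truncn h).+1.
have hM : h < M%:R := truncnS_gt _.
have lM l : (l < M)%N -> l%:R <= h.
  by rewrite ltnS => lt; rewrite -truncn_ge_nat// ler_nat.
have [K [K0 HK]] := wavelet_series_taylor Spsi gen_ltS alpha0 wge h0 hM lM r0 r1.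
have [C1 [C10 HC1]] : exists C1 : R, 0 <= C1 /\ forall p, h * (gen p.+1)%:R <= h2 * (gen p)%:R + C1.
  have [|C2 [C20 HC2]] := @blk_small R ((h2 - h) / (h + 1)).
    by rewrite divr_gt0// ltr_wpDl.
  exists ((h + 1) * C2); split; first by rewrite mulr_ge0// addr_ge0.
  move=> p; rewrite /= natrD mulrDr.
  have h10 : 0 < h + 1 by rewrite ltr_wpDl.
  have := ler_wpM2l (ltW h10) (HC2 p); rewrite mulrDr mulrA mulrCA mulfV ?gt_eqF// mulr1.
  have : 0 <= (blk p)%:R :> R by [].
  lra.
pose E := C1 + `|C|.
have [||P [sP HP]] := HK x (2 `^ E); first exact: pow2_ge0.
  move=> m k ak; rewrite -pow2D.
  set d := `|2 ^+ gen m * x - k%:R|.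
  (* [2 ^ g] bounds the distance factor from below: [g = 0] on the branch, [g = gen m - gen p.+1]
     off it. *)
  suff [p [g [g0 dg wg]]] : exists p g : R, [/\ True, 2 `^ g <= 1 + d &
      h * (gen m)%:R - h * g + b * (gen m)%:R - E <= wt m k].
    apply: (@le_trans _ _ (2 `^ E * 2 `^ (- (b * (gen m)%:R)) * (2 `^ g) `^ h)).
      by rewrite -powRrM -!pow2D ler_pow2; lra.
    apply: ler_pM; rewrite ?mulr_ge0 ?powR_ge0//.
      apply: ler_wpM2l; first exact: pow2_ge0.
      exact: (pow2_gen_le gen_ltS m (ltW b0)).
    by apply: ge0_ler_powR => //; rewrite nnegrE ?powR_ge0 ?addr_ge0 ?/d.
  exists 0.
  have wa := wge ak.
  have nC := ler_norm C.
  have mix (p : nat) : wt p (kap p) <= wt m k ->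
     h2 * (gen p)%:R - `|C| + b * (gen m)%:R <= wt m k.
    move=> wp.
    have := HC p => hp.
    have e1 : (1 - th) * (h' * (gen p)%:R - C) <= (1 - th) * wt m k.
      by apply: ler_wpM2l; [lra|exact: le_trans hp wp].
    have e2 : th * (alpha * (gen m)%:R) <= th * wt m k by apply: ler_wpM2l; [exact: ltW|].
    have e3 : (1 - th) * C <= `|C|.
      apply: le_trans (ler_wpM2l _ nC) _; first lra.
      by rewrite ler_piMl//; lra.
    move: e1 e2; rewrite mulrBr mulrA h2E mulrA -/b; lra.
  have [kk|nk] := eqVneq k (kap m).
    exists 0; split => //; first by rewrite powRr0 lerDl /d.
    have := mix m; rewrite kk => /(_ (lexx _)).
    have : 0 <= (h2 - h) * (gen m)%:R by rewrite mulr_ge0// ltW.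
    rewrite /E; lra.
  have [p [pm wp dist]] := branch_split alpha0 w_ge bx ak nk.
  have gp : (gen p.+1 <= gen m)%N by exact: gen_mono.
  exists (gen m - gen p.+1)%:R; split => //.
    rewrite pow2_nat /d.
    have := ler_norm (2 ^+ gen m * x - k%:R); have := ler_norm (- (2 ^+ gen m * x - k%:R)).
    by rewrite normrN; case: dist; lra.
  have := mix p wp; have := HC1 p; rewrite natrB// /E; lra.
split => //; exists P, (K * 2 `^ E), 1; split => // y _; exact: HP.
Qed.

Lemma holder_at0 x : holder_at x 0.
Proof.
have [B HB] := cascade_bounded.
split=> //; exists 0, B, 1; split => // y _.
by rewrite horner0 subr0 powRr0 mulr1.
Qed.

Lemma holder_at_le_hexp x t : holder_at x t -> (t%:E <= hexp F x)%E.
Proof. by move=> H; apply: ereal_sup_ubound; exists t. Qed.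

Lemma hexp_ge0 x : (0 <= hexp F x)%E.
Proof. exact: holder_at_le_hexp (holder_at0 x). Qed.

Lemma hexp_lt_wt x kap t : branch a x kap -> (t%:E < hexp F x)%E ->
  exists C, forall m, t * (gen m)%:R - C <= wt m (kap m).
Proof.
move=> bx /ereal_sup_gt[_ [t' H <-]]; rewrite lte_fin => tt'.
have [C HC] := holder_at_wt bx H.
exists C => m; apply: le_trans (HC m); rewrite lerD2r ler_wpM2r//; exact: ltW.
Qed.

Lemma hexp_gt_wt x kap t C : branch a x kap -> (hexp F x < t%:E)%E ->
  exists m, wt m (kap m) < t * (gen m)%:R - C.
Proof.
move=> bx xt; apply: contrapT => /forallNP H.
have h0 := hexp_ge0 x; move: xt h0; case E: (hexp F x) => [r| |]//.
rewrite lte_fin lee_fin => rt r0.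
have : holder_at x ((r + t) / 2).
  apply: (@holder_at_of_wt x kap _ t C bx); [lra|lra|move=> m].
  by rewrite leNgt; apply/negP; exact: H.
by move/holder_at_le_hexp; rewrite E lee_fin; lra.
Qed.

(** The exponent as the liminf of [wt / gen], phrased with finite slopes so that [h = +oo] is
    included. *)
Lemma hexp_eq_of_wt x kap (h : \bar R) : branch a x kap -> (0 <= h)%E ->
  (forall t : R, (t%:E < h)%E -> exists C, forall m, t * (gen m)%:R - C <= wt m (kap m)) ->
  (forall t C : R, (h < t%:E)%E -> exists m, wt m (kap m) < t * (gen m)%:R - C) ->
  hexp F x = h.
Proof.
move=> bx h0 lo up; apply/eqP; rewrite eq_le; apply/andP; split.
  apply: ge_ereal_sup => _ [t tH <-].
  rewrite leNgt; apply/negP => ht.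
  have [C HC] := holder_at_wt bx tH.
  by have [m] := up t C ht; rewrite ltNge HC.
apply: ereal_le_of_lt; first by case: (h) h0.
move=> t th; have [t0|t0] := ltP t 0.
  by apply: le_trans (hexp_ge0 x); rewrite lee_fin ltW.
have [t' [tt' t'h]] : exists t' : R, t < t' /\ (t'%:E < h)%E.
  case: (h) th => [r| |]//.
    by rewrite lte_fin => tr; exists ((t + r) / 2); rewrite lte_fin; split; lra.
  by move=> _; exists (t + 1); rewrite ltry; split => //; lra.
have [C HC] := lo t' t'h.
exact: holder_at_le_hexp (holder_at_of_wt bx t0 tt' HC).
Qed.

(** The inclusion in the definition of [leader], as a condition on the ancestor of generation [n]:
    it is [k] or a neighbour of [k]. *)
Definition near_node (n : nat) (k : int) (m v : nat) : Prop :=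
  [/\ (n <= gen m)%N, k - 1 <= (v %/ 2 ^ (gen m - n))%:Z &
      (v %/ 2 ^ (gen m - n))%:Z <= k + 1].

Lemma near_nodeP (n m v : nat) (k : int) : (n <= gen m)%N ->
  ((k - 1)%:~R / 2 ^+ n <= v%:~R / 2 ^+ gen m :> R /\
   (v%:Z + 1)%:~R / 2 ^+ gen m <= (k + 2)%:~R / 2 ^+ n :> R) <-> near_node n k m v.
Proof.
move=> nm; set d := (gen m - n)%N; set c := (v %/ 2 ^ d)%N.
have dE : (gen m = n + d)%N by rewrite subnKC.
have c1 : c%:Z * 2 ^+ d <= v%:Z.
  by rewrite -!natz -natrX -natrM ler_nat leq_trunc_div.
have c2 : v%:Z + 1 <= (c%:Z + 1) * 2 ^+ d.
  by rewrite -!natz !natr1 -natrX -natrM ler_nat ltn_ceil// expn_gt0.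
have p0 : 0 < 2 ^+ d :> int by rewrite exprn_gt0.
have q0 : 0 < 2 ^+ n :> R by rewrite exprn_gt0.
have q1 : 0 < 2 ^+ gen m :> R by rewrite exprn_gt0.
have E1 : ((k - 1)%:~R / 2 ^+ n <= v%:~R / 2 ^+ gen m :> R) = ((k - 1) * 2 ^+ d <= v%:Z).
  rewrite ler_pdivrMr// mulrAC ler_pdivlMr// dE exprD mulrA mulrAC.
  rewrite ler_pM2r// -(ler_int R) rmorphM rmorphXn //.
have E2 : ((v%:Z + 1)%:~R / 2 ^+ gen m <= (k + 2)%:~R / 2 ^+ n :> R) = (v%:Z + 1 <= (k + 2) * 2 ^+ d).
  rewrite ler_pdivrMr// mulrAC ler_pdivlMr// dE exprD mulrA mulrAC.
  rewrite ler_pM2r// -(ler_int R) rmorphM rmorphXn //.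
rewrite E1 E2; split=> [[h1 h2]|[_]]; last first.
  rewrite -/d -/c => h1 h2; split.
    by apply: le_trans c1; rewrite ler_wpM2r// ltW.
  by apply: (le_trans c2); rewrite ler_wpM2r ?(ltW p0)//; lia.
split => //; rewrite -/d -/c.
    have : (k - 1) * 2 ^+ d < (c%:Z + 1) * 2 ^+ d by apply: (le_lt_trans h1); lia.
    by rewrite ltr_pM2r//; lia.
  have : c%:Z * 2 ^+ d < (k + 2) * 2 ^+ d by apply: (le_lt_trans c1); lia.
  by rewrite ltr_pM2r//; lia.
Qed.

Local Notation lead := (leader psi F).

Lemma leader_le n k L : 0 <= L ->
  (forall m v, act m v -> near_node n k m v -> 2 `^ (- wt m v) <= L) -> lead n k <= L.
Proof.
move=> L0 H; apply: ge_sup.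
  exists `|wcoef psi F n k|, n, k; split => //.
  by split; [|split => //]; rewrite ler_pM2r ?invr_gt0 ?exprn_gt0// ler_int; lia.
move=> _ [j [k' [nj [h1 [h2 ->]]]]].
have [->|/cascade_wcoef_neq0[m [v [av jm kv]]]] := eqVneq (wcoef psi F j k') 0.
  by rewrite normr0.
rewrite jm kv cascade_wcoef// gtr0_norm ?pow2_gt0//; apply: H => //.
by apply/near_nodeP; rewrite -?jm// -kv.
Qed.

Lemma leader_ge n k m v : act m v -> near_node n k m v -> 2 `^ (- wt m v) <= lead n k.
Proof.
move=> av nv; apply: ub_le_sup.
  exists 1 => _ [j [k' [_ [_ [_ ->]]]]].
  have [->|/cascade_wcoef_neq0[m' [v' [av' -> ->]]]] := eqVneq (wcoef psi F j k') 0.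
    by rewrite normr0.
  rewrite cascade_wcoef// gtr0_norm ?pow2_gt0// -[leRHS](powRr0 2) ler_pow2 oppr_le0.
  exact: (wt_ge0 alpha0 w_ge av').
have nm : (n <= gen m)%N by case: nv.
have [h1 h2] := (near_nodeP v k nm).2 nv.
exists (gen m), v%:Z; do 3!split => //.
by rewrite cascade_wcoef// gtr0_norm ?pow2_gt0.
Qed.

Lemma leader_gt0 n k : 0 < lead n k -> exists m v, act m v /\ near_node n k m v.
Proof.
apply: contraPP => H; apply/negP; rewrite -leNgt; apply: leader_le => // m v av nv.
by exfalso; apply: H; exists m, v.
Qed.

Lemma near_node_anc n k p m v : (n <= gen p)%N -> (p <= m)%N ->
  near_node n k m v -> near_node n k p (v %/ 2 ^ (gen m - gen p)).
Proof.
move=> np pm [nm h1 h2]; have gp := gen_mono pm.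
rewrite /near_node -divnMA -expnD.
by rewrite (_ : (gen m - gen p + (gen p - n) = gen m - n)%N)//; lia.
Qed.

(** Positive leaders only place [x] next to a node at each level. By the margins of [act_child], the
    parent of such a node does contain [x], so level [m.+1] is used to find the node of level
    [m]. *)
Lemma wsuppP x : wsupp psi F x <-> exists kap, branch a x kap.
Proof.
split=> [[/andP[x0 x1] H]|[kap bx]]; last first.
  have x01 : 0 <= x <= 1.
    have [/eqP k0 /andP[h1 h2]] := bx 0%N; move: h1 h2; rewrite k0 /= expr0; lra.
  split => // n n1; have [am /andP[h1 h2]] := bx n.
  apply: lt_le_trans (pow2_gt0 _) (leader_ge am _).
  have nn : (n <= gen n)%N by exact: leq_gen gen_ltS n.
  have fl : Num.floor (2 ^+ n * x) = (kap n %/ 2 ^ (gen n - n))%:Z.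
    apply: floor_def.
    have := @dyadic_interval_div R (2 ^+ n * x) (gen n - n) (kap n).
    rewrite mulrA -exprD subnK// => /(_ _); rewrite h1 h2 => /(_ isT) /andP[i1 i2].
    by rewrite i1 intrD.
  by split; rewrite // fl; lia.
have weak m : exists v, act m v /\ v%:R - 1 <= 2 ^+ gen m * x < v%:R + 2.
  case: m => [|m]; first by exists 0%N; split => //; rewrite /= expr0; lra.
  have g1 : (0 < gen m.+1)%N by exact: leq_ltn_trans (gen_ltS m).
  have [p [v [av nv]]] := leader_gt0 (H _ g1).
  have mp : (m.+1 <= p)%N by apply: gen_leq_inv; case: nv.
  have [//|_ i1 i2] := near_node_anc _ mp nv.
  have [av' _] := act_anc alpha0 w_ge mp av.
  exists (v %/ 2 ^ (gen p - gen m.+1))%N; split => //.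
  move: i1 i2; rewrite subnn expn0 divn1; set u := (v %/ _)%N.
  have /andP[f1 f2] := floor_itv (2 ^+ gen m.+1 * x).
  set f := Num.floor _ in f1 f2 *.
  move=> i1 i2; rewrite -(ler_int R) intrB in i1; rewrite -(ler_int R) intrD in i2.
  rewrite intrD in f2; apply/andP; split; move: i1 i2; rewrite -!pmulrn; lra.
have [kap Hk] := choice weak.
exists (fun m => kap m.+1 %/ 2 ^ blk m)%N => m.
have [am /andP[h1 h2]] := Hk m.+1.
have [c1 c2] := act_child am.
split; first by case/andP: am.
move: h1 h2; rewrite (_ : gen m.+1 = blk m + gen m)%N; last by rewrite /= addnC.
rewrite exprD -mulrA => h1 h2.
set q := (kap m.+1 %/ 2 ^ blk m)%N in c1 c2 *.
have p2 : 0 < 2 ^+ blk m :> R by rewrite exprn_gt0.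
have c1' : q%:R * 2 ^+ blk m + 1 <= (kap m.+1)%:R :> R by rewrite -natrX -natrM natr1 -addn1 ler_nat.
have c2' : (kap m.+1)%:R + 3 <= (q%:R + 1) * 2 ^+ blk m :> R.
  by rewrite natr1 -natrX -natrM -natrD ler_nat.
apply/andP; split; first by rewrite -(ler_pM2l p2); lra.
by rewrite -(ltr_pM2l p2); lra.
Qed.

(** Descendants have smaller coefficients, and by [act_sep] the neighbouring intervals meet no other
    node. *)
Lemma leader_gen m k : act m k -> lead (gen m) k%:Z = 2 `^ (- wt m k).
Proof.
move=> ak; apply/eqP; rewrite eq_le; apply/andP; split.
  apply: leader_le; first exact: pow2_ge0.
  move=> p v av nv.
  have mp : (m <= p)%N by apply: gen_leq_inv; case: nv.
  have [au wu] := act_anc alpha0 w_ge mp av.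
  have [_] := nv; set u := (v %/ _)%N in au wu * => h1 h2.
  have -> : k = u by apply: act_sep ak au _ _; lia.
  by rewrite ler_pow2 lerN2.
apply: leader_ge => //; split; rewrite // subnn expn0 divn1; lia.
Qed.

(** * Sums of powers of leaders and the scaling function *)

Definition leader_sum (q : R) (n : nat) : R :=
  \sum_(0 <= k < 2 ^ n | 0 < lead n k%:Z) powR (lead n k%:Z) q.

Lemma Z_le_leader_sum q m : Z q m <= leader_sum q (gen m).
Proof.
rewrite /partition_sum /leader_sum [leLHS]big_mkcond [leRHS]big_mkcond /=; apply: ler_sum => k _.
have [ak|_] := boolP (act m k); last by case: ifP => // _; exact: powR_ge0.
by rewrite leader_gen// pow2_gt0 -powRrM mulNr mulrC.
Qed.

(** Nodes seen by one leader have positions at most 2 apart in generation [n], so [act_sep] gives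
    them the same ancestor [u] of level [m]. The leader lies between the coefficient of [u] and that
    of a child [v] of [u]. *)
Lemma leader_bounds m n (k : nat) : (gen m < n)%N -> (n <= gen m.+1)%N -> 0 < lead n k%:Z ->
  exists v u : nat, [/\ act m.+1 v, near_node n k%:Z m.+1 v & 2 `^ (- wt m.+1 v) <= lead n k%:Z] /\
  [/\ act m u, (u * 2 ^ (n - gen m) <= k.+1)%N, (k <= u * 2 ^ (n - gen m) + 2 ^ (n - gen m))%N
    & lead n k%:Z <= 2 `^ (- wt m u)].
Proof.
move=> mn nm l0.
have anc p v : act p v -> near_node n k%:Z p v -> let c := (v %/ 2 ^ (gen p - n))%N in
    [/\ (m < p)%N, (k <= c.+1)%N, (c <= k.+1)%N, act m (c %/ 2 ^ (n - gen m)) &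
      wt m (c %/ 2 ^ (n - gen m)) <= wt p v].
  move=> av [np h1 h2] c.
  have mp : (m < p)%N.
    by rewrite ltnNge; apply/negP => /gen_mono pm; have := leq_trans np pm; rewrite leqNgt mn.
  have [] := act_anc alpha0 w_ge (ltnW mp) av.
  have -> : (v %/ 2 ^ (gen p - gen m) = c %/ 2 ^ (n - gen m))%N.
    by rewrite /c -divnMA -expnD; congr (_ %/ 2 ^ _)%N; lia.
  by move: h1 h2; rewrite -/c => h1 h2 ac wc; split => //; lia.
have [p [v [av nv]]] := leader_gt0 l0.
have [mp k1 k2 au wu] := anc p v av nv.
have nv1 := near_node_anc nm mp nv.
have [av1 _] := act_anc alpha0 w_ge mp av.
exists (v %/ 2 ^ (gen p - gen m.+1))%N, (v %/ 2 ^ (gen p - n) %/ 2 ^ (n - gen m))%N; split.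
  by split => //; exact: leader_ge.
set c := (v %/ 2 ^ (gen p - n))%N in k1 k2 au wu *.
set d := (n - gen m)%N in au wu *.
have e1 := leq_trunc_div c (2 ^ d).
have e2 : (c < (c %/ 2 ^ d).+1 * 2 ^ d)%N by apply: ltn_ceil; rewrite expn_gt0.
split => //; first exact: leq_trans e1 k2.
  by move: e2; rewrite mulSn; lia.
apply: leader_le; first exact: pow2_ge0.
move=> p' v' av' nv'; have [_ k1' k2' au' wu'] := anc p' v' av' nv'.
rewrite ler_pow2 lerN2; apply: le_trans wu'; rewrite le_eqVlt; apply/orP; left.
apply/eqP; congr (node_weight _ _ _); apply: act_sep au au' _ _.
  set c' := (v' %/ 2 ^ (gen p' - n))%N in k1' k2' *; rewrite -/d.
  have : (c <= 3 * 2 ^ d + c')%N by clear -k1 k2 k1' k2'; have := expn_gt0 2 d; lia.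
  by move=> /(leq_div2r (2 ^ d)); rewrite divnMDl ?expn_gt0// addnC.
set c' := (v' %/ 2 ^ (gen p' - n))%N in k1' k2' *; rewrite -/d.
have : (c' <= 3 * 2 ^ d + c)%N by clear -k1 k2 k1' k2'; have := expn_gt0 2 d; lia.
by move=> /(leq_div2r (2 ^ d)); rewrite divnMDl ?expn_gt0// addnC.
Qed.

(** The sign of [q] decides which side of [leader_bounds] is used: the node above for [q >= 0], the
    node below for [q < 0]. *)
Lemma leader_sum_le q m n : (gen m < n)%N -> (n <= gen m.+1)%N ->
  leader_sum q n <= 3 * Z q m.+1 + 3 * 2 ^+ blk m * Z q m.
Proof.
move=> mn nm.
pose g1 v : R := 2 `^ (- (q * wt m.+1 v)); pose g2 v : R := 2 `^ (- (q * wt m v)).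
have g10 v : 0 <= g1 v by exact: pow2_ge0.
have g20 v : 0 <= g2 v by exact: pow2_ge0.
pose c1 v := (v %/ 2 ^ (gen m.+1 - n))%N.
pose d := (n - gen m)%N.
have W1 := @window_sum R (2 ^ n) (2 ^ gen m.+1) 1 (act m.+1) c1 g1 g10.
have W2 := @window_sum R (2 ^ n) (2 ^ gen m) (2 ^ d) (act m) id g2 g20.
have Z0m : 0 <= Z q m by exact: Z_ge0.
have D3 : (2 ^ d).+2%:R <= 3 * 2 ^+ blk m :> R.
  rewrite -natrX -natrM ler_nat.
  have : (2 ^ d <= 2 ^ blk m)%N by rewrite leq_pexp2l// /d; move: nm => /=; lia.
  have := expn_gt0 2 d; lia.
apply: le_trans (lerD W1 (le_trans W2 (ler_wpM2r Z0m D3))).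
rewrite /leader_sum big_mkcond /= -big_split /=; apply: ler_sum => k _.
case: ifPn => [l0|_]; last by rewrite addr_ge0// sumr_ge0.
have [v [u [[av nv lv] [au u1 u2 lu]]]] := leader_bounds mn nm l0.
have t1 : g1 v <= \sum_(0 <= v < 2 ^ gen m.+1 | act m.+1 v && ((c1 v * 1 <= k.+1) && (k <= c1 v * 1 + 1))%N) g1 v.
  apply: (@term_le_sum R _ _ (fun v => act m.+1 v && ((c1 v * 1 <= k.+1) && (k <= c1 v * 1 + 1))%N)) => //.
    exact: act_lt av.
  rewrite av /= muln1; case: nv => _; rewrite -/(c1 v); move: (c1 v) => x h1 h2.
  by clear -h1 h2; apply/andP; split; lia.
have t2 : g2 u <= \sum_(0 <= v < 2 ^ gen m | act m v && ((v * 2 ^ d <= k.+1) && (k <= v * 2 ^ d + 2 ^ d))%N) g2 v.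
  apply: (@term_le_sum R _ _ (fun v => act m v && ((v * 2 ^ d <= k.+1) && (k <= v * 2 ^ d + 2 ^ d))%N)) => //.
    exact: act_lt au.
  by rewrite au u1 u2.
have [q0|/ltW q0] := leP 0 q.
  apply: (@le_trans _ _ (g2 u)).
    rewrite /g2 mulrC -mulNr powRrM.
    by apply: ge0_ler_powR => //; rewrite nnegrE ?pow2_ge0// ltW.
  apply: (le_trans t2); rewrite lerDr; exact: sumr_ge0.
apply: (@le_trans _ _ (g1 v)).
  rewrite /g1 mulrC -mulNr powRrM -(opprK q) [leLHS]powRN [leRHS]powRN.
  rewrite lef_pV2 ?posrE ?powR_gt0 ?pow2_gt0//.
  by apply: ge0_ler_powR; rewrite ?nnegrE ?pow2_ge0 ?oppr_ge0// ltW.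
apply: (le_trans t1); rewrite lerDl; exact: sumr_ge0.
Qed.

Lemma scaling_funE q : scaling_fun psi F q = limn_einf (fun n : nat =>
    if leader_sum q n == 0 then +oo%E else ((- (n%:R)^-1) * (ln (leader_sum q n) / ln 2))%:E).
Proof. by []. Qed.

Lemma scaling_fun_le q t :
  (forall M, exists2 m, (M <= m)%N & 2 `^ (- (t * (gen m)%:R)) <= Z q m) ->
  (scaling_fun psi F q <= t%:E)%E.
Proof.
move=> H; rewrite scaling_funE; apply: limn_einf_le => M.
have [m Mm Zm] := H M.+1.
exists (gen m); first exact: leq_trans (leq_trans (leqnSn M) Mm) (leq_gen gen_ltS m).
have g0 : (0 : R) < (gen m)%:R by rewrite ltr0n (leq_trans _ (leq_gen gen_ltS m))// (leq_trans _ Mm).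
have Sm := le_trans Zm (Z_le_leader_sum q m).
have S0 := lt_le_trans (pow2_gt0 _) Sm.
rewrite gt_eqF// lee_fin mulNr lerNl mulrC ler_pdivlMr//.
have l2 : 0 < ln 2 :> R by rewrite ln_gt0// ltr1n.
rewrite ler_pdivlMr// mulNr -ler_expR lnK ?posrE//.
by move: Sm; rewrite /powR pnatr_eq0.
Qed.

Lemma scaling_fun_ge q t e : 0 < e ->
  (exists M, forall m, (M <= m)%N -> Z q m <= 2 `^ (- ((t + e) * (gen m)%:R))) ->
  (t%:E <= scaling_fun psi F q)%E.
Proof.
move=> e0 [M HM]; rewrite scaling_funE.
pose s := - (t + e).
have c0 : 0 < `|s| + 1 by rewrite ltr_wpDl.
have [C [C0 HC]] := @blk_small R (e / 2 / (`|s| + 1)) (divr_gt0 (divr_gt0 e0 (ltr0n R 2)) c0).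
(* One half of [e n] absorbs the block, by [HC]; the other half, from [n0] on, absorbs the
   constants. The [3] comes from [3 + 3 * 2 ^ blk m <= 2 ^ (blk m + 3)]. *)
pose n0 := (Num.truncn (((`|s| + 1) * C + 3) / (e / 2))).+1.
apply: (@limn_einf_ge R _ _ (maxn n0 (gen M).+1)) => n; rewrite geq_max => /andP[nn0 nM].
case: ifPn => [_|Sn0]; first by rewrite leey.
have n1 : (0 < n)%N by exact: leq_trans nM.
have [m /andP[mn nm]] := gen_bracket n1.
have Mm : (M <= m)%N.
  by rewrite -ltnS; apply: contraTT nM; rewrite -leqNgt -leqNgt => /gen_mono h; exact: leq_trans nm h.
have nR : 0 < n%:R :> R by rewrite ltr0n.
have S0 : 0 < leader_sum q n.
  by rewrite lt_neqAle eq_sym Sn0; apply: sumr_ge0 => k _; exact: powR_ge0.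
suff H : leader_sum q n <= 2 `^ (- (t * n%:R)).
  rewrite lee_fin mulNr lerNr mulrC ler_pdivrMr//.
  have l2 : 0 < ln 2 :> R by rewrite ln_gt0// ltr1n.
  rewrite ler_pdivrMr// mulNr -ler_expR lnK ?posrE//.
  by move: H; rewrite /powR pnatr_eq0.
have bm := HC m.
have e1 (p : nat) : `|p%:R - n%:R| <= (blk m)%:R :> R -> s * p%:R <= s * n%:R + `|s| * (blk m)%:R.
  move=> h; have : `|s * (p%:R - n%:R)| <= `|s| * (blk m)%:R by rewrite normrM ler_wpM2l.
  by have := ler_norm (s * (p%:R - n%:R)); rewrite mulrBr; lra.
have gS : gen m.+1 = (gen m + blk m)%N by [].
have Z1 : Z q m.+1 <= 2 `^ (s * n%:R + `|s| * (blk m)%:R).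
  apply: (le_trans (HM m.+1 (leqW Mm))); rewrite ler_pow2 -mulNr; apply: e1.
  by rewrite ger0_norm ?subr_ge0 ?ler_nat// lerBlDr -natrD ler_nat gS addnC leq_add2l ltnW.
have Z2 : Z q m <= 2 `^ (s * n%:R + `|s| * (blk m)%:R).
  apply: (le_trans (HM m Mm)); rewrite ler_pow2 -mulNr; apply: e1.
  by rewrite distrC ger0_norm ?subr_ge0 ?ler_nat ?(ltnW mn)// lerBlDr -natrD ler_nat addnC -gS.
apply: (le_trans (leader_sum_le q mn nm)).
apply: (@le_trans _ _ (2 `^ (s * n%:R + (`|s| + 1) * (blk m)%:R + 3))).
  rewrite (_ : s * n%:R + (`|s| + 1) * (blk m)%:R + 3 = (s * n%:R + `|s| * (blk m)%:R) + (blk m)%:R + 3%:R); last by ring.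
  rewrite 2!pow2D 2!pow2_nat.
  set X := 2 `^ _ in Z1 Z2 *.
  have X0 : 0 <= X by exact: pow2_ge0.
  have B1 : 1 <= 2 ^+ blk m :> R by rewrite exprn_ege1// ler1n.
  have := ler_wpM2l (le_trans ler01 B1) Z2.
  have := ler_wpM2r X0 B1.
  rewrite !exprS expr0; nra.
rewrite ler_pow2 /s.
have hn : ((`|s| + 1) * C + 3) / (e / 2) <= n%:R.
  by apply: ltW; apply: lt_le_trans (truncnS_gt _) _; rewrite ler_nat.
rewrite ler_pdivrMr ?divr_gt0// in hn.
have gn : (gen m)%:R <= n%:R :> R by rewrite ler_nat ltnW.
have := ler_wpM2l (ltW c0) bm.
rewrite mulrDr mulrA [(`|s| + 1) * (_ / _)]mulrC divfK ?gt_eqF// => h1.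
have := ler_wpM2l (ltW (divr_gt0 e0 (ltr0n R 2))) gn => h2.
move: h1 h2 hn; lra.
Qed.

End CascadeFunction.

(** * Hausdorff dimension *)

Section Hausdorff.
Variable R : realType.
Implicit Types (E A : set R) (s : R).

Lemma diam_fine_ge0 A : 0 <= fine (diam A).
Proof.
rewrite /diam; set S := (X in ereal_sup X).
have [->|/set0P[e Se]] := eqVneq S set0; first by rewrite ereal_sup0.
apply: fine_ge0; have [x [_ [Ax _]]] := Se.
apply: ereal_sup_ubound; exists x, x; split => //; split => //.
by rewrite subrr normr0.
Qed.

Lemma diam_fine_le A (d : R) : 0 <= d -> (diam A <= d%:E)%E -> fine (diam A) <= d.
Proof. by move=> d0; case: (diam A) => [r| |]; rewrite ?lee_fin. Qed.

Lemma diam_le_fine A (d : R) x y : (diam A <= d%:E)%E -> A x -> A y ->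
  `|x - y| <= fine (diam A).
Proof.
move=> Ad Ax Ay; have : ((`|x - y|)%:E <= diam A)%E.
  by apply: ereal_sup_ubound; exists x, y.
by case: (diam A) Ad => [r| |]; rewrite ?lee_fin.
Qed.

Lemma hcontent_ge0 s delta E : (0 <= hcontent s delta E)%E.
Proof.
apply: le_ereal_inf_tmp => _ [U _ <-]; apply: nneseries_ge0 => n _ _.
by rewrite lee_fin powR_ge0.
Qed.

Lemma hcontentS s delta E E' : E `<=` E' -> (hcontent s delta E <= hcontent s delta E')%E.
Proof.
move=> EE'; apply: ereal_inf_le_tmp => _ [U [EU Ud] <-]; exists U => //.
by split => //; exact: subset_trans EE' EU.
Qed.

Lemma hmeasure_eq0 s E : (forall delta, 0 < delta -> hcontent s delta E = 0%E) ->
  hmeasure s E = 0%E.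
Proof.
move=> H; apply/eqP; rewrite eq_le; apply/andP; split.
  by apply: ge_ereal_sup => _ [d /= d0 <-]; rewrite H.
by rewrite -(H 1 ltr01); apply: ereal_sup_ubound; exists 1 => //=; exact: ltr01.
Qed.

Lemma hmeasure_eq0_hcontent s E delta : 0 < delta -> hmeasure s E = 0%E -> hcontent s delta E = 0%E.
Proof.
move=> d0 H; apply/eqP; rewrite eq_le hcontent_ge0 andbT -H.
by apply: ereal_sup_ubound; exists delta.
Qed.

Lemma dimH_set0 : dimH (set0 : set R) = -oo%E.
Proof. by rewrite /dimH; case: ifPn => // /asboolPn; case. Qed.

Lemma dimH_nonempty E : E !=set0 ->
  dimH E = ereal_inf [set s%:E | s in [set s : R | 0 < s /\ hmeasure s E = 0%E]].
Proof.
by move=> [x Ex]; rewrite /dimH; case: ifPn => // /asboolP E0; move: Ex; rewrite E0.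
Qed.

Lemma dimHS E E' : E `<=` E' -> (dimH E <= dimH E')%E.
Proof.
move=> EE'; have [->|/set0P E0] := eqVneq E set0; first by rewrite dimH_set0 leNye.
have E'0 : E' !=set0 by have [x Ex] := E0; exists x; exact: EE'.
rewrite !dimH_nonempty//; apply: ereal_inf_le_tmp => _ [s [s0 H] <-]; exists s => //.
split => //; apply: hmeasure_eq0 => d d0; apply/eqP; rewrite eq_le hcontent_ge0 andbT.
by rewrite -(hmeasure_eq0_hcontent d0 H) hcontentS.
Qed.

Lemma dimH_le E (v : R) : (forall s, v < s -> 0 < s -> hmeasure s E = 0%E) ->
  0 <= v -> (dimH E <= v%:E)%E.
Proof.
move=> H v0; have [->|/set0P E0] := eqVneq E set0; first by rewrite dimH_set0 leNye.
rewrite dimH_nonempty//; apply/lee_addgt0Pr => e e0; apply: ereal_inf_lbound.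
have ve : v < v + e by rewrite ltrDl.
exists (v + e) => //; split; first exact: le_lt_trans v0 ve.
by apply: H => //; exact: le_lt_trans v0 ve.
Qed.

Lemma dimH_ge0 E : E !=set0 -> (0 <= dimH E)%E.
Proof.
move=> E0; rewrite dimH_nonempty//; apply: le_ereal_inf_tmp => _ [s [s0 _] <-].
by rewrite lee_fin ltW.
Qed.

Lemma sum_heap (f : nat -> R) (K : nat) : (forall n, 0 <= f n) ->
  \sum_(0 <= n < 2 ^ K) f n = f 0%N + \sum_(0 <= j < K) \sum_(0 <= k < 2 ^ j) f (2 ^ j + k)%N.
Proof.
move=> f0; elim: K => [|K IH]; first by rewrite expn0 big_nat1 big_nil addr0.
rewrite (@big_cat_nat _ _ _ (2 ^ K) 0 (2 ^ K.+1))//=; last by rewrite leq_exp2l.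
rewrite IH big_nat_recr//= addrA; congr (_ + _).
rewrite -{1}[(2 ^ K)%N]add0n big_addn expnS mul2n -addnn addnK.
by apply: eq_bigr => k _; rewrite addnC.
Qed.

(* The cover is indexed by the heap order: the dyadic interval [k / 2^j, (k+1) / 2^j]
   has number [2^j + k]. *)
Lemma hmeasure_dyadic_eq0 E s (eta : R) (bad : nat -> pred nat) : 0 < s -> 0 < eta ->
  (forall J x, E x -> exists j k, [/\ (J <= j)%N, (k < 2 ^ j)%N, bad j k &
     k%:R <= 2 ^+ j * x <= k%:R + 1]) ->
  (exists J0, forall j, (J0 <= j)%N ->
     \sum_(0 <= k < 2 ^ j | bad j k) 2 `^ (- (s * j%:R)) <= 2 `^ (- (eta * j%:R))) ->
  hmeasure s E = 0%E.
Proof.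
move=> s0 eta0 cov [J0 small].
apply: hmeasure_eq0 => d d0; apply/eqP; rewrite eq_le hcontent_ge0 andbT.
apply/lee_addgt0Pr => e e0; rewrite add0e.
have [r0 r1] := ratio_bounds eta0.
set r := 2 `^ (- eta) in r0 r1.
have nr1 : `|r| < 1 by rewrite gtr0_norm.
have [J1 HJ1] : exists J1, forall J, (J1 <= J)%N -> r ^+ J / (1 - r) <= e.
  have : (fun J => (1 - r)^-1 * r ^+ J) @ \oo --> 0 by exact: cvg_geometric.
  move=> /cvgrPdist_le /(_ e e0)[J1 _ HJ]; exists J1 => J JJ.
  have := HJ J JJ; rewrite sub0r normrN => h; apply: le_trans h; rewrite mulrC; exact: ler_norm.
have [J2 HJ2] : exists J2, forall J, (J2 <= J)%N -> 2^-1 ^+ J <= d.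
  have h2 : `|2^-1 : R| < 1 by rewrite gtr0_norm ?invf_lt1 ?ltr1n// invr_gt0.
  have : (fun J => 1 * (2^-1 : R) ^+ J) @ \oo --> 0 by exact: cvg_geometric.
  move=> /cvgrPdist_le /(_ d d0)[J2 _ HJ]; exists J2 => J JJ.
  have := HJ J JJ; rewrite sub0r normrN mul1r => h; apply: le_trans h; exact: ler_norm.
pose J := maxn J0 (maxn J1 J2).
have JJ0 : (J0 <= J)%N by rewrite /J; lia.
have JJ1 : (J1 <= J)%N by rewrite /J; lia.
have JJ2 : (J2 <= J)%N by rewrite /J; lia.
pose lev n := trunc_log 2 n; pose pos n := (n - 2 ^ lev n)%N.
pose good n := [&& (0 < n)%N, (J <= lev n)%N & bad (lev n) (pos n)].
(* Indices that are not selected carry the empty set: its diameter [-oo] has [fine] value 0 and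
   costs nothing, as [s > 0]. *)
pose U n : set R := if good n then [set x | (pos n)%:R <= 2 ^+ lev n * x <= (pos n)%:R + 1] else set0.
have Udiam n : good n -> (diam (U n) <= ((2 ^+ lev n)^-1)%:E)%E.
  move=> gn; rewrite /diam; apply: ge_ereal_sup => _ [x [y [Ux [Uy ->]]]].
  move: Ux Uy; rewrite /U gn /= lee_fin => /andP[x1 x2] /andP[y1 y2].
  have p2 : 0 < 2 ^+ lev n :> R by rewrite exprn_gt0.
  rewrite -div1r ler_pdivlMr// -[X in _ * X]gtr0_norm// -normrM mulrC mulrBr.
  by rewrite ler_norml; apply/andP; split; lra.
have U0 n : ~~ good n -> diam (U n) = -oo%E.
  move=> gn; rewrite /diam /U (negbTE gn).
  rewrite (_ : [set e | _] = set0) ?ereal_sup0//.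
  by apply/seteqP; split=> [z [x [y [[]]]]|].
have lev_le n : good n -> (2 ^+ lev n)^-1 <= d.
  by move=> /and3P[_ Jl _]; rewrite -exprVn; apply: HJ2; exact: leq_trans Jl.
have Ud n : (diam (U n) <= d%:E)%E.
  have [gn|/U0 ->] := boolP (good n); last by rewrite leNye.
  by apply: le_trans (Udiam n gn) _; rewrite lee_fin lev_le.
pose t n : R := if good n then 2 `^ (- (s * (lev n)%:R)) else 0.
have t0 n : 0 <= t n by rewrite /t; case: ifP => // _; exact: pow2_ge0.
have Ut n : powR (fine (diam (U n))) s <= t n.
  rewrite /t; case: ifPn => [gn|/U0 ->]; last by rewrite /= powR0// gt_eqF.
  rewrite mulrC -mulNr powRrM powRN pow2_nat.
  apply: ge0_ler_powR; rewrite ?nnegrE ?diam_fine_ge0 ?(ltW s0) ?invr_ge0 ?exprn_ge0//.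
  by apply: diam_fine_le (Udiam n gn); rewrite invr_ge0 exprn_ge0.
have heap j k : (k < 2 ^ j)%N -> lev (2 ^ j + k)%N = j /\ pos (2 ^ j + k)%N = k.
  move=> kj; have l : lev (2 ^ j + k)%N = j.
    by apply: trunc_log_eq => //; rewrite leq_addr /= expnS mul2n -addnn ltn_add2l.
  by split => //; rewrite /pos l addKn.
have EU : E `<=` \bigcup_n U n.
  move=> x Ex; have [j [k [Jj kj bk xk]]] := cov J x Ex.
  have [hl hp] := heap j k kj.
  exists (2 ^ j + k)%N => //; rewrite /U /good hl hp bk Jj addn_gt0 expn_gt0 /=.
  exact: xk.
have level j : \sum_(0 <= k < 2 ^ j) t (2 ^ j + k)%N <= if (J <= j)%N then r ^+ j else 0.
  rewrite (eq_big_nat _ _ (F2 := fun k => if (J <= j)%N && bad j k then 2 `^ (- (s * j%:R)) else 0)); last first.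
    move=> k /andP[_ kj]; have [hl hp] := heap j k kj.
    by rewrite /t /good hl hp addn_gt0 expn_gt0.
  case: ifP => Jj /=; last by rewrite big1.
  rewrite -big_mkcond /r pow2_exprn mulNr; apply: small; exact: leq_trans Jj.
have tot n : \sum_(0 <= i < n) t i <= e.
  have n2 : (n <= 2 ^ n)%N by rewrite ltnW// ltn_expl.
  apply: (@le_trans _ _ (\sum_(0 <= i < 2 ^ n) t i)).
    by rewrite (@big_cat_nat _ _ _ n 0 (2 ^ n))//= lerDl sumr_ge0.
  rewrite sum_heap// /t {1}/good /= add0r.
  apply: (@le_trans _ _ (\sum_(0 <= j < n) (if (J <= j)%N then r ^+ j else 0))).
    by apply: ler_sum => j _; exact: level.
  apply: (@le_trans _ _ (r ^+ J / (1 - r))); last exact: HJ1.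
  have [nJ|Jn] := leqP n J.
    rewrite big_nat big1; last by move=> j /andP[_ jn]; rewrite leqNgt (leq_trans jn nJ).
    by rewrite divr_ge0 ?exprn_ge0 ?(ltW r0)// subr_ge0 ltW.
  rewrite (@big_cat_nat _ _ _ J 0 n)//=; last exact: ltnW.
  rewrite big_nat big1 ?add0r; last by move=> j /andP[_ jn]; rewrite leqNgt jn.
  rewrite big_nat (eq_bigr (fun j => r ^+ j)); last by move=> j /andP[-> _].
  rewrite -big_nat -(subnKC (ltnW Jn)) geometric_partial_tail geometric_seriesE ?lt_eqF//.
  rewrite ler_wpM2r ?invr_ge0 ?subr_ge0 ?(ltW r1)//.
  by rewrite ler_piMr ?exprn_ge0 ?(ltW r0)// lerBlDr lerDl exprn_ge0// ltW.
apply: (@le_trans _ _ (\sum_(0 <= n <oo) (powR (fine (diam (U n))) s)%:E)%E).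
  by apply: ereal_inf_lbound; exists U.
apply: lime_le; first by apply: is_cvg_nneseries => n _ _; rewrite lee_fin powR_ge0.
apply: nearW => n; rewrite sumEFin lee_fin; apply: le_trans (tot n).
by apply: ler_sum => i _; exact: Ut.
Qed.

(* The inverse of [phi] is [s]-Hoelder, so a cover of [E] of small [s]-content
   would pull back to a cover of the unit interval of small length. *)
Lemma dimH_ge_of_holder E s (C : R) (phi : R -> R) : 0 < s -> 0 < C ->
  (forall y, 0 <= y < 1 -> E (phi y)) ->
  (forall y y', 0 <= y < 1 -> 0 <= y' < 1 -> `|y - y'| <= C * `|phi y - phi y'| `^ s) ->
  (s%:E <= dimH E)%E.
Proof.
move=> s0 C0 phiE phiH.
have E0 : E !=set0 by exists (phi 0); apply: phiE; rewrite lexx ltr01.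
rewrite dimH_nonempty//; apply: le_ereal_inf_tmp => _ [s' [s'0 H] <-].
rewrite lee_fin leNgt; apply/negP => ss'.
(* With diameters at most 1, the power [s] is dominated by the power [s' < s]. *)
have c0 := hmeasure_eq0_hcontent ltr01 H.
(* The intervals [J n] have length [2 C diam ^ s'], so their total length stays below
   [2 C / (4 C) = 1 / 2], too little to cover [[0, 1)]. *)
have e0 : 0 < (4 * C)^-1 by rewrite invr_gt0 mulr_gt0.
have : (hcontent s' 1 E < ((4 * C)^-1)%:E)%E by rewrite c0 lte_fin.
move=> /ereal_inf_lt[_ [U [EU Ud] <-]] small.
pose Y n : set R := [set y | 0 <= y < 1 /\ U n (phi y)].
pose c n : R := if pselect (Y n !=set0) is left H then projT1 (cid H) else 0.
have cY n : Y n !=set0 -> Y n (c n).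
  by move=> Yn; rewrite /c; case: pselect => // ?; case: cid.
pose rho n : R := C * powR (fine (diam (U n))) s'.
have rho0 n : 0 <= rho n by rewrite mulr_ge0 ?powR_ge0 ?(ltW C0).
pose J n : set R := `[c n - rho n, c n + rho n]%classic.
have YJ n : Y n `<=` J n.
  move=> y Yy; have [c01 Uc] := cY n (ex_intro _ y Yy); have [y01 Uy] := Yy.
  have d1 : fine (diam (U n)) <= 1 by apply: diam_fine_le.
  have d0 := diam_fine_ge0 (U n).
  have : `|y - c n| <= rho n.
    apply: (le_trans (phiH _ _ y01 c01)); rewrite /rho ler_wpM2l ?(ltW C0)//.
    apply: (@le_trans _ _ (powR (fine (diam (U n))) s)).
      apply: ge0_ler_powR; rewrite ?nnegrE ?(ltW s0)//.
      exact: diam_le_fine (Ud n) Uy Uc.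
    have [dz|dnz] := eqVneq (fine (diam (U n))) 0.
      by rewrite dz !powR0 ?gt_eqF.
    by apply: ger_powR (ltW ss'); rewrite lt_neqAle eq_sym dnz d0.
  by rewrite /J /= in_itv /= ler_norml => /andP[h1 h2]; apply/andP; split; lra.
have IJ : (`[0, 1[%classic : set R) `<=` \bigcup_n J n.
  move=> y; rewrite /= in_itv /= => y01.
  have [n _ Un] := EU _ (phiE y y01).
  by exists n => //; apply: YJ.
have h : ((@lebesgue_measure R) `[0%R, 1%R[%classic <= \sum_(n <oo) (@lebesgue_measure R) (J n))%E.
  apply: (@measure_sigma_subadditive _ R _ (@lebesgue_measure R) _ J) => //.
  by move=> n; exact: measurable_itv.
rewrite lebesgue_measure_itv /= lte_fin ltr01 oppr0 adde0 in h.
have : (\sum_(n <oo) lebesgue_measure (J n) <= (2 * C)%:E * \sum_(0 <= n <oo) (powR (fine (diam (U n))) s')%:E)%E.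
  rewrite -nneseriesZl; last by move=> n _; rewrite lee_fin powR_ge0.
  apply: lee_nneseries => [n _ _|n _]; first exact: measure_ge0.
  rewrite /J lebesgue_measure_itv /= -EFinM; case: ifPn => _.
    by rewrite -EFinB lee_fin /rho; lra.
  by rewrite lee_fin mulr_ge0 ?powR_ge0// mulr_ge0// ltW.
move=> /(le_trans h) h2.
have : ((2 * C)%:E * \sum_(0 <= n <oo) (powR (fine (diam (U n))) s')%:E < (2 * C)%:E * ((4 * C)^-1)%:E)%E.
  by rewrite lte_pmul2l// lte_fin mulr_gt0.
move=> /(le_lt_trans h2); rewrite -EFinM lte_fin invfM mulrACA mulfV ?gt_eqF// mulr1.
lra.
Qed.

End Hausdorff.

(** * Slopes and codes from the Legendre transform *)

(** [16 ^ 4 = 2 ^ 16], whence the threshold. The pairs (slope, number of digits) needed in block [i]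
    stay below [i.+1 ^ 4] and must fit into [2 ^ i.+1] codes. *)
Lemma quartic_lt_exp2 n : (17 <= n)%N -> (n ^ 4 < 2 ^ n)%N.
Proof.
elim: n => // n IH; rewrite leq_eqVlt => /predU1P[<-//|].
rewrite ltnS => n17; have := IH n17.
have : (n.+1 ^ 4 <= 2 * n ^ 4)%N by rewrite !expnS !expn0; nia.
by rewrite [(2 ^ n.+1)%N]expnS; lia.
Qed.

Lemma truncn_leR (R : realType) (x : R) : 0 <= x -> (Num.truncn x)%:R <= x.
Proof. by rewrite truncn_le. Qed.

Lemma sqr_le_blk i : (i.+1 ^ 2 <= blk i)%N. Proof. rewrite /blk; lia. Qed.

Section BlockLength.
Variable R : realType.

Lemma eventually_blk (e C D : R) : 0 < e -> exists i0, forall i, (i0 <= i)%N ->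
  C * i.+1%:R + D <= e * (blk i)%:R.
Proof.
move=> e0; exists (Num.truncn ((`|C| + `|D|) / e)).+1 => i ii.
have h : (`|C| + `|D|) / e <= i.+1%:R.
  by apply: ltW; apply: lt_le_trans (truncnS_gt _) _; rewrite ler_nat; exact: leqW.
rewrite ler_pdivrMr// in h.
have n1 : 1 <= i.+1%:R :> R by rewrite ler1n.
have BS : i.+1%:R ^+ 2 <= (blk i)%:R :> R by rewrite -natrX ler_nat sqr_le_blk.
have := ler_wpM2l (ltW e0) BS.
have := ler_wpM2r (le_trans ler01 n1) h.
have := ler_wpM2l (normr_ge0 D) n1; have := ler_norm D.
have := ler_wpM2r (le_trans ler01 n1) (ler_norm C).
rewrite expr2; nra.
Qed.

Lemma floor_sqr_blk (g e : R) (k : nat -> nat) : 0 <= g <= 1 -> e < g ->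
  (forall i, (i.+1 ^ 2)%:R * g < (k i)%:R + 1) ->
  exists i0, forall i, (i0 <= i)%N -> e * (blk i)%:R <= (k i)%:R.
Proof.
move=> /andP[g0 g1] eg Hk.
have [|i0 H] := @eventually_blk (g - e) g (2 * g + 1); first by rewrite subr_gt0.
exists i0 => i ii; have := H i ii; have := Hk i.
rewrite /blk !natrD; nra.
Qed.

End BlockLength.

Section Legendre.
Variables (R : realType) (T : R -> \bar R) (alpha c : R).
Hypothesis noplus : forall q, T q != +oo%E.
Hypothesis concT : forall (p q t : R), (0 < t)%R -> (t < 1)%R ->
     (t%:E * T p + (1 - t)%R%:E * T q <= T (t * p + (1 - t) * q)%R)%E.
Hypothesis alpha0 : 0 < alpha.
Hypothesis c1 : c <= 1.
Hypothesis growth : forall q, 0 <= q -> ((alpha * q - c)%R%:E <= T q)%E.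
Hypothesis domT : edom T = setT \/ edom T = [set q | 0 <= q].
Hypothesis legendre_ge0 : forall h : \bar R, h != -oo%E -> (-oo < legendre T h)%E ->
     (0 <= legendre T h)%E.

Local Notation t q := (fine (T q)).

Lemma edom_fine q : edom T q -> T q = (t q)%:E.
Proof. by rewrite /edom /=; have := noplus q; case: (T q). Qed.

Lemma edom_ge0 q : 0 <= q -> edom T q.
Proof. by move=> q0; apply: lt_le_trans (growth q0); rewrite ltNyr. Qed.

Lemma fine_growth q : 0 <= q -> alpha * q - c <= t q.
Proof. by move=> q0; have := growth q0; rewrite (edom_fine (edom_ge0 q0)) lee_fin. Qed.

Lemma fine_concave (r q p : R) : edom T r -> edom T p -> r < q -> q < p ->
  (p - q) * t r + (q - r) * t p <= (p - r) * t q.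
Proof.
move=> dr dp rq qp.
have pr : 0 < p - r by rewrite subr_gt0; exact: lt_trans qp.
pose l := (p - q) / (p - r).
have l0 : 0 < l by rewrite divr_gt0// subr_gt0.
have l1 : l < 1 by rewrite ltr_pdivrMr// mul1r; lra.
have E : l * r + (1 - l) * p = q by rewrite /l; field; rewrite gt_eqF.
have := concT r p l0 l1; rewrite E (edom_fine dr) (edom_fine dp) -!EFinM -EFinD => H.
have dq : edom T q by apply: lt_le_trans H; rewrite ltNyr.
move: H; rewrite (edom_fine dq) lee_fin => H.
have := ler_wpM2l (ltW pr) H.
have -> : (p - r) * (l * t r + (1 - l) * t p) = (p - q) * t r + (q - r) * t p.
  by rewrite /l; field; rewrite gt_eqF.
by [].
Qed.

Lemma legendre_le (h : R) q : edom T q -> (legendre T h%:E <= (h * q - t q)%:E)%E.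
Proof. by move=> dq; apply: ereal_inf_lbound; exists q => //; rewrite (edom_fine dq) EFinB. Qed.

Lemma legendre_ge (h v : R) : (forall q, edom T q -> v <= h * q - t q) -> (v%:E <= legendre T h%:E)%E.
Proof.
move=> H; apply: le_ereal_inf_tmp => _ [q dq <-].
by rewrite (edom_fine dq) -EFinB lee_fin H.
Qed.

(** The slope is the right derivative, the supremum of the chord slopes to the right of [q]; a chord
    from [r0] on the left keeps it finite. *)
Lemma supporting_slope q r0 : edom T r0 -> r0 < q ->
  exists h : R, legendre T h%:E = (h * q - t q)%:E.
Proof.
move=> d0 r0q.
have dge p : q <= p -> edom T p.
  move=> qp; case: domT => dE; first by rewrite dE.
  by move: d0; rewrite dE /= => ?; lra.
have dgt p : q < p -> edom T p by move=> /ltW; exact: dge.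
have dq : edom T q by exact: dge.
pose S := [set s | exists2 p, q < p & s = (t p - t q) / (p - q)].
have Sr r : edom T r -> r < q -> forall s, S s -> s <= (t q - t r) / (q - r).
  move=> dr rq _ [p qp ->].
  rewrite ler_pdivrMr ?subr_gt0// mulrAC ler_pdivlMr ?subr_gt0//.
  by have := fine_concave dr (dgt p qp) rq qp; nra.
have S0 : S !=set0 by exists ((t (q + 1) - t q) / (q + 1 - q)), (q + 1) => //; rewrite ltrDl.
have hS : has_sup S by split => //; exists ((t q - t r0) / (q - r0)) => s; exact: Sr.
exists (sup S); apply/eqP; rewrite eq_le legendre_le//= legendre_ge// => p dp.
have [pq|qp|->] := ltgtP p q; last by [].
  have : sup S <= (t q - t p) / (q - p) by apply: ge_sup => // s; exact: Sr.
  by rewrite ler_pdivlMr ?subr_gt0//; lra.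
have : (t p - t q) / (p - q) <= sup S by apply: ub_le_sup; [exact: hS.2|exists p].
by rewrite ler_pdivrMr ?subr_gt0//; lra.
Qed.

Lemma legendre_pinfty : edom T = [set q | 0 <= q] -> legendre T +oo%E = (- t 0)%:E.
Proof.
move=> dE; rewrite /legendre (_ : [set _ | q in _] = [set (- t 0)%:E]) ?ereal_inf1//.
apply/seteqP; split=> [_ [q [dq q0] <-]|_ ->].
  move: dq; rewrite dE /= => dq; have -> : q = 0 by apply/eqP; rewrite eq_le q0.
  by rewrite mule0 sub0e (edom_fine (edom_ge0 (lexx 0))).
exists 0; first by split => //; exact: edom_ge0.
by rewrite mule0 sub0e (edom_fine (edom_ge0 (lexx 0))).
Qed.

Lemma legendre_pinfty_full : edom T = setT -> legendre T +oo%E = -oo%E.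
Proof.
move=> dE; apply/eqP; rewrite -leeNy_eq; apply: ereal_inf_lbound; exists (- 1).
  by split; [rewrite dE|rewrite oppr_le0].
have d1 : edom T (- 1) by rewrite dE.
by rewrite (edom_fine d1) mulyr ltr0_sg ?oppr_lt0// EFinN mulN1e.
Qed.

(** The lower bound is the growth condition at 0 with [c <= 1]; the upper one is the sign of [T^*]
    at a supporting slope of 0, or at [+oo] if the domain is the half-line. *)
Lemma fine0_bounds : -1 <= t 0 <= 0.
Proof.
apply/andP; split.
  by have := fine_growth (lexx 0); rewrite mulr0 sub0r; have := c1; lra.
case: domT => dE.
  have [||h Hh] := @supporting_slope 0 (- 1); rewrite ?oppr_lt0//; first by rewrite dE.
  have := @legendre_ge0 h%:E isT; rewrite Hh => /(_ (ltNyr _)).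
  by rewrite lee_fin mulr0; lra.
have := @legendre_ge0 +oo%E isT; rewrite legendre_pinfty// => /(_ (ltNyr _)).
by rewrite lee_fin oppr_ge0.
Qed.

Lemma legendre_bounds (h : \bar R) g : h != -oo%E -> legendre T h = g%:E -> 0 <= g <= - t 0.
Proof.
move=> hN E; apply/andP; split.
  by have := legendre_ge0 hN; rewrite E => /(_ (ltNyr _)).
case: h hN E => [h _ E|_ E|//].
  by have := legendre_le h (edom_ge0 (lexx 0)); rewrite E lee_fin mulr0 sub0r.
case: domT => dE; first by move: E; rewrite legendre_pinfty_full.
by move: E; rewrite legendre_pinfty// => -[->].
Qed.

Lemma legendre_slope_ge (h g : R) : legendre T h%:E = g%:E -> alpha <= h.
Proof.
move=> E; rewrite leNgt; apply/negP => ha.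
have ah : 0 < alpha - h by rewrite subr_gt0.
(* Chosen so that [h q - T(q) <= c - (alpha - h) q < g]. *)
pose q := (`|c - g| + 1) / (alpha - h).
have q0 : 0 <= q by apply: divr_ge0; [exact: addr_ge0|exact: ltW].
have := legendre_le h (edom_ge0 q0); rewrite E lee_fin.
have := fine_growth q0; have : (alpha - h) * q = `|c - g| + 1 by rewrite /q mulrC divfK ?gt_eqF.
by have := ler_norm (c - g); lra.
Qed.

Lemma legendre_ninfty_or_fin (h : \bar R) : h != -oo%E ->
  legendre T h = -oo%E \/ exists g, legendre T h = g%:E.
Proof.
case: h => [h _|_|//].
  have := legendre_le h (edom_ge0 (lexx 0)).
  by case: (legendre T h%:E) => [g| |]//; [right; exists g|left].
by case: domT => dE; [left; rewrite legendre_pinfty_full|right; exists (- t 0); rewrite legendre_pinfty].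
Qed.

Lemma slope_exists : exists h g : R, legendre T h%:E = g%:E.
Proof.
have [|h Hh] := @supporting_slope 1 0 (edom_ge0 (lexx 0)); first exact: ltr01.
by exists h, (h * 1 - t 1).
Qed.

(** The code is written in base [(i.+1 ^ 2).+1]: its quotient is the integer part of [i.+1 * h], its
    remainder the number of free digits, which [T^*(h)] must allow. *)
Definition slope_cell (i u : nat) : set R := [set h | exists g, [/\ legendre T h%:E = g%:E,
  (u %/ (i.+1 ^ 2).+1)%:R <= i.+1%:R * h < (u %/ (i.+1 ^ 2).+1)%:R + 1 &
  (u %% (i.+1 ^ 2).+1)%:R <= (i.+1 ^ 2)%:R * g]].

Definition last_code (i u : nat) : bool := `[< edom T = [set q | 0 <= q] >] && (u == (2 ^ i.+1).-1).

(** Codes with an empty cell still label nodes. A slope with finite [T^*], together with zero free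
    digits, makes them obey the same inequality as the others. *)
Definition default_slope : R := xget 0 [set h | exists g, legendre T h%:E = g%:E].

Definition cell_slope (i u : nat) : R := xget default_slope (slope_cell i u).

(* A code [u] stands for a pair (slope, number of free digits) on a grid of mesh [1 / (i+1)];
   the last code is reserved for the slope [+oo]. *)
Definition digits (i u : nat) : nat :=
  if last_code i u then Num.truncn ((i.+1 ^ 2)%:R * - t 0)
  else if `[< slope_cell i u !=set0 >] then (u %% (i.+1 ^ 2).+1)%N else 0%N.

(** [i.+1] makes the reserved slope tend to [+oo]; adding [alpha] keeps the bound [weight_ge]. *)
Definition weight (i u : nat) : R :=
  (blk i)%:R * (if last_code i u then i.+1%:R + alpha else cell_slope i u).

Lemma default_slopeP : exists g, legendre T default_slope%:E = g%:E.
Proof.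
have [h [g Hh]] := slope_exists.
by rewrite /default_slope; apply: (@xgetPex _ 0 [set h | exists g, legendre T h%:E = g%:E]); exists h, g.
Qed.

Lemma cell_slopeP i u : exists g, legendre T (cell_slope i u)%:E = g%:E /\
  ((if `[< slope_cell i u !=set0 >] then (u %% (i.+1 ^ 2).+1)%N else 0%N)%:R <= (i.+1 ^ 2)%:R * g :> R).
Proof.
rewrite /cell_slope; case: ifPn => [/asboolP ne|/asboolPn ne].
  have [h Ph] := ne; have [g [E _ ag]] := @xgetPex _ default_slope _ (ex_intro _ h Ph).
  by exists g.
have -> : slope_cell i u = set0 by apply/eqP; rewrite -[_ == _]negbK; apply/negP => /set0P.
have [g E] := default_slopeP; rewrite xgetPN; last by move=> ? [].
exists g; split => //.
by rewrite mulr_ge0//; have /andP[] := legendre_bounds (isT : _%:E != -oo%E) E.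
Qed.

Lemma digits_le i u : (digits i u <= i.+1 ^ 2)%N.
Proof.
rewrite /digits; case: ifP => _; last by case: ifP => // _; rewrite -ltnS ltn_pmod.
have /andP[h1 h2] := fine0_bounds.
rewrite -(ler_nat R); apply: le_trans (truncn_leR _) _.
  by rewrite mulr_ge0// oppr_ge0.
by rewrite ler_piMr//; lra.
Qed.

Lemma weight_ge i u : alpha * (blk i)%:R <= weight i u.
Proof.
rewrite /weight mulrC ler_wpM2l//; case: ifP => _; first by rewrite lerDr.
by have [g [E _]] := cell_slopeP i u; exact: legendre_slope_ge E.
Qed.

(** For an ordinary code this is [T^*(h) <= h q - T(q)] at the slope of the cell. For the reserved
    code and [q > 0] it holds once the slope is large. *)
Lemma digits_weight_le q : edom T q -> exists i0, forall i u, (i0 <= i)%N ->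
  (digits i u)%:R - q * weight i u <= - t q * (blk i)%:R.
Proof.
move=> dq; have /andP[t1 t0] := fine0_bounds.
have B0 i : 0 <= (blk i)%:R :> R by [].
have BS i : (i.+1 ^ 2)%:R <= (blk i)%:R :> R by rewrite ler_nat sqr_le_blk.
have S0 i : 0 <= (i.+1 ^ 2)%:R :> R by [].
(* From [n0] on, [q * i.+1 >= 1 + T(q)], and the free digits number at most [blk i]. *)
pose n0 := if q == 0 then 0%N else (Num.truncn ((1 + t q) / q)).+1.
exists n0 => i u ni; rewrite /digits /weight; case: ifPn => [/andP[/asboolP dE _]|_].
  have q0 : 0 <= q by move: dq; rewrite dE.
  set k := Num.truncn _; have kle : k%:R <= (i.+1 ^ 2)%:R * - t 0 by apply: truncn_leR; rewrite mulr_ge0// oppr_ge0.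
  have kB : k%:R <= (blk i)%:R * - t 0.
    by apply: (le_trans kle); apply: ler_wpM2r => //; rewrite oppr_ge0.
  have [qz|qnz] := eqVneq q 0; first by rewrite qz mul0r; lra.
  have qp : 0 < q by rewrite lt_neqAle eq_sym qnz.
  have : (1 + t q) / q <= i.+1%:R.
    have : (1 + t q) / q < n0%:R by rewrite /n0 (negbTE qnz); exact: truncnS_gt.
    move=> /ltW /le_trans; apply; rewrite ler_nat; exact: leqW.
  rewrite ler_pdivrMr// => hq.
  have k1 : k%:R <= (blk i)%:R :> R by apply: (le_trans kB); rewrite ler_piMr//; lra.
  have := ler_wpM2l (B0 i) hq.
  have : 0 <= (blk i)%:R * (q * alpha) by rewrite !mulr_ge0// ltW.
  nra.
have [g [E ag]] := cell_slopeP i u.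
have gle := legendre_le (cell_slope i u) dq; rewrite E lee_fin in gle.
have /andP[g0 _] := legendre_bounds (isT : _%:E != -oo%E) E.
have := ler_wpM2r g0 (BS i); have := ler_wpM2l (B0 i) gle.
move: ag; set A := (if _ then _ else _)%:R; lra.
Qed.

(** Codes that realize asymptotically both the slope [h] and the density [g] of free digits. *)
Lemma legendre_codes (h : \bar R) (g : R) : h != -oo%E -> legendre T h = g%:E ->
  exists u : nat -> nat, [/\ (forall i, (u i < 2 ^ i.+1)%N),
    (forall s : R, (s%:E < h)%E -> exists i0, forall i, (i0 <= i)%N -> s * (blk i)%:R <= weight i (u i)),
    (forall s : R, (h < s%:E)%E -> exists i0, forall i, (i0 <= i)%N -> weight i (u i) <= s * (blk i)%:R) &
    (forall s : R, s < g -> exists i0, forall i, (i0 <= i)%N -> s * (blk i)%:R <= (digits i (u i))%:R)].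
Proof.
move=> hN E; have /andP[t1 t0] := fine0_bounds.
have /andP[g0 gt] := legendre_bounds hN E.
have g1 : g <= 1 by lra.
case: h hN E => [h _ E|_ E|//]; last first.
  case: domT => dE; first by move: E; rewrite legendre_pinfty_full.
  move: E; rewrite legendre_pinfty// => -[gE].
  exists (fun i => (2 ^ i.+1).-1).
  have lc i : last_code i (2 ^ i.+1).-1 by rewrite /last_code eqxx andbT; apply/asboolP.
  split.
  - by move=> i; rewrite ltn_predL expn_gt0.
  - move=> s _; exists (Num.truncn `|s|).+1 => i ii.
    rewrite /weight lc mulrC ler_wpM2l//.
    apply: (@le_trans _ _ i.+1%:R); last by rewrite lerDl ltW.
    apply: (le_trans (ler_norm s)); apply: ltW; apply: lt_le_trans (truncnS_gt _) _.
    by rewrite ler_nat; exact: leqW.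
  - by move=> s; rewrite ltNge leey.
  - move=> s sg; apply: (@floor_sqr_blk R g s) => //; first by rewrite g0.
    move=> i; rewrite /digits lc gE natr1; exact: truncnS_gt.
pose r i := Num.truncn (i.+1%:R * h); pose k i := Num.truncn ((i.+1 ^ 2)%:R * g).
have ah := legendre_slope_ge E.
have h0 : 0 < h by exact: lt_le_trans ah.
have kle i : (k i <= i.+1 ^ 2)%N.
  rewrite -(ler_nat R); apply: le_trans (truncn_leR _) _; first by rewrite mulr_ge0.
  by rewrite ler_piMr.
pose v i := (r i * (i.+1 ^ 2).+1 + k i)%N.
(* For finitely many blocks the pair does not fit and code 0 is used; the strict bound avoids the
   reserved code. *)
pose u i := if (v i < (2 ^ i.+1).-1)%N then v i else 0%N.
have [i1 Hi1] : exists i1, forall i, (i1 <= i)%N -> u i = v i.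
  (* With [n = i.+1] the integer part of [h] is at most [n - 7], so [r i <= n (n - 6)]; the margin 6
     absorbs the lower order terms of [v i < n ^ 4]. *)
  exists (maxn 17 (Num.truncn (h + 6)).+1) => i; rewrite geq_max => /andP[i17 ih].
  rewrite /u; suff -> : (v i < (2 ^ i.+1).-1)%N by [].
  have := quartic_lt_exp2 (leqW i17).
  have rh : (r i <= i.+1 * (Num.truncn h).+1)%N.
    rewrite -(ler_nat R) natrM; apply: le_trans (truncn_leR _) _; first by rewrite mulr_ge0// ltW.
    by rewrite ler_wpM2l// ltW// truncnS_gt.
  have t6 : Num.truncn (h + 6) = (Num.truncn h + 6)%N.
    apply/eqP; rewrite truncn_eq ?addr_ge0 ?(ltW h0)//.
    have /andP[q1 q2] := truncn_itv (ltW h0).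
    by rewrite natrD -addSn natrD; apply/andP; split; lra.
  have hh : ((Num.truncn h).+1 + 6 <= i.+1)%N.
    by rewrite addSn -t6; exact: leq_trans ih (leqnSn i).
  have := kle i; move: rh hh; rewrite /v !expnS expn0 muln1.
  by move: (r i) (k i) (Num.truncn h) => ri ki th; clear; nia.
have uD i : (i1 <= i)%N -> [/\ (u i %/ (i.+1 ^ 2).+1 = r i)%N, (u i %% (i.+1 ^ 2).+1 = k i)%N &
    last_code i (u i) = false].
  move=> ii; have uv := Hi1 i ii; have kS : (k i < (i.+1 ^ 2).+1)%N by rewrite ltnS.
  split; rewrite ?uv /v ?divnMDl ?modnMDl ?(divn_small kS) ?(modn_small kS) ?addn0//.
  apply/negbTE; rewrite negb_and; apply/orP; right; rewrite -/(v i).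
  move: uv; rewrite /u; case: ifPn => [lt _|_ <-]; first by rewrite ltn_eqF.
  by rewrite eq_sym -lt0n; have := ltn_expl i.+1 (ltnSn 1); clear; lia.
have cell i : (i1 <= i)%N -> slope_cell i (u i) h.
  move=> ii; have [e1 e2 _] := uD i ii; exists g; rewrite e1 e2; split => //.
    by have := truncn_itv (mulr_ge0 (ler0n R i.+1) (ltW h0)); rewrite natr1.
  by apply: truncn_leR; rewrite mulr_ge0.
(* The slope chosen in the cell need not be [h], but both lie in an interval of length
   [1 / i.+1]. *)
have near i : (i1 <= i)%N -> `|cell_slope i (u i) - h| * i.+1%:R <= 1.
  move=> ii; have [_ [_ /andP[x1 x2] _]] := @xgetPex _ default_slope _ (ex_intro _ h (cell i ii)).
  have [_ [_ /andP[y1 y2] _]] := cell i ii.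
  rewrite -/(cell_slope i (u i)) in x1 x2.
  rewrite -[X in _ * X <= _](gtr0_norm (ltr0Sn R i)) -normrM.
  by rewrite mulrBl ler_norml; apply/andP; split; lra.
have wE i : (i1 <= i)%N -> weight i (u i) = (blk i)%:R * cell_slope i (u i).
  by move=> ii; have [_ _ e3] := uD i ii; rewrite /weight e3.
have far (d : R) : 0 < d -> exists i0, forall i, (i0 <= i)%N -> (i1 <= i)%N /\
    `|cell_slope i (u i) - h| <= d.
  move=> d0; exists (maxn i1 (Num.truncn d^-1).+1) => i; rewrite geq_max => /andP[ii di].
  split => //; have n0 : 0 < i.+1%:R :> R by [].
  rewrite -(ler_pM2r n0); apply: (le_trans (near i ii)).
  rewrite mulrC -ler_pdivrMr// div1r; apply: ltW.
  by apply: lt_le_trans (truncnS_gt _) _; rewrite ler_nat; exact: leqW.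
exists u; split.
- move=> i; rewrite /u; case: ifP => [|_]; last by rewrite expn_gt0.
  by move=> /leq_trans; apply; exact: leq_pred.
- move=> s; rewrite lte_fin => sh; have [|i0 Hi0] := far (h - s); first by rewrite subr_gt0.
  exists i0 => i /Hi0[ii]; rewrite ler_norml => /andP[h1 h2].
  by rewrite wE// mulrC ler_wpM2l//; lra.
- move=> s; rewrite lte_fin => sh; have [|i0 Hi0] := far (s - h); first by rewrite subr_gt0.
  exists i0 => i /Hi0[ii]; rewrite ler_norml => /andP[h1 h2].
  by rewrite wE// mulrC ler_wpM2r//; lra.
- move=> s sg; have [||i0 Hi0] := @floor_sqr_blk R g s k _ sg; first by rewrite g0.
    by move=> i; rewrite natr1; exact: truncnS_gt.
  exists (maxn i0 i1) => i; rewrite geq_max => /andP[i0i ii].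
  have [e1 e2 e3] := uD i ii; rewrite /digits e3.
  case: asboolP => [_|[]]; last by exists h; exact: cell.
  by rewrite e2; exact: Hi0.
Qed.

End Legendre.

(** * The multifractal formalism *)

Section Increments.
Variable R : realType.

Lemma increments_ge (x : nat -> R) (s : R) :
  (exists i0, forall i, (i0 <= i)%N -> s * (blk i)%:R <= x i.+1 - x i) ->
  exists C, forall i, s * (gen i)%:R - C <= x i.
Proof.
move=> [i0 H]; pose D i := s * (gen i)%:R - x i.
exists (\sum_(i < i0.+1) `|D i|) => i.
suff : D i <= \sum_(i < i0.+1) `|D i| by rewrite /D; lra.
have [ii|ii] := leqP i i0.
  rewrite (bigD1 (Ordinal (ii : (i < i0.+1)%N)))//=.
  by apply: (le_trans (ler_norm _)); rewrite lerDl sumr_ge0.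
apply: (@le_trans _ _ (D i0)); last first.
  rewrite (bigD1 ord_max)//=.
  by apply: (le_trans (ler_norm _)); rewrite lerDl sumr_ge0.
elim: i ii => // i IH; rewrite ltnS leq_eqVlt => /predU1P[<-|lt].
  by have := H i0 (leqnn _); rewrite /D /= natrD; lra.
apply: le_trans (IH lt).
by have := H i (ltnW lt); rewrite /D /= natrD; lra.
Qed.

Lemma increments_le (x : nat -> R) (s : R) :
  (exists i0, forall i, (i0 <= i)%N -> x i.+1 - x i <= s * (blk i)%:R) ->
  exists C, forall i, x i <= s * (gen i)%:R + C.
Proof.
move=> [i0 H]; have [|C HC] := @increments_ge (fun i => - x i) (- s).
  by exists i0 => i /H; lra.
by exists C => i; have := HC i; lra.
Qed.

Lemma gen_large (e C : R) : 0 < e -> exists M, forall m, (M <= m)%N -> C <= e * (gen m)%:R.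
Proof.
move=> e0; exists (Num.truncn (C / e)).+1 => m Mm.
rewrite mulrC -ler_pdivrMr//; apply: ltW; apply: lt_le_trans (truncnS_gt _) _.
by rewrite ler_nat; exact: leq_trans Mm (leq_gen gen_ltS m).
Qed.

Lemma log2K (z : R) : 0 < z -> 2 `^ (ln z / ln 2) = z.
Proof.
by move=> z0; rewrite /powR pnatr_eq0 /= divfK ?lnK ?posrE// gt_eqF// ln_gt0// ltr1n.
Qed.

Lemma unit_interval_dist (k y y' : R) : k <= y < k + 1 -> k <= y' < k + 1 -> `|y - y'| <= 1.
Proof. by move=> /andP[? ?] /andP[? ?]; rewrite ler_norml; apply/andP; split; lra. Qed.

End Increments.

Section Assembly.
Variables (R : realType) (psi : R -> R) (T : R -> \bar R) (alpha c : R).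
Hypothesis Spsi : schwartz psi.
Hypothesis Opsi : orthonormal_wavelet psi.
Hypothesis noplus : forall q, T q != +oo%E.
Hypothesis concT : forall (p q t : R), (0 < t)%R -> (t < 1)%R ->
     (t%:E * T p + (1 - t)%R%:E * T q <= T (t * p + (1 - t) * q)%R)%E.
Hypothesis alpha0 : 0 < alpha.
Hypothesis c1 : c <= 1.
Hypothesis growth : forall q, 0 <= q -> ((alpha * q - c)%R%:E <= T q)%E.
Hypothesis domT : edom T = setT \/ edom T = [set q | 0 <= q].
Hypothesis legendre_ge0 : forall h : \bar R, h != -oo%E -> (-oo < legendre T h)%E ->
     (0 <= legendre T h)%E.

Local Notation t q := (fine (T q)).
Local Notation a := (digits T).
Local Notation w := (weight T alpha).
Local Notation act := (active a).
Local Notation wt := (node_weight w).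
Local Notation Z := (partition_sum a w).
Local Notation zblk := (block_sum a w).
Local Notation F := (cascade psi a w).
Local Notation inI := (@in_node R).

Let ale i u : (a i u <= i.+1 ^ 2)%N.
Proof. exact: (@digits_le R T alpha c). Qed.

Let wge i u : alpha * (blk i)%:R <= w i u.
Proof. exact: (@weight_ge R T alpha c). Qed.

Let efine := edom_fine noplus.

(** * The scaling function of the cascade *)

Lemma zblk_gt0 q i : 0 < zblk q i.
Proof.
rewrite /block_sum (big_rem 0%N) ?mem_index_iota ?expn_gt0//=; apply: ltr_wpDr.
  by apply: sumr_ge0 => u _; rewrite mulr_ge0 ?pow2_ge0// exprn_ge0.
by apply: mulr_gt0; [exact: exprn_gt0|exact: pow2_gt0].
Qed.

Lemma Z_gt0 q m : 0 < Z q m.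
Proof. by elim: m => [|m IH]; rewrite ?Z0 ?(ZS w ale)// mulr_gt0// zblk_gt0. Qed.

Lemma log2_ZS q m : ln (Z q m.+1) / ln 2 - ln (Z q m) / ln 2 = ln (zblk q m) / ln 2 :> R.
Proof. by rewrite (ZS w ale) lnM ?posrE ?Z_gt0 ?zblk_gt0// mulrDl addrAC subrr add0r. Qed.

Lemma log2_le (z s : R) : 0 < z -> (ln z / ln 2 <= s) = (z <= 2 `^ s).
Proof. by move=> z0; rewrite -{2}(log2K z0) ler_pow2. Qed.

Lemma log2_ge (z s : R) : 0 < z -> (s <= ln z / ln 2) = (2 `^ s <= z).
Proof. by move=> z0; rewrite -{2}(log2K z0) ler_pow2. Qed.

Lemma Z_upper q (e : R) : edom T q -> 0 < e ->
  exists M, forall m, (M <= m)%N -> Z q m <= 2 `^ ((e - t q) * (gen m)%:R).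
Proof.
move=> dq e0; have [i0 H0] := @digits_weight_le R T alpha c noplus concT alpha0 c1 growth domT legendre_ge0 q dq.
have [i1 H1] := @eventually_blk R (e / 2) 1 0 (divr_gt0 e0 (ltr0n R 2)).
have [|C HC] := @increments_le R (fun m => ln (Z q m) / ln 2) (e / 2 - t q).
  exists (maxn i0 i1) => i; rewrite geq_max => /andP[ii0 ii1].
  rewrite log2_ZS log2_le ?zblk_gt0//.
  apply: (@le_trans _ _ (\sum_(0 <= u < 2 ^ i.+1) 2 `^ (- t q * (blk i)%:R))).
    apply: ler_sum => u _; rewrite -pow2_nat -pow2D ler_pow2.
    exact: H0.
  rewrite sumr_const_nat subn0 -[leLHS]mulr_natl natrX -pow2_nat -pow2D ler_pow2.
  by have := H1 i ii1; rewrite mul1r addr0; lra.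
have [M HM] := gen_large C (divr_gt0 e0 (ltr0n R 2)).
exists M => m Mm; rewrite -log2_le ?Z_gt0//; apply: (le_trans (HC m)).
by have := HM m Mm; lra.
Qed.

Lemma scaling_ge q s : edom T q -> s < t q -> (s%:E <= scaling_fun psi F q)%E.
Proof.
move=> dq st; pose e := (t q - s) / 2; have e0 : 0 < e by rewrite divr_gt0// subr_gt0.
apply: (scaling_fun_ge Spsi Opsi alpha0 wge e0).
have [M HM] := Z_upper dq e0; exists M => m Mm.
by apply: (le_trans (HM m Mm)); rewrite ler_pow2 -mulNr /e ler_wpM2r//; lra.
Qed.

(** Keeping one code per block in the product bounds the partition sum from below. *)
Lemma scaling_le_path q (tau s : R) (u : nat -> nat) : (forall i, (u i < 2 ^ i.+1)%N) ->
  (exists i0, forall i, (i0 <= i)%N -> tau * (blk i)%:R <= (a i (u i))%:R - q * w i (u i)) ->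
  s < tau -> (scaling_fun psi F q <= (- s)%:E)%E.
Proof.
move=> ub [i0 H] st.
have [|C HC] := @increments_ge R (fun m => ln (Z q m) / ln 2) tau.
  exists i0 => i ii; rewrite log2_ZS log2_ge ?zblk_gt0//.
  apply: (@le_trans _ _ (2 ^+ a i (u i) * 2 `^ (- (q * w i (u i))))).
    by rewrite -pow2_nat -pow2D ler_pow2 H.
  rewrite /block_sum (big_rem (u i)) ?mem_index_iota ?ub//= lerDl.
  by apply: sumr_ge0 => v _; rewrite mulr_ge0 ?pow2_ge0// exprn_ge0.
apply: (scaling_fun_le Spsi Opsi alpha0 wge) => M.
have ts : 0 < tau - s by rewrite subr_gt0.
have [M' HM'] := gen_large C ts.
exists (maxn M M'); first exact: leq_maxl.
rewrite -log2_ge ?Z_gt0//; apply: le_trans (HC _).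
by have := HM' (maxn M M') (leq_maxr _ _); lra.
Qed.

Let codes := @legendre_codes R T alpha c noplus concT alpha0 c1 growth domT legendre_ge0.

Lemma scaling_le q (e : R) : edom T q -> 0 < e -> (scaling_fun psi F q <= (t q + e)%:E)%E.
Proof.
move=> dq e0.
(* An error [d] on the digits and [|q| d] on the weight add up to [e / 2]. *)
pose d := e / 2 / (1 + `|q|); have q1 : 0 < 1 + `|q| by rewrite ltr_pwDl.
have d0 : 0 < d by rewrite divr_gt0// divr_gt0.
have dE : d * (1 + `|q|) = e / 2 by rewrite /d divfK// gt_eqF.
rewrite -[(t q + e)]opprK.
(* A supporting slope at [q] requires a point of the domain to its left. The remaining case is
   [q = 0] with domain the half-line, where the reserved code has the right number of digits. *)
have [[r dr rq]|nr] := pselect (exists2 r, edom T r & r < q).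
  have [h Hh] := supporting_slope noplus concT domT dr rq.
  have [u [ub lo up fr]] := codes (isT : h%:E != -oo%E) Hh.
  have [|i1 H1] := lo (h - d); first by rewrite lte_fin; lra.
  have [|i2 H2] := up (h + d); first by rewrite lte_fin; lra.
  have [|i3 H3] := fr (h * q - t q - d); first lra.
  apply: (@scaling_le_path q (- t q - e / 2) _ u ub); last lra.
  exists (maxn i1 (maxn i2 i3)) => i; rewrite !geq_max => /and3P[/H1 h1 /H2 h2 /H3 h3].
  have B0 : 0 <= (blk i)%:R :> R by [].
  have : `|q * (w i (u i) - h * (blk i)%:R)| <= `|q| * (d * (blk i)%:R).
    rewrite normrM ler_wpM2l// ler_norml; apply/andP; split; lra.
  have := ler_norm (q * (w i (u i) - h * (blk i)%:R)).
  have := congr1 ( *%R^~ (blk i)%:R) dE; rewrite /= mulrDr mulrDl mulr1; lra.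
have dE' : edom T = [set q | 0 <= q].
  case: domT => // dE'; exfalso; apply: nr; exists (q - 1); first by rewrite dE'.
  by rewrite ltrBlDr ltrDl.
have q0 : q = 0.
  move: dq; rewrite dE' /= => q0; apply/eqP; rewrite eq_le q0 andbT leNgt; apply/negP => qp.
  by apply: nr; exists 0 => //; rewrite dE' /=.
rewrite q0.
have [u [ub _ _ fr]] := codes (isT : +oo%E != -oo%E) (legendre_pinfty noplus growth dE').
have [|i3 H3] := fr (- t 0 - e / 2); first lra.
apply: (@scaling_le_path 0 (- t 0 - e / 2) _ u ub); last lra.
by exists i3 => i /H3; rewrite mul0r subr0.
Qed.

Lemma scaling_eq q : scaling_fun psi F q = T q.
Proof.
have [dq|ndq] := pselect (edom T q).
  rewrite (efine dq); apply/eqP; rewrite eq_le; apply/andP; split.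
    by apply/lee_addgt0Pr => e e0; rewrite -EFinD; exact: scaling_le.
  by apply: ereal_le_of_lt => // s; rewrite lte_fin => sq; rewrite scaling_ge.
have Tq : T q = -oo%E by apply/eqP; rewrite -leeNy_eq leNgt; apply/negP.
have dE : edom T = [set q | 0 <= q] by case: domT => // dE; case: ndq; rewrite dE.
have q0 : q < 0 by rewrite ltNge; apply/negP => q0; apply: ndq; rewrite dE.
have [u [ub lo _ _]] := codes (isT : +oo%E != -oo%E) (legendre_pinfty noplus growth dE).
rewrite Tq; apply: contrapT => ne.
have [s Hs] : exists s : R, (s%:E < scaling_fun psi F q)%E.
  case: (scaling_fun psi F q) ne => [r _|_|//]; last by exists 0; exact: ltry.
  by exists (r - 1); rewrite lte_fin; lra.
move: Hs; rewrite ltNge => /negP; apply.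
(* Outside the domain [q < 0], and the reserved code eventually exceeds the slope that makes
   [- q w >= (1 - s) blk]. *)
have [i0 H0] := lo ((1 - s) / - q) (ltry _).
rewrite -[s]opprK; apply: (@scaling_le_path q (1 - s) _ u ub); last lra.
exists i0 => i /H0 h; have nq : 0 < - q by rewrite oppr_gt0.
have := ler_wpM2l (ltW nq) h; rewrite mulrA [- q * _]mulrC divfK ?gt_eqF//.
by have : 0 <= (a i (u i))%:R :> R by []; lra.
Qed.

(** * Upper bounds for the iso-Hoelder sets *)

Local Notation E h := (isoH psi F h).

Lemma isoH_window (h : R) x (e : R) (J : nat) : E h%:E x -> 0 < e -> exists m kap,
  [/\ (J <= m)%N, branch a x kap, (h - e) * (gen m)%:R <= wt m (kap m) &
      wt m (kap m) <= (h + e) * (gen m)%:R].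
Proof.
move=> [/(wsuppP Spsi Opsi a alpha0 wge)[kap bx] hx] e0.
have [|C HC] := hexp_lt_wt Spsi Opsi alpha0 wge (t := h - e / 2) bx.
  by rewrite hx lte_fin; lra.
have [M HM] := gen_large C (divr_gt0 e0 (ltr0n R 2)).
pose P := maxn J M.
(* The subtracted constant forces [m >= P]: at a lower level the bound would make the weight
   negative. *)
have [|m Hm] := hexp_gt_wt Spsi alpha0 wge (t := h + e) (`|h + e| * (gen P)%:R) bx.
  by rewrite hx lte_fin; lra.
have wm : 0 <= wt m (kap m) by have [am _] := bx m; exact: (wt_ge0 alpha0 wge am).
have Pm : (P <= m)%N.
  rewrite leqNgt; apply/negP => mP.
  have gm : (gen m)%:R <= (gen P)%:R :> R by rewrite ler_nat gen_mono// ltnW.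
  have := ler_wpM2l (normr_ge0 (h + e)) gm.
  have := ler_wpM2r (ler0n R (gen m)) (ler_norm (h + e)); lra.
exists m, kap; split => //.
- exact: leq_trans (leq_maxl _ _) Pm.
- by have := HM m (leq_trans (leq_maxr _ _) Pm); have := HC m; lra.
- have : 0 <= `|h + e| * (gen P)%:R by rewrite mulr_ge0.
  lra.
Qed.

(** A Chernoff bound: in the window, [2 ^ (- q wt)] is at least [2 ^ (- (q h + |q| e) gen)], so
    [Z q] controls the number of nodes. *)
Lemma window_count (h q s : R) : edom T q -> h * q - t q < s ->
  exists e eta M, [/\ 0 < e, 0 < eta & forall m, (M <= m)%N ->
   \sum_(0 <= k < 2 ^ gen m | act m k && ((h - e) * (gen m)%:R <= wt m k <= (h + e) * (gen m)%:R))
      2 `^ (- (s * (gen m)%:R)) <= 2 `^ (- (eta * (gen m)%:R))].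
Proof.
move=> dq vs; pose d := s - (h * q - t q); have d0 : 0 < d by rewrite subr_gt0.
pose e := d / 2 / (1 + `|q|); have q1 : 0 < 1 + `|q| by rewrite ltr_pwDl.
have e0 : 0 < e by rewrite divr_gt0// divr_gt0.
have eE : e * (1 + `|q|) = d / 2 by rewrite /e divfK// gt_eqF.
have [M HM] := Z_upper dq e0.
exists e, (d / 2), M; split => //; first by rewrite divr_gt0.
move=> m Mm; pose g : R := (gen m)%:R; have g0 : 0 <= g by [].
apply: (@le_trans _ _ (2 `^ (- (s * g) + (q * h + `|q| * e) * g) * Z q m)).
  rewrite /partition_sum mulr_sumr [leLHS]big_mkcond [leRHS]big_mkcond /=; apply: ler_sum => k _.
  case: (act m k) => //=; case: ifPn => [/andP[h1 h2]|_]; last by rewrite mulr_ge0 ?pow2_ge0.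
  rewrite -pow2D ler_pow2 -/g.
  have : `|q * (wt m k - h * g)| <= `|q| * (e * g).
    by rewrite normrM ler_wpM2l// ler_norml; apply/andP; split; move: h1 h2; rewrite -/g; lra.
  by have := ler_norm (q * (wt m k - h * g)); lra.
apply: (le_trans (ler_wpM2l (pow2_ge0 _) (HM m Mm))); rewrite -pow2D ler_pow2 -/g.
have := congr1 ( *%R^~ g) eE; rewrite /= /d; lra.
Qed.

(** Nodes of the window cover the set at arbitrarily high levels. If [h q - T(q)] were negative, the
    count with [s = 0] would be smaller than 1, while a point of the set provides a node. *)
Lemma isoH_fin_bound (h : R) q : E h%:E !=set0 -> edom T q ->
  0 <= h * q - t q /\ (dimH (E h%:E) <= (h * q - t q)%:E)%E.
Proof.
move=> [x Ex] dq.
have v0 : 0 <= h * q - t q.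
  rewrite leNgt; apply/negP => v0; have [e [eta [M [e0 eta0 HM]]]] := window_count dq v0.
  have [m [kap [Mm bx w1 w2]]] := isoH_window (maxn M 1) Ex e0.
  have M1 : (1 <= m)%N := leq_trans (leq_maxr _ _) Mm.
  have [am _] := bx m.
  have := HM m (leq_trans (leq_maxl _ _) Mm).
  rewrite leNgt => /negP; apply; rewrite mul0r oppr0 powRr0.
  apply: (@lt_le_trans _ _ 1).
    rewrite -[ltRHS](powRr0 (2 : R)) ltr_pow2 oppr_lt0 mulr_gt0// ltr0n.
    exact: leq_trans M1 (leq_gen gen_ltS m).
  rewrite (big_rem (kap m)) ?mem_index_iota ?(act_lt am)//= am w1 w2 lerDl.
  exact: sumr_ge0.
split => //; apply: dimH_le => // s vs s0.
have [e [eta [M [e0 eta0 HM]]]] := window_count dq vs.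
pose bad (j : nat) : pred nat := fun k => `[< exists m, [/\ j = gen m, act m k,
   (h - e) * (gen m)%:R <= wt m k & wt m k <= (h + e) * (gen m)%:R] >].
apply: (@hmeasure_dyadic_eq0 R _ s eta bad) => //.
  move=> J y Ey; have [m [kap [Jm bx w1 w2]]] := isoH_window J Ey e0.
  have [am /andP[y1 y2]] := bx m.
  exists (gen m), (kap m); split.
  - exact: leq_trans Jm (leq_gen gen_ltS m).
  - exact: act_lt am.
  - by apply/asboolP; exists m.
  - by rewrite y1 ltW.
exists (gen M) => j Mj.
have [[m jm]|nj] := pselect (exists m, j = gen m); last first.
  rewrite big1 ?pow2_ge0// => k /asboolP[m [jm _ _ _]].
  by case: nj; exists m.
rewrite jm in Mj *; apply: le_trans (HM m (gen_leq_inv Mj)).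
rewrite [leLHS]big_mkcond [leRHS]big_mkcond /=; apply: ler_sum => k _.
case: ifPn => [/asboolP[m' [/(gen_inj gen_ltS) <- -> -> ->]]//|_].
by case: ifP => _; rewrite ?pow2_ge0.
Qed.

(** On a full domain the finiteness of [T(-1)] bounds every weight linearly in [gen], so no exponent
    is infinite. The dimension bound counts all nodes, that is [q = 0]. *)
Lemma isoH_infty_bound : E +oo%E !=set0 ->
  edom T = [set q | 0 <= q] /\ (dimH (E +oo%E) <= (- t 0)%:E)%E.
Proof.
have all_wt x K : E +oo%E x -> exists kap C, branch a x kap /\ forall m, K * (gen m)%:R - C <= wt m (kap m).
  move=> [/(wsuppP Spsi Opsi a alpha0 wge)[kap bx] hx].
  have [|C HC] := hexp_lt_wt Spsi Opsi alpha0 wge (t := K) bx; first by rewrite hx ltry.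
  by exists kap, C.
have /andP[t1 t0] := @fine0_bounds R T alpha c noplus concT c1 growth domT legendre_ge0.
move=> [x Ex]; split.
  case: domT => // dE; exfalso.
  have d1 : edom T (- 1) by rewrite dE.
  have [M HM] := Z_upper d1 ltr01.
  (* [Z (-1)] allows slope [1 - T(-1)]; one more unit absorbs [C], another gives strictness. *)
  have [kap [C [bx HC]]] := all_wt x (3 - t (- 1)) Ex.
  have [M' HM'] := gen_large C (ltr01 : 0 < 1 :> R).
  pose m := maxn (maxn M M') 1; have [am _] := bx m.
  have Mm : (M <= m)%N by rewrite /m; lia.
  have M'm : (M' <= m)%N by rewrite /m; lia.
  have m1 : (1 <= m)%N by rewrite /m; lia.
  have := HM m Mm; rewrite leNgt => /negP; apply.
  apply: (@lt_le_trans _ _ (2 `^ (- (- 1 * wt m (kap m))))).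
    rewrite ltr_pow2 mulN1r opprK; have := HC m; have := HM' m M'm.
    have : 0 < (gen m)%:R :> R by rewrite ltr0n (leq_trans m1)// leq_gen//; exact: gen_ltS.
    lra.
  rewrite /partition_sum (big_rem (kap m)) ?mem_index_iota ?(act_lt am)//= am lerDl.
  by apply: sumr_ge0 => k _; exact: pow2_ge0.
apply: dimH_le; last by rewrite oppr_ge0.
move=> s vs s0; pose e := (s + t 0) / 2; have e0 : 0 < e by rewrite divr_gt0//; lra.
have [M HM] := Z_upper (edom_ge0 growth (lexx 0)) e0.
pose bad (j : nat) : pred nat := fun k => `[< exists2 m, j = gen m & act m k >].
apply: (@hmeasure_dyadic_eq0 R _ s e bad) => //.
  move=> J y /(all_wt y 0)[kap [C [bx _]]]; have [am /andP[y1 y2]] := bx J.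
  exists (gen J), (kap J); split.
  - exact: leq_gen gen_ltS J.
  - exact: act_lt am.
  - by apply/asboolP; exists J.
  - by rewrite y1 ltW.
exists (gen M) => j Mj.
have [[m jm]|nj] := pselect (exists m, j = gen m); last first.
  by rewrite big1 ?pow2_ge0// => k /asboolP[m jm _]; case: nj; exists m.
rewrite jm in Mj *.
apply: (@le_trans _ _ (2 `^ (- (s * (gen m)%:R)) * Z 0 m)).
  rewrite /partition_sum mulr_sumr [leLHS]big_mkcond [leRHS]big_mkcond /=; apply: ler_sum => k _.
  rewrite mul0r oppr0 powRr0 mulr1.
  case: ifPn => [/asboolP[m' /(gen_inj gen_ltS) <- ->]//|_].
  by case: ifP => _; rewrite ?pow2_ge0.
apply: (le_trans (ler_wpM2l (pow2_ge0 _) (HM m (gen_leq_inv Mj)))).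
rewrite -pow2D ler_pow2 /e; lra.
Qed.

Lemma isoH_upper (h : \bar R) : E h !=set0 ->
  exists g, [/\ h != -oo%E, legendre T h = g%:E & (dimH (E h) <= g%:E)%E].
Proof.
move=> E0; have hN : h != -oo%E.
  have [x [_ hx]] := E0; rewrite -hx.
  by have := hexp_ge0 Spsi a alpha0 wge x; case: (hexp _ _).
have [LN|[g Hg]] := legendre_ninfty_or_fin noplus growth domT hN.
  exfalso; case: h hN E0 LN => [h _ E0 LN|_ E0 LN|//].
    have := @legendre_ge R T noplus h 0; rewrite LN leeNy_eq => /(_ _)/negP; apply => //.
    by move=> q dq; have [] := isoH_fin_bound E0 dq.
  by have [dE _] := isoH_infty_bound E0; move: LN; rewrite (legendre_pinfty noplus growth dE).
exists g; split => //; rewrite -Hg; case: h hN E0 Hg => [h _ E0 _|_ E0 _|//].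
  apply: le_ereal_inf_tmp => _ [q dq <-]; rewrite (efine dq) -EFinB.
  by have [] := isoH_fin_bound E0 dq.
by have [dE] := isoH_infty_bound E0; rewrite (legendre_pinfty noplus growth dE).
Qed.

(** * Lower bound for the dimension below a given node *)

Section LowerBound.
Variables (h : \bar R) (g : R) (u : nat -> nat) (m0 k0 : nat).
Hypothesis h0 : (0 <= h)%E.
Hypothesis ub : forall i, (u i < 2 ^ i.+1)%N.
Hypothesis ulo : forall s : R, (s%:E < h)%E ->
  exists i0, forall i, (i0 <= i)%N -> s * (blk i)%:R <= w i (u i).
Hypothesis uup : forall s : R, (h < s%:E)%E ->
  exists i0, forall i, (i0 <= i)%N -> w i (u i) <= s * (blk i)%:R.
Hypothesis ufr : forall s : R, s < g ->
  exists i0, forall i, (i0 <= i)%N -> s * (blk i)%:R <= (a i (u i))%:R.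
Hypothesis ak0 : act m0 k0.

Definition free_digits (n : nat) : nat := (\sum_(0 <= s < n) a (m0 + s) (u (m0 + s)))%N.

Definition read (y : R) (n : nat) : nat := Num.truncn (2 ^+ free_digits n * y).

(** The codes are imposed by [u], and the free digits of block [m0 + n'] are the next binary digits
    of [y]: the residue of [read y n'.+1] is the part not read before. *)
Fixpoint node (y : R) (n : nat) : nat := if n is n'.+1 then
    let i := (m0 + n')%N in
    (node y n' * 2 ^ blk i +
       ((u i * 2 ^ (i.+1 ^ 2) + read y n'.+1 %% 2 ^ a i (u i)) * 4 + 1))%N
  else k0.

Lemma block_lt i v : (v < 2 ^ (i.+1 ^ 2))%N ->
  ((u i * 2 ^ (i.+1 ^ 2) + v) * 4 + 1 < 2 ^ blk i)%N.
Proof.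
move=> vl.
have -> : (2 ^ blk i = 2 ^ i.+1 * 2 ^ (i.+1 ^ 2) * 4)%N by rewrite /blk !expnD; lia.
have := ub i; have : (0 < 2 ^ (i.+1 ^ 2))%N by rewrite expn_gt0.
move: vl; set L := (2 ^ (i.+1 ^ 2))%N; set U := (2 ^ i.+1)%N; nia.
Qed.

Lemma read_lt y n : (read y n.+1 %% 2 ^ a (m0 + n) (u (m0 + n)) < 2 ^ ((m0 + n).+1 ^ 2))%N.
Proof.
by apply: (@leq_trans (2 ^ a (m0 + n) (u (m0 + n)))); rewrite ?ltn_mod ?expn_gt0// leq_pexp2l.
Qed.

Lemma node_div y n : (node y n.+1 %/ 2 ^ blk (m0 + n) = node y n)%N.
Proof.
by rewrite /= divnMDl ?expn_gt0// (divn_small (block_lt (read_lt y n))) addn0.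
Qed.

Lemma node_mod y n : (node y n.+1 %% 2 ^ blk (m0 + n) =
  (u (m0 + n) * 2 ^ ((m0 + n).+1 ^ 2) + read y n.+1 %% 2 ^ a (m0 + n) (u (m0 + n))) * 4 + 1)%N.
Proof.
by rewrite /= modnMDl (modn_small (block_lt (read_lt y n))).
Qed.

Lemma node_code y n : blk_code (m0 + n)%N (node y n.+1 %% 2 ^ blk (m0 + n))%N = u (m0 + n)%N.
Proof.
rewrite node_mod /blk_code divnMDl// addn0 divnMDl ?expn_gt0//.
by rewrite (divn_small (read_lt y n)) addn0.
Qed.

Lemma node_act y n : act (m0 + n)%N (node y n).
Proof.
elim: n => [|n IH]; first by rewrite addn0.
rewrite addnS /active -/(active a) node_div IH /= /admissible node_code node_mod.
rewrite modnMDl eqxx /= divnMDl// addn0 modnMDl (modn_small (read_lt y n)).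
by rewrite ltn_mod expn_gt0.
Qed.

Lemma node_branch y : exists x, (exists kap, branch a x kap) /\ forall n, inI (m0 + n)%N (node y n) x.
Proof.
by apply: (path_branch alpha0 wge (node_act y)) => n; rewrite node_div.
Qed.

Lemma wt_increment y x kap m : branch a x kap -> (forall n, inI (m0 + n)%N (node y n) x) ->
  (m0 <= m)%N -> wt m.+1 (kap m.+1) - wt m (kap m) = w m (u m).
Proof.
move=> bx nI mm.
have kE n : kap (m0 + n)%N = node y n.
  by have [_ xI] := bx (m0 + n)%N; exact: interval_nat_uniq xI (nI n).
have -> : m = (m0 + (m - m0))%N by rewrite subnKC.
rewrite -addnS !kE addnS /= -/(node y (m - m0).+1).
have := node_div y (m - m0); have := node_code y (m - m0) => /= -> ->.
by rewrite addrAC subrr add0r.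
Qed.

Lemma node_isoH y x : (exists kap, branch a x kap) -> (forall n, inI (m0 + n)%N (node y n) x) ->
  E h x.
Proof.
move=> [kap bx] nI; split; first by apply/(wsuppP Spsi Opsi a alpha0 wge); exists kap.
apply: (hexp_eq_of_wt Spsi Opsi alpha0 wge bx h0).
  move=> s sh; apply: (@increments_ge R (fun m => wt m (kap m)) s).
  have [i0 H] := ulo sh; exists (maxn i0 m0) => i; rewrite geq_max => /andP[ii im].
  by rewrite (wt_increment bx nI im) H.
move=> s C hs.
have [s' [hs' s's]] : exists s' : R, (h < s'%:E)%E /\ s' < s.
  case: (h) h0 hs => [r|//|//] _; rewrite lte_fin => rs.
  by exists ((r + s) / 2); rewrite lte_fin; split; lra.
have [|C' HC'] := @increments_le R (fun m => wt m (kap m)) s'.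
  have [i0 H] := uup hs'; exists (maxn i0 m0) => i; rewrite geq_max => /andP[ii im].
  by rewrite (wt_increment bx nI im) H.
have ss : 0 < s - s' by rewrite subr_gt0.
have [M HM] := gen_large (C + C' + 1) ss.
by exists M; have := HM M (leqnn _); have := HC' M; lra.
Qed.

Lemma free_digitsS n : free_digits n.+1 = (free_digits n + a (m0 + n) (u (m0 + n)))%N.
Proof. by rewrite /free_digits big_nat_recr. Qed.

Lemma read_bounds y n : 0 <= y -> (read y n)%:R <= 2 ^+ free_digits n * y < (read y n)%:R + 1.
Proof.
by move=> y0; have := truncn_itv (mulr_ge0 (exprn_ge0 (free_digits n) (ler0n R 2)) y0); rewrite natr1.
Qed.

Lemma readS y n : 0 <= y -> (read y n.+1 %/ 2 ^ a (m0 + n) (u (m0 + n)) = read y n)%N.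
Proof.
move=> y0; have := read_bounds n.+1 y0.
rewrite free_digitsS addnC exprD -mulrA => /dyadic_interval_div h1.
exact: interval_nat_uniq h1 (read_bounds n y0).
Qed.

Lemma node_read y y' n : 0 <= y < 1 -> 0 <= y' < 1 -> node y n = node y' n -> read y n = read y' n.
Proof.
move=> /andP[y0 y1] /andP[y'0 y'1]; elim: n => [|n IH] E.
  have r0 z : 0 <= z -> z < 1 -> read z 0 = 0%N.
    move=> z0 z1; rewrite /read /free_digits big_nil expr0 mul1r.
    by apply/eqP; rewrite truncn_eq// z0.
  by rewrite !r0.
have e1 : node y n = node y' n by rewrite -(node_div y) -(node_div y') E.
have := node_mod y n; rewrite E node_mod => /eqP; rewrite eqn_add2r eqn_pmul2r// eqn_add2l => /eqP e2.
by rewrite (divn_eq (read y n.+1) (2 ^ a (m0 + n) (u (m0 + n)))) (readS n y0) (IH e1) -e2 -(readS n y'0) -divn_eq.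
Qed.

Lemma node_close y y' n : 0 <= y < 1 -> 0 <= y' < 1 -> node y n = node y' n ->
  `|y - y'| <= 2 `^ (- (free_digits n)%:R).
Proof.
move=> hy hy' /(node_read hy hy') E.
have /andP[y0 _] := hy; have /andP[y'0 _] := hy'.
have p2 : 0 < 2 ^+ free_digits n :> R by rewrite exprn_gt0.
rewrite powRN pow2_nat -div1r ler_pdivlMr// -[X in _ * X]gtr0_norm// -normrM mulrC mulrBr.
apply: unit_interval_dist (read_bounds n y0) _.
by rewrite E; exact: read_bounds.
Qed.

(** The generation is that of the following level: numbers that agree on [n] blocks are told apart
    by points only after one more block. *)
Lemma free_digits_ge (s : R) : 0 < s -> s < g ->
  exists C, forall n, s * (gen (m0 + n).+1)%:R - C <= (free_digits n)%:R.
Proof.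
move=> s0 sg; pose s' := (s + g) / 2.
have [|C HC] := @increments_ge R (fun m => (free_digits (m - m0))%:R) s'.
  have [|i0 H] := @ufr s'; first by rewrite /s'; lra.
  exists (maxn i0 m0) => i; rewrite geq_max => /andP[ii im].
  by rewrite subSn// free_digitsS subnKC// natrD addrAC subrr add0r H.
have [|C2 [C20 HC2]] := @blk_small R ((s' - s) / s); first by rewrite divr_gt0// /s'; lra.
exists (C + s * C2) => n; have := HC (m0 + n)%N; rewrite addKn.
have := ler_wpM2l (ltW s0) (HC2 (m0 + n)%N); rewrite mulrDr mulrA mulrCA mulfV ?gt_eqF// mulr1.
by rewrite /= natrD; lra.
Qed.

(** If [y] and [y'] first separate after [n] common blocks, then
    [|y - y'| <= 2 ^ (- free_digits n)], while their points are at least [2 ^ (- gen (m0 + n).+1)]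
    apart. Orders [s <= 0] only need a nonempty set, which covers [g = 0]. *)
Lemma isoH_lower : (E h `&` [set x | inI m0 k0 x]) !=set0 /\
  (g%:E <= dimH (E h `&` [set x | inI m0 k0 x]))%E.
Proof.
have [phi Hphi] := choice node_branch.
have Ephi y : (E h `&` [set x | inI m0 k0 x]) (phi y).
  have [bx nI] := Hphi y; split; first exact: node_isoH nI.
  by have := nI 0%N; rewrite addn0.
split; first by exists (phi 0).
apply: ereal_le_of_lt => // s; rewrite lte_fin => sg.
have [s0|s0] := leP s 0.
  by apply: le_trans (dimH_ge0 (ex_intro _ _ (Ephi 0))); rewrite lee_fin.
have [C HC] := free_digits_ge s0 sg.
apply: (@dimH_ge_of_holder R _ s (2 `^ C) phi) => // y y' hy hy'.
have [->|yy'] := eqVneq y y'.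
  by rewrite subrr normr0 mulr_ge0 ?powR_ge0.
(* Distinct numbers do separate: since [0 < s < g], the number of digits read tends to infinity. *)
have ex : exists n, node y n != node y' n.
  apply: contrapT => /forallNP H.
  have eqn n : node y n = node y' n by apply/eqP; rewrite -[_ == _]negbK; apply/negP/H.
  have d0 : 0 < `|y - y'| by rewrite normr_gt0 subr_eq0.
  have [M HM] := gen_large (C + `|y - y'|^-1) s0.
  have [n Hn] : exists n, `|y - y'|^-1 <= (free_digits n)%:R.
    exists M; apply: le_trans (HC M).
    have := HM (m0 + M).+1 (leqW (leq_addl _ _)); lra.
  have := node_close hy hy' (eqn n); rewrite powRN pow2_nat leNgt => /negP; apply.
  rewrite -[ltRHS]invrK ltf_pV2 ?posrE ?invr_gt0 ?exprn_gt0//.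
  by apply: (le_lt_trans Hn); rewrite -natrX ltr_nat ltn_expl.
have := ex_minnP ex; case: ex_minnP => -[|n] neq least _; first by case/eqP: neq.
have eqn : node y n = node y' n.
  by apply/eqP; rewrite -[_ == _]negbK; apply/negP => /least; rewrite ltnn.
apply: (le_trans (node_close hy hy' eqn)).
pose G := gen (m0 + n).+1.
have far : 2 `^ (- G%:R) <= `|phi y - phi y'|.
  have [_ nI] := Hphi y; have [_ nI'] := Hphi y'.
  have := nI n.+1; have := nI' n.+1; rewrite addnS /in_node -/G => /andP[b1 b2] /andP[a1 a2].
  have A : act (m0 + n).+1 (node y n.+1) by rewrite -addnS; exact: node_act.
  have A' : act (m0 + n).+1 (node y' n.+1) by rewrite -addnS; exact: node_act.
  have p2 : 0 < 2 ^+ G :> R by rewrite exprn_gt0.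
  rewrite powRN pow2_nat -div1r ler_pdivrMr// -[X in _ * X]gtr0_norm// -normrM mulrC mulrBr.
  have [h1|h1] := leqP (node y n.+1 + 4) (node y' n.+1).
    have h2 : ((node y n.+1)%:R + 4 <= (node y' n.+1)%:R :> R) by rewrite -natrD ler_nat.
    by rewrite distrC; apply: le_trans (ler_norm _); lra.
  have [h1'|h1'] := leqP (node y' n.+1 + 4) (node y n.+1).
    have h2 : ((node y' n.+1)%:R + 4 <= (node y n.+1)%:R :> R) by rewrite -natrD ler_nat.
    by apply: le_trans (ler_norm _); lra.
  case/eqP: neq; apply: act_sep A A' _ _.
    by move: h1'; rewrite addnS ltnS.
  by move: h1; rewrite addnS ltnS.
apply: (@le_trans _ _ (2 `^ C * (2 `^ (- G%:R)) `^ s)).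
  by rewrite -powRrM -pow2D ler_pow2; have := HC n; rewrite -/G; lra.
apply: ler_wpM2l; first exact: pow2_ge0.
by apply: ge0_ler_powR => //; rewrite ?nnegrE ?pow2_ge0 ?(ltW s0).
Qed.

End LowerBound.

Lemma isoH_lower_node (h : \bar R) g m0 k0 : h != -oo%E -> legendre T h = g%:E -> act m0 k0 ->
  (E h `&` [set x | inI m0 k0 x]) !=set0 /\ (g%:E <= dimH (E h `&` [set x | inI m0 k0 x]))%E.
Proof.
move=> hN Hg ak; have [u [ub lo up fr]] := codes hN Hg.
apply: (@isoH_lower h g u m0 k0) => //.
case: h hN Hg {lo up} => [h _ Hg|//|//].
rewrite lee_fin; apply: le_trans (ltW alpha0) _.
exact: (legendre_slope_ge noplus growth Hg).
Qed.

Lemma isoH_dim (h : \bar R) : (0 <= h)%E -> dimH (E h) = legendre T h.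
Proof.
move=> h0; have hN : h != -oo%E by case: (h) h0.
have [E0|/set0P E0] := eqVneq (E h) set0.
  rewrite E0 dimH_set0; have [->//|[g Hg]] := legendre_ninfty_or_fin noplus growth domT hN.
  have [[x [Ex _]] _] := @isoH_lower_node h g 0 0 hN Hg (eqxx _).
  by move: Ex; rewrite E0.
have [g [_ Hg up]] := isoH_upper E0.
apply/eqP; rewrite eq_le {1}Hg up /= Hg.
have [_ lo] := @isoH_lower_node h g 0 0 hN Hg (eqxx _).
by apply: (le_trans lo); apply: dimHS; exact: subIsetl.
Qed.

(** A ball that meets the support contains the interval of some node, and the lower bound is the
    same below every node. *)
Lemma isoH_ball_dim (h : \bar R) g x r : E h !=set0 -> legendre T h = g%:E -> 0 < r ->
  [set y | `|y - x| < r] `&` wsupp psi F !=set0 ->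
  dimH (E h `&` [set y | `|y - x| <= r]) = g%:E.
Proof.
move=> E0 Hg r0 [y [/= yr /(wsuppP Spsi Opsi a alpha0 wge)[kap by_]]].
have [g' [hN Hg' up]] := isoH_upper E0.
have gE : g' = g by move: Hg'; rewrite Hg => -[].
rewrite gE in up.
apply/eqP; rewrite eq_le; apply/andP; split.
  by apply: le_trans up; apply: dimHS; exact: subIsetl.
have d0 : 0 < r - `|y - x| by rewrite subr_gt0.
have [M HM] := gen_large (r - `|y - x|)^-1 (ltr01 : 0 < 1 :> R).
have [am yI] := by_ M.
have [_ lo] := isoH_lower_node hN Hg am.
apply: (le_trans lo); apply: dimHS => z [Ez zI]; split => //=.
have p2 : 0 < 2 ^+ gen M :> R by rewrite exprn_gt0.
have zy : `|z - y| <= (2 ^+ gen M)^-1.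
  rewrite -div1r ler_pdivlMr// -[X in _ * X]gtr0_norm// -normrM mulrC mulrBr.
  exact: unit_interval_dist zI yI.
have small : (2 ^+ gen M)^-1 <= r - `|y - x|.
  rewrite -[leRHS]invrK lef_pV2 ?posrE ?invr_gt0//.
  have := HM M (leqnn _); rewrite mul1r => /le_trans; apply.
  by rewrite -natrX ler_nat ltnW// ltn_expl.
by have := ler_normD (z - y) (y - x); rewrite addrA subrK; lra.
Qed.

Lemma cascade_homogeneous : homogeneously_multifractal psi F.
Proof.
move=> h x1 r1 x2 r2 r10 r20 b1 b2.
have [E0|/set0P E0] := eqVneq (E h) set0; first by rewrite E0 !set0I.
have [g [_ Hg _]] := isoH_upper E0.
by rewrite (isoH_ball_dim E0 Hg r10 b1) (isoH_ball_dim E0 Hg r20 b2).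
Qed.

End Assembly.

Unset Implicit Arguments.

Theorem theorem1p12 (R : realType) (psi : R -> R) (T : R -> \bar R) :
  schwartz psi -> orthonormal_wavelet psi ->
  (* T : R -> R ∪ {-oo} *)
  (forall q, T q != +oo%E) ->
  (* non-decreasing *)
  (forall p q : R, p <= q -> (T p <= T q)%E) ->
  (* concave *)
  (forall (p q t : R), (0 < t)%R -> (t < 1)%R ->
     (t%:E * T p + (1 - t)%R%:E * T q <= T (t * p + (1 - t) * q)%R)%E) ->
  (* (i) *)
  (exists alpha c : R, 0 < alpha /\ (0 <= c)%R /\ (c <= 1)%R /\
     forall q, 0 <= q -> ((alpha * q - c)%R%:E <= T q)%E) ->
  (* (ii) *)
  (edom T = setT \/ edom T = [set q | 0 <= q]) ->
  (forall h : \bar R, h != -oo%E -> (-oo < legendre T h)%E ->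
     (0 <= legendre T h)%E) ->
  (* (iii) *)
  (0 < inf [set q : R | 0 <= q /\ (0 < T q)%E] \/
   exists d : R, 0 < d /\
     ((fun h : R => ((T h - T 0%R) * (h^-1)%R%:E)%E) @ 0^'+ --> d%:E) /\
     (forall q : R, 0 < q -> T q = (d * q)%:E)) ->
  exists F : R -> R,
    bounded_real_fun F /\ holder_continuous F /\
    homogeneously_multifractal psi F /\
    wsupp psi F `<=` [set x | (0 <= x)%R /\ (x <= 1)%R] /\
    (forall q : R, scaling_fun psi F q = T q) /\
    (forall h : \bar R, (0 <= h)%E ->
       dimH (isoH psi F h) = legendre (scaling_fun psi F) h).
Proof.
move=> Spsi Opsi noplus _ concT [alpha [c [alpha0 [_ [c1 growth]]]]] domT Lge0 _.
have wge := @weight_ge R T alpha c noplus concT growth domT Lge0.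
exists (cascade psi (digits T) (weight T alpha)).
split; first exact: (cascade_bounded Spsi (digits T) alpha0 wge).
split; first exact: (cascade_holder Spsi (digits T) alpha0 wge).
split; first exact: (cascade_homogeneous Spsi Opsi noplus concT alpha0 c1 growth domT Lge0).
split; first by move=> x [/andP[x0 x1] _].
have TE := scaling_eq Spsi Opsi noplus concT alpha0 c1 growth domT Lge0.
split => [//|h h0]; rewrite (_ : scaling_fun psi _ = T); last exact/funext.
exact: (isoH_dim Spsi Opsi noplus concT alpha0 c1 growth domT Lge0).
Qed.
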